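(* Let $x_0,y_0\in \mathbb{R}^n$ with $x_0\neq y_0$ and $\alpha,\beta\in \mathbb{R}$ with $\alpha\ne\beta$. Then there is an extremal $u$ which satisfies $u(x_0)=\alpha$ and $u(y_0)=\beta$ and whose $1-n/p$ Hölder ratio is maximized at $x_0$ and $y_0$, i.e. $$[u]_{C^{1-n/p}(\mathbb{R}^n)}=\frac{|u(x_0)-u(y_0)|}{|x_0-y_0|^{1-n/p}}.$$
   Context: Throughout, $n\ge 1$ is an integer and $n<p<\infty$. $\mathcal{D}^{1,p}(\mathbb{R}^n)$ is the space of $u\in L^1_{\mathrm{loc}}(\mathbb{R}^n)$ whose weak first-order partial derivatives all belong to $L^p(\mathbb{R}^n)$. Every such $u$ has a Hölder continuous representative and is always identified with it. Put $[u]_{C^{1-n/p}(\mathbb{R}^n)}:=\sup_{x\ne y}\frac{|u(x)-u(y)|}{|x-y|^{1-n/p}}$ and $\|Du\|_{L^p(\mathbb{R}^n)}:=\left(\int_{\mathbb{R}^n}|Du|^p\,dx\right)^{1/p}$. Morrey's inequality says there is a finite constant $C$ with $[u]_{C^{1-n/p}(\mathbb{R}^n)}\le C\|Du\|_{L^p(\mathbb{R}^n)}$ for all $u\in\mathcal{D}^{1,p}(\mathbb{R}^n)$; $C_*$ denotes the sharp (smallest) such constant. An extremal is a function $u\in\mathcal{D}^{1,p}(\mathbb{R}^n)$ with $[u]_{C^{1-n/p}(\mathbb{R}^n)}=C_*\|Du\|_{L^p(\mathbb{R}^n)}$. *)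

(* Defs.v *)
From HB Require Import structures.
From mathcomp Require Import all_boot all_order all_algebra.
From mathcomp Require Import all_classical all_reals all_analysis.
Set Implicit Arguments.
Unset Strict Implicit.
Unset Printing Implicit Defensive.
Import Order.TTheory GRing.Theory Num.Theory numFieldNormedType.Exports.
Local Open Scope classical_set_scope.
Local Open Scope ring_scope.

Definition rV_display : measure_display.
Proof. exact: default_measure_display. Qed.

Section rV_measurable.
Context {R : realType} {n : nat}.

Let coord (i : 'I_n) (x : 'rV[R]_n) : measurableTypeR R := x ord0 i.

Let rV_set0 : g_sigma_preimage coord set0.
Proof. exact: sigma_algebra0. Qed.

Let rV_setC A : g_sigma_preimage coord A -> g_sigma_preimage coord (~` A).
Proof. exact: sigma_algebraC. Qed.

Let rV_bigcup (F : (set 'rV[R]_n)^nat) : (forall i, g_sigma_preimage coord (F i)) ->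
  g_sigma_preimage coord (\bigcup_i (F i)).
Proof. exact: sigma_algebra_bigcup. Qed.

(* The sigma-algebra generated by the coordinates, that is, the Borel
   sigma-algebra of R^n. *)
HB.instance Definition _ := @isMeasurable.Build rV_display 'rV[R]_n
  (g_sigma_preimage coord) rV_set0 rV_setC rV_bigcup.

End rV_measurable.

Lemma measurable_coord (R : realType) n (i : 'I_n) :
  measurable_fun [set: 'rV[R]_n] (fun x : 'rV[R]_n => x ord0 i).
Proof.
move=> _ Y mY; rewrite setTI; apply: sub_sigma_algebra => /=.
rewrite -bigcup_seq/=; exists i => /=; first by rewrite mem_index_enum.
by exists Y => //; rewrite setTI.
Qed.

Lemma measurable_fun_rVP d (T : measurableType d) (R : realType) n
    (f : T -> 'rV[R]_n) :
  (forall i, measurable_fun [set: T] (fun t => f t ord0 i)) ->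
  measurable_fun [set: T] f.
Proof.
move=> mf _ A mA; rewrite setTI.
suff : (@measurable _ 'rV[R]_n) `<=` [set B | measurable (f @^-1` B)] by exact.
apply: smallest_sub.
  split => /=; first by rewrite preimage_set0.
    by move=> B mB; rewrite setTD preimage_setC; exact: measurableC.
  move=> F mF; rewrite preimage_bigcup.
  exact: (@bigcupT_measurable _ T (fun k => f @^-1` F k) mF).
rewrite -bigcup_seq; apply: bigcup_sub => i _ _ [Y mY <-] /=.
by rewrite setTI; have := mf i measurableT Y mY; rewrite setTI.
Qed.

Section rV_lebesgue.
Context {R : realType}.

Definition rV_cons n (z : measurableTypeR R * 'rV[R]_n) : 'rV[R]_n.+1 :=
  @row_mx R 1 1 n (z.1)%:M z.2.

Definition rV_uncons n (v : 'rV[R]_n.+1) : measurableTypeR R * 'rV[R]_n :=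
  (v ord0 ord0, @rsubmx R 1 1 n v).

Lemma rV_cons0 n (a : measurableTypeR R) (v : 'rV[R]_n) :
  rV_cons (a, v) ord0 ord0 = a.
Proof. by rewrite mxE; case: splitP => // j _; rewrite !ord1 mxE mulr1n. Qed.

Lemma rV_consS n (a : measurableTypeR R) (v : 'rV[R]_n) (j : 'I_n) :
  rV_cons (a, v) ord0 (lift ord0 j) = v ord0 j.
Proof. by rewrite -rshift1; exact: (@row_mxEr R 1 1 n). Qed.

Lemma measurable_rV_cons n : measurable_fun setT (@rV_cons n).
Proof.
apply: measurable_fun_rVP => i.
case: (unliftP (ord0 : 'I_n.+1) i) => [j|] ->.
- rewrite (_ : (fun _ => _) =
      (fun z : measurableTypeR R * 'rV[R]_n => z.2 ord0 j)).
    apply: (measurableT_comp (@measurable_coord R n j)); exact: measurable_snd.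
  by apply/funext => -[a v]; rewrite rV_consS.
- rewrite (_ : (fun _ => _) = fst); first exact: measurable_fst.
  by apply/funext => -[a v]; rewrite rV_cons0.
Qed.

Lemma measurable_rV_uncons n : measurable_fun setT (@rV_uncons n).
Proof.
apply/measurable_fun_pairP; split; first exact: measurable_coord.
apply: measurable_fun_rVP => i; rewrite (_ : (fun _ => _) =
  (fun v : 'rV[R]_n.+1 => v ord0 (rshift 1 i))); first exact: measurable_coord.
by apply/funext => v /=; rewrite mxE.
Qed.

Lemma rV_consK n : cancel (@rV_cons n) (@rV_uncons n).
Proof.
by move=> [a v]; rewrite /rV_uncons rV_cons0 /rV_cons row_mxKr.
Qed.

Section step.
Context n (mu : {sigma_finite_measure set 'rV[R]_n -> \bar R}).

Definition rV_prod : set 'rV[R]_n.+1 -> \bar R :=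
  pushforward (lebesgue_measure \x mu)%E (@rV_cons n).

Let step0 : rV_prod set0 = 0%E.
Proof. by rewrite /rV_prod /pushforward preimage_set0 measure0. Qed.

Let step_ge0 A : (0 <= rV_prod A)%E.
Proof. by rewrite /rV_prod /pushforward; exact: measure_ge0. Qed.

Let step_sigma_additive : semi_sigma_additive rV_prod.
Proof.
exact: (@measure_semi_sigma_additive _ _ _
  (measure_function_pushforward__canonical__measure_function_Measure
     (lebesgue_measure \x mu)%E (@measurable_rV_cons n))).
Qed.

HB.instance Definition _ :=
  isMeasure.Build _ _ _ rV_prod step0 step_ge0 step_sigma_additive.

Let step_sigma_finite : sigma_finite setT rV_prod.
Proof.
have /sigma_finiteP[F [TF ndF Foo]] := sigma_finiteT (@lebesgue_measure R).
have /sigma_finiteP[G [TG ndG Goo]] := sigma_finiteT mu.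
exists (fun k => @rV_uncons n @^-1` (F k `*` G k)).
  rewrite -preimage_bigcup -[LHS](preimage_setT (@rV_uncons n)); congr (_ @^-1` _).
  apply/esym; rewrite -subTset => -[x y] _.
  have [i _ Fix] : (\bigcup_k F k) x by rewrite -TF.
  have [j _ Gjy] : (\bigcup_k G k) y by rewrite -TG.
  exists (maxn i j) => //; split.
  - by move: x Fix; exact/subsetPset/ndF/leq_maxl.
  - by move: y Gjy; exact/subsetPset/ndG/leq_maxr.
move=> k; have [mF Fk] := Foo k; have [mG Gk] := Goo k; split.
  rewrite -[X in measurable X]setTI; apply: measurable_rV_uncons => //.
  exact: measurableX.
rewrite /rV_prod /pushforward -comp_preimage (_ : _ \o _ = id) ?preimage_id//.
  by rewrite product_measure1E// lte_mul_pinfty// ge0_fin_numE.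
by apply/funext => z; exact: rV_consK.
Qed.

HB.instance Definition _ :=
  Measure_isSigmaFinite.Build _ _ _ rV_prod step_sigma_finite.
End step.
End rV_lebesgue.

(* Lebesgue measure on the Borel sets of R^n, as the n-fold product of the
   one-dimensional one; see rV_lebesgue_box. *)
Fixpoint rV_lebesgue (R : realType) n :
    {sigma_finite_measure set 'rV[R]_n -> \bar R} :=
  if n is m.+1 then rV_prod (rV_lebesgue R m) else dirac (0 : 'rV[R]_0).

Lemma rV_lebesgue_box (R : realType) n (A : 'I_n -> set (measurableTypeR R)) :
  (forall i, measurable (A i)) ->
  (rV_lebesgue R n [set x : 'rV[R]_n | forall i, A i (x ord0 i)] =
   \prod_(i < n) lebesgue_measure (A i))%E.
Proof.
elim: n A => [|n IHn] A mA.
  by rewrite big_ord0 /= diracE mem_set// => -[].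
rewrite big_ord_recl -IHn//= -product_measure1E//; last first.
  rewrite (_ : [set _ | _] = \bigcap_(i in [set: 'I_n])
      ((fun x : 'rV[R]_n => x ord0 i) @^-1` A (lift ord0 i))).
    apply: fin_bigcap_measurable => [|i _]; first exact: finite_finset.
    by have := @measurable_coord R n i measurableT _ (mA (lift ord0 i)); rewrite setTI.
  by apply/seteqP; split=> x /= h i; [move=> _; exact: h|exact: (h i I)].
congr (product_measure1 _ _ _); apply/seteqP; split=> -[a v] /=.
  move=> h; split=> [|i]; first by have := h ord0; rewrite rV_cons0.
  by have := h (lift ord0 i); rewrite rV_consS.
move=> [Aa Av] i; case: (unliftP (ord0 : 'I_n.+1) i) => [j|] ->.
  by rewrite rV_consS; exact: Av.
by rewrite rV_cons0.
Qed.

Section morrey.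
Context {R : realType} {n : nat}.
Implicit Types (u phi g : 'rV[R]_n -> R) (x y : 'rV[R]_n) (i : 'I_n) (p : R).

Local Notation leb := (rV_lebesgue R n).

(* The library norm on 'rV[R]_n is the sup norm. *)
Definition enorm x : R := Num.sqrt (\sum_i x ord0 i ^+ 2).

Definition locally_integrable_rV u : Prop :=
  measurable_fun setT u /\
  forall K : set 'rV[R]_n, compact K -> (\int[leb]_(x in K) `|u x|%:E < +oo)%E.

Definition partial i phi : 'rV[R]_n -> R := fun x => 'D_(delta_mx ord0 i) phi x.

Definition iter_partial (s : seq 'I_n) phi : 'rV[R]_n -> R := foldr partial phi s.

Definition smooth phi : Prop := forall s : seq 'I_n,
  continuous (iter_partial s phi) /\
  forall i x, derivable (iter_partial s phi) x (delta_mx ord0 i).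

Definition test_function phi : Prop :=
  smooth phi /\ compact (closure [set x | phi x != 0]).

Definition is_weak_partial i u g : Prop :=
  locally_integrable_rV g /\
  forall phi, test_function phi ->
    \int[leb]_x (u x * partial i phi x) = - \int[leb]_x (g x * phi x).

(* Junk value 0 if u has no i-th weak partial derivative; otherwise unique up to
   a null set. *)
Definition weak_partial i u : 'rV[R]_n -> R :=
  xget (fun=> 0) [set g | is_weak_partial i u g].

Definition weak_grad u : 'rV[R]_n -> 'rV[R]_n :=
  fun x => \row_i weak_partial i u x.

(* Continuity selects the Hoelder continuous representative: two continuous
   functions that agree almost everywhere are equal. *)
Definition D1p p u : Prop :=
  [/\ continuous u,
      locally_integrable_rV u &
      forall i, exists2 g, is_weak_partial i u g & g \in Lfun leb p%:E].

Definition grad_norm p u : \bar R :=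
  'N[leb]_(p%:E)[EFin \o (enorm \o weak_grad u)]%E.

Definition holder_ratio p u x y : R :=
  `|u x - u y| / (enorm (x - y) `^ (1 - n%:R / p)).

Definition holder_seminorm p u : \bar R :=
  ereal_sup [set r | exists x y, x != y /\ r = (holder_ratio p u x y)%:E].

Definition morrey_bound p (C : R) : Prop :=
  forall u, D1p p u -> (holder_seminorm p u <= C%:E * grad_norm p u)%E.

End morrey.

(* Extended-real infimum: it would be +oo if no finite bound existed. *)
Definition morrey_constant (R : realType) (n : nat) (p : R) : \bar R :=
  ereal_inf [set C%:E | C in @morrey_bound R n p].

Definition extremal (R : realType) (n : nat) (p : R) (u : 'rV[R]_n -> R) : Prop :=
  D1p p u /\ (holder_seminorm p u = morrey_constant n p * grad_norm p u)%E.

(* Main.v *)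
(* Minimise the Dirichlet energy [E(u) = \int |Du|^p] among the functions with [u x0 = alpha] and
   [u y0 = beta]. By uniform convexity of the p-th power of the norm, the gradients of a minimising
   sequence form a Cauchy sequence in [L^p]; Morrey's inequality between a pair of points then makes
   the functions converge, and the limit [v] attains the infimum [m].  Affine normalisation turns
   minimality into [|u x0 - u y0|^p m <= |alpha - beta|^p E(u)] for every [u], and the similarities
   of [R^n], which act transitively on pairs of distinct points and scale both sides alike, carry
   this estimate to every other pair.  So it is the sharp Morrey inequality, and [v] is an extremal
   whose Hoelder ratio is largest at [x0] and [y0]. *)
Require Import Defs.
From mathcomp Require Import all_boot all_order all_algebra.
From mathcomp Require Import all_classical all_reals all_analysis.
From mathcomp Require Import measurable_realfun.
From mathcomp Require Import ring lra.
Set Implicit Arguments.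
Unset Strict Implicit.
Unset Printing Implicit Defensive.
Import Order.TTheory GRing.Theory Num.Theory numFieldNormedType.Exports.
Local Open Scope classical_set_scope.
Local Open Scope ring_scope.

(** * Borel sets and changes of variables in R^n *)

(** The inequality for one pair of points rests on a smooth product bump [eta]. A rescaled or
    translated copy of [eta] with the same mass differs from it by the divergence of a test field,
    so the two averages of [u] differ by a bounded amount once the energy of [u] is at most 1.
    Halving the scale multiplies the energy by 2^(n - p), which is below 1 because p > n. The errors
    over dyadic scales are therefore summed by a geometric series, and the averages tend to a point
    value of [u].

    Uniform convexity comes from strict midpoint convexity by compactness, in a homogeneous form
    that covers every p > 1 at once. Integrals are transported along similarities only; the factor
    of each map is read off a set that it scales in an obvious way, a ball for orthogonal maps and a
    cube for dilations.

    With m the minimal energy, the sharp constant is |alpha - beta| m^(-1/p) |x0 - y0|^(n/p - 1).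
    Gradients are carried as explicit vector fields; uniqueness of weak derivatives links them to
    the field chosen in [weak_grad]. *)

Section boxes.
Context {R : realType} {n : nat}.
Implicit Types a b c x : 'rV[R]_n.
Local Notation leb := (rV_lebesgue R n).

Definition obox a b : set 'rV[R]_n :=
  [set x | forall i, a ord0 i < x ord0 i < b ord0 i].

Definition cube (r : R) : set 'rV[R]_n := obox (const_mx (- r)) (const_mx r).

Lemma cubeP r x : cube r x <-> forall i, `|x ord0 i| < r.
Proof.
by split=> h i; have := h i; rewrite ltr_norml !mxE.
Qed.

Lemma measurable_coord_preimage i (Y : set R) : measurable (Y : set (measurableTypeR R)) ->
  measurable [set x : 'rV[R]_n | Y (x ord0 i)].
Proof. by move=> mY; have := @measurable_coord R n i measurableT _ mY; rewrite setTI. Qed.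

Lemma measurable_obox a b : measurable (obox a b).
Proof.
rewrite (_ : obox a b = \bigcap_(i in [set: 'I_n])
    [set x | `]a ord0 i, b ord0 i[%classic (x ord0 i)]).
  apply: fin_bigcap_measurable => [|i _]; first exact: finite_finset.
  by apply: measurable_coord_preimage; exact: measurable_itv.
apply/seteqP; split=> x /= h i; first by move=> _; have := h i; rewrite /= in_itv.
by have := h i I; rewrite /= in_itv.
Qed.

Lemma coord_norm_le x i : `|x ord0 i| <= `|x|.
Proof. by rewrite [leRHS]mx_normrE; exact: (le_bigmax _ (fun ij => `|x ij.1 ij.2|) (ord0, i)). Qed.

Lemma cube_mono (r s : R) : r <= s -> cube r `<=` cube s.
Proof. by move=> rs x /cubeP xr; apply/cubeP => i; exact: lt_le_trans (xr i) rs. Qed.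

Lemma cube_ge (x : 'rV[R]_n) : exists N : nat, cube N.+1%:R x.
Proof.
exists (Num.bound `|x|); apply/cubeP => i.
apply: le_lt_trans (coord_norm_le _ _) _.
by rewrite (lt_trans (archi_boundP _))// ltr_nat.
Qed.

Lemma cube_cover : \bigcup_k cube k.+1%:R = setT.
Proof. by rewrite -subTset => x _; have [N xN] := cube_ge x; exists N. Qed.

Lemma obox_setI : setI_closed (range (fun ab => obox ab.1 ab.2)).
Proof.
move=> _ _ [[a b] _ <-] [[c d] _ <-] /=.
exists (\row_i Num.max (a ord0 i) (c ord0 i), \row_i Num.min (b ord0 i) (d ord0 i)) => //=.
apply/seteqP; split=> x /=.
  by move=> h; split=> i; have := h i;
    rewrite !mxE gt_max lt_min => /andP[/andP[? ?] /andP[? ?]]; apply/andP; split.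
move=> [h k] i; move: (h i) (k i).
by rewrite !mxE gt_max lt_min => /andP[-> ->] /andP[-> ->].
Qed.

Lemma measurable_oboxE : @measurable _ 'rV[R]_n = <<s range (fun ab => obox ab.1 ab.2) >>.
Proof.
set G := range _.
apply/seteqP; split; last first.
  apply: smallest_sub; first exact: sigma_algebra_measurable.
  by move=> _ [[a b] _ <-]; exact: measurable_obox.
suff idm : measurable_fun setT (id : g_sigma_algebraType G -> 'rV[R]_n).
  by move=> A mA; have := idm measurableT A mA; rewrite setTI.
apply: measurable_fun_rVP => i.
apply: (measurability _ (RGenOInfty.measurableE R)) => _ [_ [r ->] <-]; rewrite setTI.
(* The half-space x_i > r is the union of boxes bounded below by r in direction i and by -(k+1) in
   the others, with all upper bounds equal to k+1. *)
rewrite (_ : _ @^-1` _ = \bigcup_k obox (\row_j (if j == i then r else - k.+1%:R)) (const_mx k.+1%:R)).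
  apply: bigcupT_measurable => k; apply: sub_sigma_algebra.
  by exists (\row_j (if j == i then r else - k.+1%:R), const_mx k.+1%:R).
apply/seteqP; split=> x /=; rewrite in_itv/= ?andbT.
  move=> rx; have [N /cubeP xN] := cube_ge x; exists N => // j.
  rewrite !mxE; case: eqP => [->|_]; first by rewrite rx (le_lt_trans (ler_norm _)).
  by have := xN j; rewrite ltr_norml.
by move=> [k _ /(_ i)]; rewrite !mxE eqxx => /andP[].
Qed.

Lemma rV_lebesgue_obox a b :
  (leb (obox a b) = \prod_(i < n) (Num.max 0 (b ord0 i - a ord0 i))%:E)%E.
Proof.
rewrite (_ : obox a b = [set x : 'rV[R]_n | forall i, `]a ord0 i, b ord0 i[%classic (x ord0 i)]).
  rewrite (@rV_lebesgue_box R n (fun i => `]a ord0 i, b ord0 i[%classic)).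
    apply: eq_bigr => i _; rewrite lebesgue_measure_itv/= lte_fin.
    case: ltP => ab; first by rewrite max_r// subr_ge0 ltW.
    by rewrite max_l// subr_le0.
  by move=> i; exact: measurable_itv.
by apply/seteqP; split=> x /= h i; have := h i; rewrite /= in_itv.
Qed.

Lemma rV_lebesgue_obox_fin a b : (leb (obox a b) < +oo)%E.
Proof. by rewrite rV_lebesgue_obox prodEFin ltry. Qed.

(** Boxes are stable under intersection, generate the sigma-algebra and contain an exhausting
    sequence of cubes; this is the uniqueness theorem for measures on such a system. *)
Lemma rV_measure_unique (m1 m2 : {measure set 'rV[R]_n -> \bar R}) :
  (forall a b, m1 (obox a b) = m2 (obox a b)) ->
  (forall k : nat, (m1 (cube k.+1%:R) < +oo)%E) ->
  forall A, measurable A -> m1 A = m2 A.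
Proof.
move=> m12 m1fin A mA.
apply: (measure_unique _ (fun k => cube k.+1%:R) measurable_oboxE obox_setI _ cube_cover) => //.
  by move=> k; exists (const_mx (- k.+1%:R), const_mx k.+1%:R).
by move=> _ [[a b] _ <-].
Qed.

(** The sigma-algebra is generated by the coordinates, so its link with the topology must be proved:
    an open set is the union of the countably many boxes with rational centre and radius 1/(k+1)
    that it contains. *)
Lemma open_measurable_rV (U : set 'rV[R]_n) : open U -> measurable U.
Proof.
move=> oU.
pose B (q : 'rV[rat]_n * nat) : set 'rV[R]_n :=
  obox (\row_i (ratr (q.1 ord0 i) - q.2.+1%:R^-1)) (\row_i (ratr (q.1 ord0 i) + q.2.+1%:R^-1)).
rewrite (_ : U = \bigcup_q (if `[< B q `<=` U >] then B q else set0)).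
  apply: countable_bigcupT_measurable => [|q]; first exact: countableP.
  by case: ifP => _; [exact: measurable_obox|exact: measurable0].
apply/seteqP; split=> x; last by move=> [q _]; case: asboolP => // qU /qU.
move=> Ux.
have /nbhs_ballP[e /= e0 eU] : nbhs x U by exact: open_nbhs_nbhs.
(* Half of [e], because a point of the chosen box is within one radius of its centre, and the centre
   within one radius of [x]. *)
have [N Ne] : exists N : nat, N.+1%:R^-1 < e / 2.
  have e20 : 0 < e / 2 by rewrite divr_gt0.
  have [N _ /(_ N (leqnn N))] := near_infty_natSinv_lt (PosNum e20); by exists N.
pose d : R := N.+1%:R^-1; have d0 : 0 < d by rewrite invr_gt0.
have [q qx] : exists q : 'rV[rat]_n, forall i, `|x ord0 i - ratr (q ord0 i)| < d.
  have /choice[f fx] : forall i, exists r : rat, `|x ord0 i - ratr r| < d.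
    move=> i; have [r] := @rat_in_itvoo R (x ord0 i - d) (x ord0 i + d) ltac:(by rewrite ltrD2l gtrN).
    by rewrite in_itv/= -ltr_distlC => h; exists r.
  by exists (\row_i f i) => i; rewrite mxE.
exists (q, N) => //; case: asboolP => [_ i|].
  by rewrite !mxE -ltr_distl.
case=> y By; apply: eU; rewrite mx_norm_ball /ball_ /=.
apply: (@le_lt_trans _ _ (d + d)); last first.
  by rewrite [ltRHS]splitr ltrD.
rewrite [leLHS]mx_normrE; apply/bigmax_leP; split; first by rewrite addr_ge0 // ltW.
move=> [j i] _ /=; rewrite ord1 !mxE.
have : `|y ord0 i - ratr (q ord0 i)| < d by have := By i; rewrite !mxE ltr_distl.
move: (qx i); rewrite [`|y _ _ - _|]distrC => h1 h2.
by rewrite -(subrKA (ratr (q ord0 i))) (le_trans (ler_normD _ _))// ltW// ltrD.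
Qed.

Lemma continuous_measurable_rV (f : 'rV[R]_n -> R) : continuous f ->
  measurable_fun setT f.
Proof.
move=> cf; apply: (measurability _ (RGenOpens.measurableE R)).
move=> _ [_ [a [b ->]] <-]; rewrite setTI.
apply: open_measurable_rV; apply: open_comp => [x _|]; [exact: cf|exact: interval_open].
Qed.

Lemma compact_cube (K : set 'rV[R]_n) : compact K -> exists N : nat, K `<=` cube N.+1%:R.
Proof.
move=> /compact_bounded[M [Mr MK]].
have [N MN] : exists N : nat, M < N.+1%:R.
  exists (Num.bound `|M|); rewrite (le_lt_trans (ler_norm _))//.
  by rewrite (lt_trans (archi_boundP _))// ltr_nat.
exists N.+1 => x Kx; apply/cubeP => i.
apply: le_lt_trans (coord_norm_le _ _) _.
by apply: (@le_lt_trans _ _ N.+1%:R); [exact: (MK N.+1%:R)|rewrite ltr_nat].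
Qed.

Lemma compact_measurable_rV (K : set 'rV[R]_n) : compact K -> measurable K.
Proof.
move=> cK; rewrite -[K]setCK; apply: measurableC; apply: open_measurable_rV.
rewrite openC; apply: compact_closed => //; exact: norm_hausdorff.
Qed.

Lemma cube_closure_compact (r : R) (A : set 'rV[R]_n) : A `<=` cube r -> compact (closure A).
Proof.
move=> Ar; apply: bounded_closed_compact; last exact: closed_closure.
exists `|r|; split; first exact: num_real.
move=> M rM x clx /=.
rewrite leNgt; apply/negP => Mx.
have [y [Ay]] := clx _ (nbhsx_ballx x (`|x| - M) ltac:(by rewrite subr_gt0)).
rewrite mx_norm_ball /ball_ /= => xy.
have : `|y| <= `|r|.
  rewrite [leLHS]mx_normrE; apply/bigmax_leP; split => [|[j i] _] //=.
  rewrite ord1 ltW// (lt_le_trans _ (ler_norm _))//.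
  by have /cubeP := Ar _ Ay; exact.
have := ler_normD (x - y) y; rewrite subrK.
lra.
Qed.

Lemma measurable_rV_shift c : measurable_fun setT (fun x : 'rV[R]_n => x + c).
Proof.
apply: measurable_fun_rVP => i.
rewrite (_ : (fun _ => _) = (fun x : 'rV[R]_n => x ord0 i + c ord0 i)).
  by apply: measurable_funD => //; exact: measurable_coord.
by apply/funext => x; rewrite mxE.
Qed.

(** The measure of a box depends only on its side lengths, and boxes determine the measure. *)
Lemma rV_lebesgue_shift c (A : set 'rV[R]_n) : measurable A ->
  leb ((fun x => x + c) @^-1` A) = leb A.
Proof.
move=> mA.
pose nu := measure_function_pushforward__canonical__measure_function_Measure
  leb (measurable_rV_shift c).
have nuE a b : nu (obox a b) = leb (obox a b).
  rewrite /nu /= /pushforward.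
  rewrite (_ : _ @^-1` _ = obox (a - c) (b - c)).
    rewrite !rV_lebesgue_obox; apply: eq_bigr => i _; rewrite !mxE.
    by congr (Num.max 0 _)%:E; lra.
  by apply/seteqP; split=> x /= h i; have := h i; rewrite !mxE ltrBlDr ltrBrDr.
apply: (@rV_measure_unique nu leb nuE) => // k.
by rewrite nuE; exact: rV_lebesgue_obox_fin.
Qed.

Lemma ge0_integral_shift c (f : 'rV[R]_n -> \bar R) :
  measurable_fun setT f -> (forall x, 0 <= f x)%E ->
  (\int[leb]_x f (x + c)%R = \int[leb]_x f x)%E.
Proof.
move=> mf f0.
rewrite -[LHS](@ge0_integral_pushforward _ _ _ _ _ _ (measurable_rV_shift c) leb setT f)//.
apply: eq_measure_integral; first exact: measurable_rV_shift.
by move=> mS A mA _; exact: rV_lebesgue_shift.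
Qed.

End boxes.
Opaque rV_lebesgue.

(** * Integrals under invertible linear maps *)

Section linear_change.
Context {R : realType} {n : nat}.
Implicit Types (a b c x : 'rV[R]_n) (A : 'M[R]_n).
Local Notation leb := (rV_lebesgue R n).

Lemma measurable_mulmxr A : measurable_fun setT (fun x : 'rV[R]_n => x *m A).
Proof.
apply: measurable_fun_rVP => i.
rewrite (_ : (fun _ => _) = (fun x : 'rV[R]_n => \sum_k x ord0 k * A k i)).
  apply: measurable_sum => k; apply: measurable_funM => //; exact: measurable_coord.
by apply/funext => x; rewrite mxE.
Qed.

(* Uniqueness of Haar measure: integrate [1_B (x) g (x + y A)] in both orders. *)
Lemma ge0_integral_mulmx A (B : set 'rV[R]_n) (k : R) (g : 'rV[R]_n -> \bar R) :
  A \in unitmx -> measurable B -> (forall x, B (- x) <-> B x) ->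
  (0 < leb B < +oo)%E -> 
  leb ((fun x => x *m A) @^-1` B) = (k%:E * leb B)%E ->
  measurable_fun setT g -> (forall x, 0 <= g x)%E ->
  (\int[leb]_x g (x *m A) = k%:E * \int[leb]_x g x)%E.
Proof.
move=> uA mB evenB /andP[B0 Boo] kB mg g0.
pose f x : \bar R := (\1_B x)%:E.
have mf : measurable_fun setT f by exact/measurable_EFinP/measurable_indic.
have f0 x : (0 <= f x)%E by rewrite lee_fin.
have mLx (h : 'rV[R]_n -> \bar R) x : measurable_fun setT h ->
    measurable_fun setT (fun y : 'rV[R]_n => h (y *m A + x)).
  move=> mh; apply: measurableT_comp => //.
  exact: (measurableT_comp (measurable_rV_shift x) (measurable_mulmxr A)).
(* The shift by [x] after [A] is the shift by [x *m invmx A] before it, which leaves the integral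
   unchanged. *)
have shL (h : 'rV[R]_n -> \bar R) x : measurable_fun setT h -> (forall x, 0 <= h x)%E ->
    (\int[leb]_y h (y *m A + x)%R = \int[leb]_y h (y *m A))%E.
  move=> mh h0.
  rewrite -(@ge0_integral_shift R n (x *m invmx A) (fun y => h (y *m A)))//.
    by apply: eq_integral => y _; rewrite mulmxDl mulmxKV.
  by apply: measurableT_comp => //; exact: measurable_mulmxr.
have fN x : f (- x) = f x.
  rewrite /f !indicE; congr ((_ : bool)%:R%:E).
  by apply/idP/idP; rewrite !inE => /evenB.
have intf : (\int[leb]_x f x = leb B)%E by rewrite integral_indic// setIT.
have intfA : (\int[leb]_x f (x *m A) = k%:E * leb B)%E.
  rewrite -kB -(setIT (_ @^-1` B)); apply: esym; rewrite -[LHS]integral_indic//.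
  by rewrite -[X in measurable X]setTI; exact: measurable_mulmxr.
clearbody f.
pose F (z : 'rV[R]_n * 'rV[R]_n) : \bar R := (f z.1 * g (z.2 *m A + z.1)%R)%E.
pose F' (z : 'rV[R]_n * 'rV[R]_n) : \bar R := (f (z.1 - z.2 *m A)%R * g z.1)%E.
have mA2 : measurable_fun setT (fun z : 'rV[R]_n * 'rV[R]_n => z.2 *m A).
  by apply: (measurableT_comp (measurable_mulmxr A)); exact: measurable_snd.
have mop (s : R) : measurable_fun setT (fun z : 'rV[R]_n * 'rV[R]_n => z.1 + s *: (z.2 *m A)).
  apply: measurable_fun_rVP => i.
  rewrite (_ : (fun _ => _) = (fun z : 'rV[R]_n * 'rV[R]_n => z.1 ord0 i + s * (z.2 *m A) ord0 i)).
    apply: measurable_funD.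
      by apply: (measurableT_comp (@measurable_coord R n i)); exact: measurable_fst.
    apply: measurable_funM => //.
    exact: (measurableT_comp (@measurable_coord R n i) mA2).
  by apply/funext => z; rewrite !mxE.
have mF : measurable_fun setT F.
  apply: emeasurable_funM; first by apply: (measurableT_comp mf); exact: measurable_fst.
  rewrite (_ : (fun _ => _) = g \o (fun z => z.1 + 1 *: (z.2 *m A))).
    by apply: (measurableT_comp mg); exact: mop.
  by apply/funext => z /=; rewrite scale1r addrC.
have mF' : measurable_fun setT F'.
  apply: emeasurable_funM.
    rewrite (_ : (fun _ => _) = f \o (fun z => z.1 + (-1) *: (z.2 *m A))).
      by apply: (measurableT_comp mf); exact: mop.
    by apply/funext => z /=; rewrite scaleN1r.
  by apply: (measurableT_comp mg); exact: measurable_fst.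
have F0 z : (0 <= F z)%E by rewrite mule_ge0.
have F'0 z : (0 <= F' z)%E by rewrite mule_ge0.
have E1 : (\int[leb]_x \int[leb]_y F (x, y) = leb B * \int[leb]_y g (y *m A))%E.
  rewrite -intf -ge0_integralZr//; last first.
    by apply: integral_ge0.
  apply: eq_integral => x _; rewrite /F /=.
  by rewrite ge0_integralZl// ?shL//; exact: mLx.
have E2 : (\int[leb]_y \int[leb]_x F (x, y) = \int[leb]_y \int[leb]_x F' (x, y))%E.
  apply: eq_integral => y _.
  rewrite -(@ge0_integral_shift R n (y *m A) (fun x => F' (x, y)))//; last first.
    exact: (measurableT_comp mF' (measurable_pair2 y)).
  by apply: eq_integral => x _; rewrite /F /F' /= addrK addrC.
have E3 : (\int[leb]_x \int[leb]_y F' (x, y) = (k%:E * leb B) * \int[leb]_x g x)%E.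
  have iA : (0 <= \int[leb]_x f (x *m A))%E by apply: integral_ge0.
  transitivity (\int[leb]_x ((\int[leb]_y f (y *m A)) * g x))%E; last first.
    rewrite -intfA.
    exact: (@ge0_integralZl _ _ _ leb setT measurableT g mg _ (fun x _ => g0 x) iA).
  apply: eq_integral => x _; rewrite /F' /=.
  (* Evenness of [B] turns f(x - yA) into f(yA - x), whose integral in y is that of f(yA), namely
     [k] times the measure of [B]. *)
  under eq_integral do rewrite -fN opprB -[_ - x]/(_ + (- x)).
  rewrite (ge0_integralZr leb measurableT (mLx _ _ mf) (fun y _ => f0 _) (g0 x)).
  by rewrite shL.
have : (leb B * \int[leb]_y g (y *m A) = leb B * (k%:E * \int[leb]_x g x))%E.
  rewrite -E1 (fubini_tonelli F mF F0) E2 -(fubini_tonelli F' mF' F'0) E3.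
  by rewrite [RHS]muleCA [RHS]muleA.
clear - B0 Boo.
have lebB : leb B = (fine (leb B))%:E by rewrite fineK// ge0_fin_numE// ltW.
rewrite lebB => /(congr1 (fun z => ((fine (leb B))^-1%:E * z)%E)).
rewrite !muleA -EFinM mulVf ?mul1e//.
by rewrite gt_eqF// -lte_fin -lebB.
Qed.
End linear_change.

(** * Euclidean norm, orthogonal maps and similarities *)

Section euclid.
Context {R : realType} {n : nat}.
Implicit Types (a b c x v w : 'rV[R]_n) (A Q : 'M[R]_n).
Local Notation leb := (rV_lebesgue R n).

Definition sqn x : R := \sum_i x ord0 i ^+ 2.

Lemma sqn_ge0 x : 0 <= sqn x.
Proof. by apply: sumr_ge0 => i _; exact: sqr_ge0. Qed.

Lemma sqnE x : (x *m x^T) = (sqn x)%:M.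
Proof.
apply/matrixP => i j; rewrite !ord1 !mxE eqxx mulr1n.
by apply: eq_bigr => k _; rewrite !mxE expr2.
Qed.

Lemma sqn_enorm x : enorm x ^+ 2 = sqn x.
Proof. by rewrite sqr_sqrtr// sqn_ge0. Qed.

Lemma enorm_ge0 x : 0 <= enorm x. Proof. exact: sqrtr_ge0. Qed.

Lemma coord_le_sqn x i : x ord0 i ^+ 2 <= sqn x.
Proof. by rewrite /sqn (bigD1 i)//= lerDl sumr_ge0// => j _; exact: sqr_ge0. Qed.

Lemma coord_le_enorm x i : `|x ord0 i| <= enorm x.
Proof. by rewrite -sqrtr_sqr ler_wsqrtr// coord_le_sqn. Qed.

Lemma sqn_eq0 x : (sqn x == 0) = (x == 0).
Proof.
apply/eqP/eqP => [x0|->]; last by rewrite /sqn big1// => i _; rewrite mxE expr0n.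
apply/rowP => i; rewrite mxE; apply/eqP; rewrite -sqrf_eq0 eq_le sqr_ge0 andbT.
by rewrite -x0 coord_le_sqn.
Qed.

Lemma enorm_eq0 x : (enorm x == 0) = (x == 0).
Proof. by rewrite -sqrf_eq0 sqn_enorm sqn_eq0. Qed.

Lemma sqnZ (k : R) x : sqn (k *: x) = k ^+ 2 * sqn x.
Proof. by rewrite /sqn mulr_sumr; apply: eq_bigr => i _; rewrite mxE exprMn. Qed.

Lemma enormZ (k : R) x : enorm (k *: x) = `|k| * enorm x.
Proof. by rewrite /enorm -!/(sqn _) sqnZ sqrtrM ?sqr_ge0// sqrtr_sqr. Qed.

Lemma enorm0 : enorm (0 : 'rV[R]_n) = 0.
Proof. by apply/eqP; rewrite enorm_eq0. Qed.

Lemma enormN x : enorm (- x) = enorm x.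
Proof. by rewrite -scaleN1r enormZ normrN1 mul1r. Qed.

Lemma enorm_triangle x (y : 'rV[R]_n) : enorm (x + y) <= enorm x + enorm y.
Proof.
rewrite -(@ler_pXn2r _ 2)// ?nnegrE ?addr_ge0 ?enorm_ge0//.
rewrite sqrrD !sqn_enorm.
pose d := \sum_i x ord0 i * y ord0 i.
have lin s t : sqn (t *: x + s *: y) = t ^+ 2 * sqn x + s ^+ 2 * sqn y + 2 * (s * t) * d.
  rewrite /sqn /d !mulr_sumr -!big_split/=; apply: eq_bigr => i _; rewrite !mxE; ring.
have := lin 1 1; rewrite !scale1r => ->.
suff : d <= enorm x * enorm y by lra.
(* Cauchy-Schwarz: the square norm of |y| x - |x| y equals 2 |x| |y| (|x| |y| - d). *)
have := sqn_ge0 (enorm y *: x + (- enorm x) *: y).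
rewrite lin -!sqn_enorm sqrrN.
have := enorm_ge0 x; have := enorm_ge0 y.
rewrite le_eqVlt => /orP[/eqP/esym/eqP|y0].
  rewrite enorm_eq0 => /eqP y0 _ _; rewrite /d big1 ?mulr_ge0 ?enorm_ge0// => i _.
  by rewrite y0 mxE mulr0.
rewrite le_eqVlt => /orP[/eqP/esym/eqP|x0].
  rewrite enorm_eq0 => /eqP x0 _; rewrite /d big1 ?mulr_ge0 ?enorm_ge0// => i _.
  by rewrite x0 mxE mul0r.
have xy0 := mulr_gt0 x0 y0.
move=> h; rewrite -(ler_pM2l xy0); lra.
Qed.

Lemma sqn_mulmx Q x : Q *m Q^T = 1%:M -> sqn (x *m Q) = sqn x.
Proof.
move=> QQ; have := sqnE (x *m Q).
rewrite trmx_mul mulmxA -(mulmxA x) QQ mulmx1 sqnE.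
by move=> /(congr1 (fun M : 'M[R]_1 => M ord0 ord0)); rewrite !mxE eqxx !mulr1n.
Qed.

Lemma enorm_mulmx Q x : Q *m Q^T = 1%:M -> enorm (x *m Q) = enorm x.
Proof. by move=> QQ; rewrite /enorm -!/(sqn _) sqn_mulmx. Qed.

(** Two vectors of equal length are exchanged by the reflection in the hyperplane orthogonal to
    their difference d, because v . d = |d|^2 / 2. *)
Lemma orthogonal_transitive v w : enorm v = enorm w ->
  exists2 Q : 'M[R]_n, Q *m Q^T = 1%:M & v *m Q = w.
Proof.
move=> vw; set d := v - w.
have sv : sqn v = sqn w by rewrite -!sqn_enorm vw.
have dT : (d *m d^T) = (sqn d)%:M by exact: sqnE.
have vd : v *m d^T = (sqn d / 2)%:M.
  have -> : v *m d^T = 2^-1 *: (d *m d^T).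
    have tr1 : w *m v^T = v *m w^T.
      by apply/matrixP => i j; rewrite !ord1 !mxE; apply: eq_bigr => k _; rewrite !mxE mulrC.
    rewrite /d [in LHS]linearB/= [in RHS]linearB/= mulmxBr mulmxBl !mulmxBr tr1 !sqnE sv.
    apply/matrixP => i j; rewrite !mxE; lra.
  by rewrite dT scale_scalar_mx mulrC.
(* Householder reflection; for [d = 0] the junk value [2 / 0 = 0] gives the identity. *)
pose Q : 'M[R]_n := 1%:M - (2 / sqn d) *: (d^T *m d).
have QT : Q^T = Q by rewrite /Q linearB/= linearZ/= trmx_mul trmxK trmx1.
exists Q.
  rewrite QT /Q; have [d0|d0] := eqVneq d 0.
    by rewrite d0 mulmx0 scaler0 subr0 mulmx1.
  have sd0 : sqn d != 0 by rewrite sqn_eq0.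
  rewrite mulmxBr mulmx1 mulmxBl mul1mx -scalemxAl -scalemxAr.
  rewrite mulmxA -(mulmxA d^T) dT mul_mx_scalar -scalemxAl !scalerA.
  have -> : 2 / sqn d * (2 / sqn d * sqn d) = 2 / sqn d + 2 / sqn d by field.
  rewrite scalerDl.
  by rewrite opprB addrK subrK.
rewrite /Q mulmxBr mulmx1 -scalemxAr mulmxA vd mul_scalar_mx scalerA.
have [d0|d0] := eqVneq d 0; first by rewrite d0 scaler0 subr0; apply/eqP; rewrite -subr_eq0 -/d d0.
have sd0 : sqn d != 0 by rewrite sqn_eq0.
rewrite (_ : _ * _ = 1) ?scale1r; last by field.
by rewrite /d opprB addrC subrK.
Qed.

Lemma measurable_sqn : measurable_fun setT sqn.
Proof.
apply: measurable_sum => i; apply: measurable_funX; exact: measurable_coord.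
Qed.

Lemma measurable_enorm : measurable_fun setT (@enorm R n).
Proof.
apply: (measurableT_comp _ measurable_sqn).
by apply: continuous_measurable_fun; exact: sqrt_continuous.
Qed.

(** The test set for orthogonal maps in [ge0_integral_mulmx]: they leave it invariant, so their
    factor is 1. *)
Definition sball : set 'rV[R]_n := [set x | sqn x < 1].

Lemma measurable_sball : measurable sball.
Proof.
rewrite (_ : sball = sqn @^-1` `]-oo, 1[%classic).
  by rewrite -[X in measurable X]setTI; exact: measurable_sqn.
by apply/seteqP; split=> x /=; rewrite in_itv.
Qed.

Lemma rV_lebesgue_cube (r : R) : 0 <= r -> leb (cube r) = ((2 * r) ^+ n)%:E.
Proof.
move=> r0; rewrite /cube rV_lebesgue_obox prodEFin; congr EFin.
rewrite (eq_bigr (fun=> 2 * r)) => [|i _]; first by rewrite prodr_const card_ord.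
by rewrite !mxE opprK max_r ?addr_ge0// mulr2n mulrDl mul1r.
Qed.

Lemma sball_pos_fin : (0 < leb sball < +oo)%E.
Proof.
apply/andP; split.
  have r0 : (0 : R) < n.+1%:R^-1 by rewrite invr_gt0.
  apply: (@lt_le_trans _ _ (leb (cube n.+1%:R^-1))).
    by rewrite rV_lebesgue_cube ?ltW// lte_fin exprn_gt0// mulr_gt0.
  apply: le_measure; rewrite ?inE; [exact: measurable_obox|exact: measurable_sball|].
  move=> x /cubeP xr; rewrite /sball /= /sqn.
  (* The half-side 1/(n+1) makes the sum of n squares at most n/(n+1), hence below 1. *)
  apply: (@le_lt_trans _ _ (\sum_(i < n) n.+1%:R^-1)).
    apply: ler_sum => i _; rewrite -real_normK ?num_real// -[leRHS]mulr1 expr2.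
    apply: ler_pM => //; first exact: ltW.
    by rewrite (le_trans (ltW (xr i)))// invf_le1// ler1n.
  rewrite sumr_const card_ord -[_ *+ n]mulr_natl ltr_pdivrMr ?mul1r ?ltr_nat//.
apply: (@le_lt_trans _ _ (leb (cube 1))).
  apply: le_measure; rewrite ?inE; [exact: measurable_sball|exact: measurable_obox|].
  move=> x x1; apply/cubeP => i; rewrite -(@ltr_pXn2r _ 2)// ?nnegrE//.
  by rewrite -normrX ger0_norm ?sqr_ge0// expr1n (le_lt_trans (coord_le_sqn _ _)).
exact: rV_lebesgue_obox_fin.
Qed.

Lemma ge0_integral_orthogonal Q (g : 'rV[R]_n -> \bar R) : Q *m Q^T = 1%:M ->
  measurable_fun setT g -> (forall x, 0 <= g x)%E ->
  (\int[leb]_x g (x *m Q) = \int[leb]_x g x)%E.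
Proof.
move=> QQ mg g0.
rewrite (@ge0_integral_mulmx R n Q sball 1)// ?mul1e//.
- by have /mulmx1_unit[] := QQ.
- exact: measurable_sball.
- by move=> x; rewrite /sball/= -scaleN1r sqnZ sqrrN expr1n mul1r.
- exact: sball_pos_fin.
- by congr (leb _); apply/seteqP; split=> x /=; rewrite /sball/= sqn_mulmx.
Qed.

Lemma ge0_integral_scale (l : R) (g : 'rV[R]_n -> \bar R) : 0 < l ->
  measurable_fun setT g -> (forall x, 0 <= g x)%E ->
  (\int[leb]_x g (l *: x) = (l ^- n)%:E * \int[leb]_x g x)%E.
Proof.
move=> l0 mg g0.
under eq_integral do rewrite -mul_mx_scalar.
apply: (@ge0_integral_mulmx R n l%:M (cube 1)) => //.
- by rewrite -scalemx1 unitmxZ ?unitmx1// unitfE gt_eqF.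
- exact: measurable_obox.
- by move=> x; rewrite !cubeP; split=> h i; have := h i; rewrite mxE normrN.
- by rewrite rV_lebesgue_cube// !lte_fin ltry andbT exprn_gt0// mulr1.
- rewrite (_ : _ @^-1` _ = cube l^-1).
    rewrite !rV_lebesgue_cube ?invr_ge0 ?ltW// -EFinM mulr1 -exprVn -exprMn.
    by rewrite mulrC.
  apply/seteqP; split=> x /=; rewrite !cubeP => h i; have := h i;
    by rewrite mul_mx_scalar mxE normrM gtr0_norm// -ltr_pdivlMl// mulr1.
Qed.

Lemma ge0_integral_similarity (l : R) Q b (g : 'rV[R]_n -> \bar R) :
  0 < l -> Q *m Q^T = 1%:M ->
  measurable_fun setT g -> (forall x, 0 <= g x)%E ->
  (\int[leb]_x g (l *: (x *m Q) + b)%R = (l ^- n)%:E * \int[leb]_x g x)%E.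
Proof.
move=> l0 QQ mg g0.
have mgb : measurable_fun setT (fun x => g (x + b)%R).
  exact: (measurableT_comp mg (measurable_rV_shift b)).
have mgl : measurable_fun setT (fun x => g (l *: x + b)%R).
  under eq_fun do rewrite -mul_mx_scalar.
  exact: (measurableT_comp mgb (measurable_mulmxr l%:M)).
rewrite (@ge0_integral_orthogonal Q (fun x => g (l *: x + b)%R) QQ mgl (fun x => g0 _)).
rewrite (@ge0_integral_scale l (fun x => g (x + b)%R) l0 mgb (fun x => g0 _)).
by rewrite (ge0_integral_shift b mg g0).
Qed.

Lemma integral_similarity (l : R) Q b (g : 'rV[R]_n -> \bar R) :
  0 < l -> Q *m Q^T = 1%:M -> measurable_fun setT g ->
  (\int[leb]_x g (l *: (x *m Q) + b)%R = (l ^- n)%:E * \int[leb]_x g x)%E.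
Proof.
move=> l0 QQ mg; rewrite integralE [in RHS]integralE.
have -> : (\int[leb]_x (fun x => g (l *: (x *m Q) + b)%R)^\+ x =
          (l ^- n)%:E * \int[leb]_x g^\+ x)%E.
  rewrite -(ge0_integral_similarity b l0 QQ (measurable_funepos mg) (funepos_ge0 g)).
  by apply: eq_integral => x _; rewrite !funeposE.
have -> : (\int[leb]_x (fun x => g (l *: (x *m Q) + b)%R)^\- x =
          (l ^- n)%:E * \int[leb]_x g^\- x)%E.
  rewrite -(ge0_integral_similarity b l0 QQ (measurable_funeneg mg) (funeneg_ge0 g)).
  by apply: eq_integral => x _; rewrite !funenegE.
have a0 : (0 <= \int[leb]_x g^\+ x)%E by exact: integral_ge0.
have b0 : (0 <= \int[leb]_x g^\- x)%E by exact: integral_ge0.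
have k0 : (0 < (l ^- n)%:E)%E by rewrite lte_fin invr_gt0 exprn_gt0.
(* The formula holds for every measurable [g]: in the last case both parts are infinite, their
   difference is -oo by convention, and a positive factor preserves it. *)
move: (\int[leb]_x g^\+ x)%E (\int[leb]_x g^\- x)%E a0 b0 => [a| |] [b'| |] // _ _.
- by rewrite muleBr.
- by rewrite /= gt0_muleNy// gt0_muley.
- by rewrite /= gt0_muley.
- by rewrite /= gt0_muleNy// gt0_muley.
Qed.
End euclid.

(** * Smooth functions of several variables *)

Section ck.
Context {R : realType} {n : nat}.
Implicit Types (phi psi f g : 'rV[R]_n -> R) (x y v w : 'rV[R]_n) (i j : 'I_n).

Local Notation e_ i := (delta_mx ord0 i : 'rV[R]_n).

(** Finite-order counterpart of [smooth], recursive in the order, so that closure under sums,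
    products and affine substitutions is proved by induction. *)
Fixpoint Ck (k : nat) phi : Prop :=
  continuous phi /\
  (if k is k'.+1 then
     forall i, (forall x, derivable phi x (e_ i)) /\ Ck k' (partial i phi)
   else True).

Lemma Ck_continuous k phi : Ck k phi -> continuous phi.
Proof. by case: k => [|k] []. Qed.

Lemma CkW k phi : Ck k.+1 phi -> Ck k phi.
Proof.
elim: k phi => [|k IH] phi [cphi dphi]; first by split.
by split=> // i; split; [exact: (dphi i).1|exact: IH (dphi i).2].
Qed.

Lemma iter_partial_rcons s i phi :
  iter_partial (rcons s i) phi = iter_partial s (partial i phi).
Proof. by rewrite /iter_partial foldr_rcons. Qed.

Lemma smoothP phi : smooth phi <-> forall k, Ck k phi.
Proof.
split=> [sphi k|].
  elim: k phi sphi => [|k IH] phi sphi; first by split=> //; have [] := sphi [::].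
  have [cphi dphi] := sphi [::]; split=> // i; split; first exact: dphi.
  by apply: IH => s; rewrite -iter_partial_rcons; exact: sphi.
move=> Cphi s; elim/last_ind: s phi Cphi => [|s i IH] phi Cphi.
  by split=> [|i x]; [exact: Ck_continuous (Cphi 0%N)|exact: ((Cphi 1%N).2 i).1].
by rewrite iter_partial_rcons; apply: IH => k; exact: ((Cphi k.+1).2 i).2.
Qed.

Lemma is_derive_line phi y v (t : R) : derivable phi (y + t *: v) v ->
  is_derive t 1 (fun s => phi (y + s *: v)) ('D_v phi (y + t *: v)).
Proof.
move=> dphi.
have E : (fun h : R => h^-1 *: (((fun s => phi (y + s *: v)) \o shift t) (h *: (1 : R)) - phi (y + t *: v))) =
    (fun h : R => h^-1 *: ((phi \o shift (y + t *: v)) (h *: v) - phi (y + t *: v))).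
  by apply/funext => h /=; rewrite [h *: 1]mulr1 scalerDl addrCA.
split; first by rewrite /derivable E.
by rewrite /derive E.
Qed.

Lemma mvt_coord phi i y (s : R) : (forall x, derivable phi x (e_ i)) ->
  exists2 t : R, `|t| <= `|s| &
    phi (y + s *: e_ i) - phi y = s * partial i phi (y + t *: e_ i).
Proof.
move=> dphi.
pose g s := phi (y + s *: e_ i).
have dg (t : R) : is_derive t (1 : R) g (partial i phi (y + t *: e_ i)) by exact: is_derive_line.
have cg : continuous g.
  by move=> t; apply/differentiable_continuous/derivable1_diffP; have [] := dg t.
have g0 : g 0 = phi y by rewrite /g scale0r addr0.
rewrite -g0 -/(g s).
have [s0|s0] := leP 0 s.
  have [t] := MVT_segment s0 (fun t _ => dg t) (continuous_subspaceT cg).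
  rewrite in_itv/= => /andP[t0 ts]; rewrite subr0 mulrC => gE.
  by exists t => //; rewrite !ger0_norm.
have [t] := MVT_segment (ltW s0) (fun t _ => dg t) (continuous_subspaceT cg).
rewrite in_itv/= => /andP[ts t0]; rewrite sub0r => gE.
exists t; first by rewrite (ler0_norm t0) (ltr0_norm s0) lerN2.
by rewrite -opprB gE mulrN opprK mulrC.
Qed.

(** The increment along w + c e_i splits into one along w and one along e_i from the displaced
    point; the mean value theorem and the continuity of the i-th partial derivative settle the
    second. *)
Lemma is_derive_add_coord phi i x w (d c : R) : is_derive x w phi d ->
  (forall x, derivable phi x (e_ i)) -> continuous (partial i phi) ->
  is_derive x (w + c *: e_ i) phi (d + c * partial i phi x).
Proof.
move=> [dw <-] di ci.
suff H : (fun h : R => h^-1 *: ((phi \o shift x) (h *: (w + c *: e_ i)) - phi x)) @ 0^' -->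
    'D_w phi x + c * partial i phi x.
  by split; [apply/cvg_ex; eexists; exact: H|exact/cvg_lim].
have -> : (fun h : R => h^-1 *: ((phi \o shift x) (h *: (w + c *: e_ i)) - phi x)) =
  (fun h : R => h^-1 *: ((phi \o shift x) (h *: w) - phi x) +
    h^-1 *: (phi (h *: w + x + (h * c) *: e_ i) - phi (h *: w + x))).
  apply/funext => h /=; rewrite -scalerDr; congr (_ *: _).
  by rewrite scalerDr scalerA [X in phi X]addrAC [RHS]addrC addrA subrK.
apply: cvgD; first exact: dw.
apply/cvgrPdist_le => eps eps0 /=.
have c10 : 0 < `|c| + 1 by rewrite ltr_wpDl.
have /cvgrPdist_lt/(_ (eps / (`|c| + 1))) := ci x.
move=> /(_ (divr_gt0 eps0 c10)) /nbhs_ballP[del /= del0 Hdel].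
have m0 : 0 < `|w| + `|c| + 1 by rewrite ltr_wpDl// addr_ge0.
near=> h.
have h0 : h != 0 by near: h; exact: nbhs_dnbhs_neq.
have hd : `|h| < del / (`|w| + `|c| + 1).
  near: h; apply: dnbhs0_lt; exact: divr_gt0.
have [t th ->] := mvt_coord (h *: w + x) (h * c) di.
rewrite [_ *: _]mulrA mulrA mulVf// mul1r -mulrBr normrM.
set z := _ + t *: _.
have zb : ball x del z.
  rewrite mx_norm_ball /ball_ /= /z.
  rewrite (_ : x - _ = - (h *: w + t *: e_ i)); last first.
    by rewrite opprD addrA opprD addrCA subrr addr0 -opprD.
  rewrite normrN (le_lt_trans (ler_normD _ _))// !normrZ.
  have e1 : `|e_ i| <= 1.
    rewrite [leLHS]mx_normrE; apply/bigmax_leP; split=> // -[a b] _ /=.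
    by rewrite !mxE; case: (_ && _); rewrite ?normr1 ?normr0.
  apply: (@le_lt_trans _ _ (`|h| * (`|w| + `|c|))).
    rewrite mulrDr lerD2l -normrM (le_trans _ th)// -[leRHS]mulr1.
    by rewrite ler_wpM2l.
  rewrite (@le_lt_trans _ _ (`|h| * (`|w| + `|c| + 1)))//; last by rewrite -ltr_pdivlMr.
  by rewrite ler_wpM2l// lerDl.
have := Hdel z zb; rewrite /= ltr_pdivlMr// => /ltW; apply: le_trans.
by rewrite mulrC ler_wpM2l// lerDl.
Unshelve. all: by end_near. Qed.

(** The direction is built up from 0 by adding its coordinate components one at a time. *)
Lemma is_derive_C1 phi x v :
  (forall i x, derivable phi x (e_ i)) -> (forall i, continuous (partial i phi)) ->
  is_derive x v phi (\sum_i v ord0 i * partial i phi x).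
Proof.
move=> dphi cphi.
rewrite [v in is_derive _ v]row_sum_delta.
elim/big_rec2 : _ => [|i d w _ IH].
  exact: is_derive0.
rewrite [_ *: _ + w]addrC [_ + d]addrC.
by have := @is_derive_add_coord phi i x w d (v ord0 i) IH (dphi i) (cphi i).
Qed.

Lemma CkD k f g : Ck k f -> Ck k g -> Ck k (fun x => f x + g x).
Proof.
have cD (f' g' : 'rV[R]_n -> R) : continuous f' -> continuous g' -> continuous (fun x => f' x + g' x).
  by move=> cf cg x; exact: continuousD (cf x) (cg x).
elim: k f g => [|k IH] f g [cf df] [cg dg]; split=> //; try exact (cD _ _ cf cg).
move=> i; have [{}df df'] := df i; have [{}dg dg'] := dg i.
split=> [x|]; first exact: derivableD.
rewrite (_ : partial i _ = fun x => partial i f x + partial i g x); first exact: IH.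
by apply/funext => x; rewrite /partial deriveD.
Qed.

Lemma Ck_cst k (c : R) : Ck k (fun=> c).
Proof.
elim: k c => [|k IH] c; split=> //; try exact: cst_continuous.
move=> i; split=> [x|]; first exact: derivable_cst.
rewrite (_ : partial i _ = fun=> 0); first exact: IH.
by apply/funext => x; rewrite /partial derive_cst.
Qed.

Lemma partialM i f g x : derivable f x (e_ i) -> derivable g x (e_ i) ->
  partial i (fun x => f x * g x) x = f x * partial i g x + g x * partial i f x.
Proof. by move=> df dg; rewrite /partial (deriveM df dg). Qed.

Lemma CkM k f g : Ck k f -> Ck k g -> Ck k (fun x => f x * g x).
Proof.
have cM (f' g' : 'rV[R]_n -> R) : continuous f' -> continuous g' -> continuous (fun x => f' x * g' x).
  by move=> cf cg x; exact: continuousM (cf x) (cg x).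
elim: k f g => [|k IH] f g Cf Cg; split=> //;
  try exact (cM _ _ (Ck_continuous Cf) (Ck_continuous Cg)).
move=> i; have [df df'] := Cf.2 i; have [dg dg'] := Cg.2 i.
split=> [x|]; first exact: derivableM.
rewrite (_ : partial i _ = fun x => f x * partial i g x + g x * partial i f x).
  by apply: CkD; apply: IH => //; exact: CkW.
by apply/funext => x; rewrite partialM.
Qed.

Lemma CkZ k (c : R) f : Ck k f -> Ck k (fun x => c * f x).
Proof. by move=> Cf; apply: CkM => //; exact: Ck_cst. Qed.

Lemma Ck_sum k (F : 'I_n -> 'rV[R]_n -> R) : (forall j, Ck k (F j)) ->
  Ck k (fun x => \sum_j F j x).
Proof.
move=> CF; elim: (index_enum _) => [|j s IH].
  by rewrite (_ : (fun _ => _) = fun=> 0); [exact: Ck_cst|apply/funext => x; rewrite big_nil].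
rewrite (_ : (fun _ => _) = fun x => F j x + \sum_(j <- s) F j x); first exact: CkD.
by apply/funext => x; rewrite big_cons.
Qed.

Lemma is_derive_affine f (A : 'M[R]_n) b x v d :
  is_derive (x *m A + b) (v *m A) f d -> is_derive x v (fun x => f (x *m A + b)) d.
Proof.
move=> [df <-].
have E : (fun h : R => h^-1 *: (((fun x => f (x *m A + b)) \o shift x) (h *: v) - f (x *m A + b))) =
    (fun h : R => h^-1 *: ((f \o shift (x *m A + b)) (h *: (v *m A)) - f (x *m A + b))).
  by apply/funext => h /=; rewrite mulmxDl scalemxAl addrA.
by split; rewrite /derivable /derive E.
Qed.

Lemma partial_affine f (A : 'M[R]_n) b i x : Ck 1 f ->
  is_derive x (e_ i) (fun x => f (x *m A + b)) (\sum_j A i j * partial j f (x *m A + b)).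
Proof.
move=> Cf; apply: is_derive_affine.
rewrite (_ : \sum_j _ = \sum_j (e_ i *m A) ord0 j * partial j f (x *m A + b)).
  apply: is_derive_C1 => [j y|j]; first exact: (Cf.2 j).1.
  exact: (@Ck_continuous 0 _ (Cf.2 j).2).
by apply: eq_bigr => j _; rewrite -rowE mxE.
Qed.

Lemma continuous_rV (T : topologicalType) (F : T -> 'rV[R]_n) :
  (forall i, continuous (fun t => F t ord0 i)) -> continuous F.
Proof.
move=> cF t.
rewrite (_ : F = fun t => \sum_i F t ord0 i *: e_ i); last first.
  by apply/funext => u; exact: row_sum_delta.
elim: (index_enum _) => [|i s IH].
  rewrite (_ : (fun _ => _) = cst 0); first exact: cvg_cst.
  by apply/funext => u; rewrite big_nil.
rewrite (_ : (fun _ => _) = fun t => F t ord0 i *: e_ i + \sum_(i <- s) F t ord0 i *: e_ i).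
  apply: cvgD; last exact: IH.
  by apply: cvgZr_tmp; exact: cF.
by apply/funext => u; rewrite big_cons.
Qed.

Lemma continuous_affine (A : 'M[R]_n) b : continuous (fun x : 'rV[R]_n => x *m A + b).
Proof.
apply: continuous_rV => i.
rewrite (_ : (fun _ => _) = fun x : 'rV[R]_n => \sum_j A j i * x ord0 j + b ord0 i).
  apply: (@Ck_continuous 0); apply: CkD; last exact: Ck_cst.
  by apply: Ck_sum => j; apply: CkZ; split => //; exact: coord_continuous.
by apply/funext => x; rewrite !mxE; congr (_ + _); apply: eq_bigr => j _; rewrite mulrC.
Qed.

Lemma Ck_affine k f (A : 'M[R]_n) b : Ck k f -> Ck k (fun x => f (x *m A + b)).
Proof.
elim: k f => [|k IH] f Cf; split=> //;
  try (by move=> x; apply: continuous_comp; [exact: continuous_affine|exact: Ck_continuous Cf _]).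
have C1f : Ck 1 f.
  by split; [exact: Ck_continuous Cf|move=> i; split; [exact: (Cf.2 i).1|split => //; exact: Ck_continuous (Cf.2 i).2]].
move=> i; split=> [x|]; first by have [] := partial_affine A b i x C1f.
rewrite (_ : partial i _ = fun x => \sum_j A i j * partial j f (x *m A + b)).
  by apply: Ck_sum => j; apply: CkZ; apply: (IH (partial j f)); exact: (Cf.2 j).2.
by apply/funext => x; apply: derive_val; exact: partial_affine.
Qed.

End ck.

(** * Smooth steps and bumps on the line *)

Section smooth_real.
Context {R : realType}.
Implicit Types (f g : R -> R) (x y c d : R).

Fixpoint D1 (k : nat) f : Prop :=
  continuous f /\
  (if k is k'.+1 then (forall x, derivable f x 1) /\ D1 k' (derive1 f) else True).

Lemma D1_continuous k f : D1 k f -> continuous f.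
Proof. by case: k => [|k] []. Qed.

Lemma D1W k f : D1 k.+1 f -> D1 k f.
Proof.
elim: k f => [|k IH] f [cf [df Df]]; first by split.
by split=> //; split=> //; exact: IH.
Qed.

Lemma derivable_D1 k f f' : (forall x, is_derive x 1 f (f' x)) -> D1 k f' ->
  D1 k.+1 f.
Proof.
move=> df Df'; split.
  by move=> x; apply/differentiable_continuous/derivable1_diffP; have [] := df x.
split=> [x|]; first by have [] := df x.
rewrite (_ : derive1 f = f')//.
by apply/funext => x; rewrite derive1E; exact: (@derive_val _ _ _ _ _ _ _ (df x)).
Qed.

Lemma D1_is_derive k f x : D1 k.+1 f -> is_derive x 1 f (derive1 f x).
Proof. by move=> [_ [df _]]; rewrite derive1E; exact: derivableP. Qed.

Lemma D1D k f g : D1 k f -> D1 k g -> D1 k (fun x => f x + g x).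
Proof.
elim: k f g => [|k IH] f g Df Dg.
  by split=> // x; exact: continuousD (@D1_continuous _ _ Df x) (@D1_continuous _ _ Dg x).
apply: (@derivable_D1 _ _ (fun x => derive1 f x + derive1 g x)) => [x|].
  by have := D1_is_derive x Df; have := D1_is_derive x Dg => *; exact: is_deriveD.
by apply: IH; [exact: Df.2.2|exact: Dg.2.2].
Qed.

Lemma D1_cst k c : D1 k (fun=> c).
Proof.
elim: k c => [|k IH] c; first by split=> //; exact: cst_continuous.
by apply: (@derivable_D1 _ _ (fun=> 0)).
Qed.

Lemma D1M k f g : D1 k f -> D1 k g -> D1 k (fun x => f x * g x).
Proof.
elim: k f g => [|k IH] f g Df Dg.
  by split=> // x; exact: continuousM (@D1_continuous _ _ Df x) (@D1_continuous _ _ Dg x).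
apply: (@derivable_D1 _ _ (fun x => f x * derive1 g x + g x * derive1 f x)) => [x|].
  by have := D1_is_derive x Df; have := D1_is_derive x Dg => *; exact: is_deriveM.
by apply: D1D; apply: IH; [exact: D1W Df|exact: Dg.2.2|exact: D1W Dg|exact: Df.2.2].
Qed.

Lemma D1Z k c f : D1 k f -> D1 k (fun x => c * f x).
Proof. by move=> Df; apply: D1M => //; exact: D1_cst. Qed.

Lemma is_derive_affine1 f x c d (l : R) : is_derive (c * x + d) 1 f l ->
  is_derive x 1 (fun x => f (c * x + d)) (c * l).
Proof.
move=> df.
have dg : is_derive x 1 (fun x => c * x + d) c.
  rewrite (_ : (fun _ => _) = (c \*o id) + cst d); last by apply/funext.
  by apply: is_derive_eq; rewrite addr0 [_ *: _]mulr1.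
rewrite mulrC; exact: (@is_derive1_comp _ f (fun x => c * x + d)).
Qed.

Lemma D1_affine k f c d : D1 k f -> D1 k (fun x => f (c * x + d)).
Proof.
elim: k f => [|k IH] f Df.
  split=> // x; apply: (@continuous_comp _ _ _ (fun x => c * x + d) f); last exact: (@D1_continuous _ _ Df).
  apply: continuousD; last exact: cst_continuous.
  by apply: continuousM; [exact: cst_continuous|exact: cvg_id].
apply: (@derivable_D1 _ _ (fun x => c * derive1 f (c * x + d))) => [x|].
  by apply: is_derive_affine1; exact: D1_is_derive Df.
by apply: D1Z; apply: (IH (derive1 f)); exact: Df.2.2.
Qed.

Lemma is_derive_inv f x d : f x != 0 -> is_derive x 1 f d ->
  is_derive x 1 (fun y => (f y)^-1) (- (f x) ^- 2 * d).
Proof.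
move=> f0 [ef <-]; apply: DeriveDef; first exact: derivableV.
by rewrite (deriveV f0 ef).
Qed.

Lemma D1V k f : (forall x, f x != 0) -> D1 k f -> D1 k (fun x => (f x)^-1).
Proof.
move=> f0; elim: k => [|k IH] Df.
  by split=> // x; apply: continuousV; [exact: f0|exact: (@D1_continuous _ _ Df)].
apply: (@derivable_D1 _ _ (fun x => - 1 * ((f x)^-1 * (f x)^-1) * derive1 f x)) => [x|].
  have := is_derive_inv (f0 x) (D1_is_derive x Df).
  by rewrite expr2 invfM mulN1r.
have Dk := D1W Df.
by apply: D1M; [apply: D1Z; apply: D1M; exact: IH|exact: Df.2.2].
Qed.

(* [flat j x = x^-j exp (-1/x)] for [x > 0]; this family is stable under
   differentiation. *)
Definition flat (j : nat) x : R := if 0 < x then x ^- j * expR (- x^-1) else 0.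

Lemma flat_ge0 j x : 0 <= flat j x.
Proof. by rewrite /flat; case: ltP => // x0; rewrite mulr_ge0// ?expR_ge0// invr_ge0 exprn_ge0// ltW. Qed.

Lemma flat_gt0 j x : 0 < x -> 0 < flat j x.
Proof. by move=> x0; rewrite /flat x0 mulr_gt0// ?expR_gt0// invr_gt0 exprn_gt0. Qed.

Lemma flat_eq0 j x : x <= 0 -> flat j x = 0.
Proof. by rewrite /flat ltNge => ->. Qed.

(** The exponential of 1/x dominates the term of degree j+1 of its series. The bound gives the limit
    0 of every [flat j] at the origin. *)
Lemma flat_le j x : flat j x <= j.+1`!%:R * `|x|.
Proof.
rewrite /flat; case: ltP => x0; last by rewrite mulr_ge0.
rewrite gtr0_norm// expRN.
have xj : 0 < x ^- j by rewrite invr_gt0 exprn_gt0.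
have fk : 0 < (j.+1`!%:R : R) by rewrite ltr0n fact_gt0.
have H : x ^- j.+1 / j.+1`!%:R <= expR x^-1.
  have := @expR_ge1Dxn R x^-1 j; rewrite invr_ge0 exprVn => /(_ (ltW x0)).
  by apply: le_trans; rewrite lerDr.
rewrite -ler_pdivlMl// -[leRHS]invrK lef_pV2 ?posrE ?expR_gt0//; last first.
  by rewrite invr_gt0 !mulr_gt0// invr_gt0.
apply: le_trans H; rewrite le_eqVlt; apply/orP; left; apply/eqP.
by rewrite exprS; field; rewrite !gt_eqF// exprn_gt0.
Qed.

Lemma flat_cvg0 j : flat j x @[x --> 0] --> 0.
Proof.
apply/cvgrPdist_le => e e0.
have K0 : 0 < (j.+1`!%:R : R) by rewrite ltr0n fact_gt0.
near=> x; rewrite sub0r normrN ger0_norm ?flat_ge0//.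
apply: le_trans (flat_le _ _) _; rewrite -ler_pdivlMl//.
rewrite -[`|x|]normrN -[- x]sub0r; near: x.
by apply: cvgr_dist_le; [exact: cvg_id|rewrite mulr_gt0// invr_gt0].
Unshelve. all: by end_near. Qed.

(** Away from 0 this is direct differentiation. At 0 the difference quotient of [flat j] is exactly
    [flat j.+1], which tends to 0. *)
Lemma is_derive_flat j x :
  is_derive x 1 (flat j) (- j%:R * flat j.+1 x + flat j.+2 x).
Proof.
have [x0|x0|<-] := ltrgtP 0 x.
- rewrite (_ : _ + _ = - j%:R * (x ^- j.+1 * expR (- x^-1)) + x ^- j.+2 * expR (- x^-1)); last first.
    by rewrite /flat x0.
  apply: (@near_eq_is_derive _ _ _ (fun x => x ^- j * expR (- x^-1))).
    by near=> y; rewrite /flat ifT//; near: y; exact: lt_nbhsr.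
  have xn0 : x != 0 by rewrite gt_eqF.
  have dV : is_derive x 1 (fun y : R => y^-1) (- x ^- 2).
    have H := @is_derive_inv id x 1 xn0 (is_derive_id _ _).
    by rewrite mulr1 in H.
  have xj0 : x ^+ j != 0 by rewrite expf_neq0.
  have dX : is_derive x 1 (fun y : R => y ^+ j) (j%:R * x ^+ j.-1).
    apply: DeriveDef; first exact: exprn_derivable.
    by rewrite exp_derive /GRing.scale/= mulr1.
  have dVj : is_derive x 1 (fun y : R => y ^- j) (- j%:R * x ^- j.+1).
    have H := @is_derive_inv (fun y => y ^+ j) x _ xj0 dX; refine (@is_derive_eq _ _ _ _ _ _ _ _ H _).
    clear -xn0; case: j => [|i]; first by rewrite mul0r mulr0 oppr0 mul0r.
    by rewrite !exprS /=; field; rewrite xn0 expf_neq0.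
  have dE : is_derive x 1 (fun y : R => expR (- y^-1)) (expR (- x^-1) * x ^- 2).
    have dN : is_derive x 1 (fun y : R => - y^-1) (x ^- 2).
      by rewrite -[x ^- 2]opprK; exact: is_deriveN.
    exact: (@is_derive1_comp _ expR (fun y => - y^-1)).
  rewrite (_ : _ + _ = x ^- j * (expR (- x^-1) * x ^- 2) + expR (- x^-1) * (- j%:R * x ^- j.+1)).
    exact: is_deriveM.
  by rewrite !exprS; field; rewrite expf_neq0.
- rewrite !flat_eq0 ?(ltW x0)// mulr0 addr0.
  apply: (@near_eq_is_derive _ _ _ (cst 0)).
  by near=> y; rewrite flat_eq0// ltW//; near: y; exact: lt_nbhsl.
rewrite !flat_eq0// mulr0 addr0.
suff H : (fun h : R => h^-1 *: ((flat j \o shift 0) (h *: (1 : R)) - flat j 0)) @ 0^' --> (0 : R).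
  by split; [apply/cvg_ex; eexists; exact: H|exact/cvg_lim].
rewrite (_ : (fun h => _) = flat j.+1).
  by apply: cvg_trans (flat_cvg0 j.+1); exact: cvg_app (@nbhs_dnbhs _ _).
apply/funext => h /=; rewrite [h *: 1]mulr1 addr0 (flat_eq0 j (lexx 0)) subr0.
rewrite /flat; case: ifP => h0; last by rewrite scaler0.
by rewrite [_ *: _]mulrA -invfM -exprS.
Unshelve. all: by end_near. Qed.

Lemma D1_flat k j : D1 k (flat j).
Proof.
elim: k j => [|k IH] j.
  split=> // x; apply/differentiable_continuous/derivable1_diffP.
  by have [] := is_derive_flat j x.
apply: (derivable_D1 (is_derive_flat j)).
by apply: D1D => //; apply: D1Z.
Qed.

(* Vanishes left of [-1] and equals 1 right of [1]. *)
Definition step x : R := flat 0 (x + 1) / (flat 0 (x + 1) + flat 0 (1 - x)).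

Lemma step_den_gt0 x : 0 < flat 0 (x + 1) + flat 0 (1 - x).
Proof.
have [x0|x0] := leP x 0.
  by rewrite ltr_wpDl ?flat_ge0 ?flat_gt0//; lra.
by rewrite ltr_pwDl ?flat_ge0 ?flat_gt0//; lra.
Qed.

Lemma D1_flat_affine k c d : D1 k (fun x => flat 0 (c * x + d)).
Proof. exact/D1_affine/D1_flat. Qed.

Lemma D1_step k : D1 k step.
Proof.
have D1p : D1 k (fun x => flat 0 (x + 1)).
  by have := D1_flat_affine k 1 1; under eq_fun do rewrite mul1r.
have D1m : D1 k (fun x => flat 0 (1 - x)).
  by have := D1_flat_affine k (-1) 1; under eq_fun do rewrite mulN1r addrC.
apply: D1M => //; apply: D1V; last exact: D1D.
by move=> x; rewrite gt_eqF// step_den_gt0.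
Qed.

Lemma step0 x : x <= - 1 -> step x = 0.
Proof. by move=> x1; rewrite /step flat_eq0 ?mul0r//; lra. Qed.

Lemma step1 x : 1 <= x -> step x = 1.
Proof.
move=> x1; rewrite /step [flat 0 (1 - x)]flat_eq0 ?addr0 ?divff//; last lra.
by rewrite gt_eqF// flat_gt0//; lra.
Qed.

Lemma is_derive_step x : is_derive x 1 step
  ((flat 2 (x + 1) * flat 0 (1 - x) + flat 0 (x + 1) * flat 2 (1 - x)) /
   (flat 0 (x + 1) + flat 0 (1 - x)) ^+ 2).
Proof.
have den0 y : flat 0 (y + 1) + flat 0 (1 - y) != 0 by rewrite gt_eqF// step_den_gt0.
have d1 : is_derive x 1 (fun x => flat 0 (x + 1)) (flat 2 (x + 1)).
  have := @is_derive_affine1 (flat 0) x 1 1 _ (is_derive_flat 0 _).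
  by rewrite !mul1r oppr0 mul0r add0r; under eq_fun do rewrite mul1r.
have d2 : is_derive x 1 (fun x => flat 0 (1 - x)) (- flat 2 (1 - x)).
  have := @is_derive_affine1 (flat 0) x (-1) 1 _ (is_derive_flat 0 _).
  by rewrite !mulN1r oppr0 mul0r add0r [_ + 1]addrC; under eq_fun do rewrite mulN1r addrC.
have dD : is_derive x 1 (fun x => flat 0 (x + 1) + flat 0 (1 - x)) (flat 2 (x + 1) - flat 2 (1 - x)).
  exact: is_deriveD.
have dV : is_derive x 1 (fun x => (flat 0 (x + 1) + flat 0 (1 - x))^-1)
    (- (flat 0 (x + 1) + flat 0 (1 - x)) ^- 2 * (flat 2 (x + 1) - flat 2 (1 - x))).
  exact: is_derive_inv.
have H := is_deriveM d1 dV; refine (@is_derive_eq _ _ _ _ _ _ _ _ H _).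
by rewrite /GRing.scale/=; field; exact: den0.
Qed.

Definition bump1 f := (forall k, D1 k f) /\ exists r, forall x, f x != 0 -> `|x| < r.

(** Defined as a derivative so that [bump] and [c * bump (c * x + d)] have the same mass in a usable
    form: for c > 0 their difference has a compactly supported primitive, the difference of two
    steps. *)
Definition bump : R -> R := derive1 step.

Lemma bumpE x : bump x = (flat 2 (x + 1) * flat 0 (1 - x) + flat 0 (x + 1) * flat 2 (1 - x)) /
   (flat 0 (x + 1) + flat 0 (1 - x)) ^+ 2.
Proof. by rewrite /bump derive1E; exact: (@derive_val _ _ _ _ _ _ _ (is_derive_step x)). Qed.

Lemma bump_ge0 x : 0 <= bump x.
Proof. by rewrite bumpE divr_ge0 ?sqr_ge0// addr_ge0// mulr_ge0 ?flat_ge0. Qed.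

Lemma bump0_gt0 : 0 < bump 0.
Proof.
rewrite bumpE subr0 add0r divr_gt0// ?exprn_gt0// ?addr_gt0// ?mulr_gt0//; exact: flat_gt0.
Qed.

Lemma bump_bump1 : bump1 bump.
Proof.
split=> [k|]; first exact: (D1_step k.+1).2.2.
exists 1 => x; apply: contra_neqT; rewrite -leNgt bumpE => x1.
have [x0|x0] := leP x 0.
  rewrite ler0_norm// in x1; rewrite !(@flat_eq0 _ (x + 1)) ?mul0r ?add0r ?mul0r//; lra.
rewrite gtr0_norm// in x1; rewrite !(@flat_eq0 _ (1 - x)) ?mulr0 ?add0r ?mul0r//; lra.
Qed.

Lemma step_sub_bump1 c d : 0 < c -> bump1 (fun x => step x - step (c * x + d)).
Proof.
move=> c0; split=> [k|].
  under eq_fun do rewrite -mulN1r.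
  by apply: D1D; [exact: D1_step|apply: D1Z; exact/D1_affine/D1_step].
(* Beyond this radius both x and c x + d are at distance at least 1 from 0 on the same side, so the
   two steps are both 0 or both 1. *)
exists (1 + (1 + `|d|) / c) => x; apply: contra_neqT; rewrite -leNgt => xr.
have d0 : 0 <= (1 + `|d|) / c by rewrite divr_ge0 ?addr_ge0// ltW.
have cd : c * ((1 + `|d|) / c) = 1 + `|d| by field; rewrite gt_eqF.
have := ler_norm d; have := ler_norm (- d); rewrite normrN => dl dr.
have [x0|x0] := leP x 0.
  rewrite (ler0_norm x0) in xr.
  rewrite (@step0 x) ?(@step0 (c * x + d)) ?subrr//; last lra.
  have : c * ((1 + `|d|) / c) <= c * (- x) by rewrite ler_pM2l//; lra.
  rewrite cd; lra.
rewrite (gtr0_norm x0) in xr.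
rewrite (@step1 x) ?(@step1 (c * x + d)) ?subrr//; last lra.
have : c * ((1 + `|d|) / c) <= c * x by rewrite ler_pM2l//; lra.
rewrite cd; lra.
Qed.

Lemma derive1_step_sub c d x :
  derive1 (fun x => step x - step (c * x + d)) x = bump x - c * bump (c * x + d).
Proof.
have d1 : is_derive x 1 step (bump x) by exact: D1_is_derive (D1_step 1).
have d2 : is_derive x 1 (fun x => step (c * x + d)) (c * bump (c * x + d)).
  by apply: is_derive_affine1; exact: D1_is_derive (D1_step 1).
by rewrite derive1E; have H := is_deriveB d1 d2; exact: (@derive_val _ _ _ _ _ _ _ H).
Qed.

Lemma bump_affine c d : 0 < c -> bump1 (fun x => c * bump (c * x + d)).
Proof.
move=> c0; have [Db [r br]] := bump_bump1; split=> [k|].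
  by apply: D1Z; exact: D1_affine.
exists ((`|r| + `|d|) / c) => x.
rewrite mulf_eq0 negb_or => /andP[_ /br]; rewrite ltr_pdivlMr// => H.
have : `|c * x| < `|r| + `|d|.
  rewrite -[c * x](addrK d) (le_lt_trans (ler_normB _ _))// ltrD2r.
  by rewrite (lt_le_trans H)// ler_norm.
by rewrite normrM gtr0_norm// mulrC.
Qed.

(* Converges to the indicator function of the open interval as [c] grows. *)
Definition plateau (c a b : R) x : R := flat 0 (c * (x - a)) * flat 0 (c * (b - x)).

Lemma plateau_bump1 c a b : 0 < c -> bump1 (plateau c a b).
Proof.
move=> c0; split=> [k|].
  apply: D1M.
    by under eq_fun do rewrite mulrBr; exact: D1_flat_affine.
  by under eq_fun do rewrite mulrBr addrC -mulNr; exact: D1_flat_affine.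
exists (`|a| + `|b| + 1) => x; rewrite mulf_eq0 negb_or => /andP[xa xb].
have ax : a < x.
  rewrite ltNge; apply: contra xa => xa; rewrite flat_eq0// pmulr_rle0// subr_le0//.
have bx : x < b.
  rewrite ltNge; apply: contra xb => xb; rewrite flat_eq0// pmulr_rle0// subr_le0//.
rewrite ltr_norml; have := ler_norm a; have := ler_norm (-a); have := ler_norm b; have := ler_norm (-b).
rewrite !normrN; have := normr_ge0 a; have := normr_ge0 b => *; apply/andP; split; lra.
Qed.

Lemma flat0_le1 x : flat 0 x <= 1.
Proof.
rewrite /flat; case: ltP => // x0; rewrite expr0 invr1 mul1r -expR0 ler_expR.
by rewrite oppr_le0 invr_ge0 ltW.
Qed.

Lemma plateau_01 c a b x : 0 <= plateau c a b x <= 1.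
Proof. by rewrite mulr_ge0 ?flat_ge0//= mulr_ile1 ?flat_ge0 ?flat0_le1. Qed.

(** For y > 0 the factor [flat 0 (k.+1%:R * y)] is exp(-1/((k+1) y)), which tends to 1; for y <= 0
    it vanishes. *)
Lemma cvg_plateau a b x :
  plateau k.+1%:R a b x @[k --> \oo] --> ((a < x < b)%R%:R : R).
Proof.
have H y : flat 0 (k.+1%:R * y) @[k --> \oo] --> ((0 < y)%R%:R : R).
  have [y0|y0] := ltP 0 y; last first.
    rewrite (_ : (fun _ => _) = fun=> 0); first exact: cvg_cst.
    by apply/funext => k; rewrite flat_eq0// pmulr_rle0.
  rewrite (_ : (fun _ => _) = fun k => expR (- (k.+1%:R^-1 * y^-1))); last first.
    by apply/funext => k; rewrite /flat mulr_gt0// expr0 invr1 mul1r invfM.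
  have -> : (true%:R : R) = expR (- (0 * y^-1)) by rewrite mul0r oppr0 expR0.
  apply: continuous_cvg; first exact: continuous_expR.
  by apply: cvgN; apply: cvgM; [exact: cvg_harmonic|exact: cvg_cst].
rewrite (_ : _%:R = ((0 < x - a)%R%:R * (0 < b - x)%R%:R : R)).
  by apply: cvgM; exact: H.
by rewrite !subr_gt0; case: (_ < _); case: (_ < _); rewrite ?mulr1 ?mulr0.
Qed.
End smooth_real.

(** * Test functions and integration by parts *)

Section tensors.
Context {R : realType} {n : nat}.
Implicit Types (f : 'I_n -> R -> R) (phi : 'rV[R]_n -> R) (i : 'I_n).
Local Notation e_ i := (delta_mx ord0 i : 'rV[R]_n).

Definition tens f (x : 'rV[R]_n) : R := \prod_i f i (x ord0 i).

Definition tens_upd f i (g : R -> R) : 'I_n -> R -> R :=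
  fun j => if j == i then g else f j.

Lemma tens_updE f i g x :
  tens (tens_upd f i g) x = g (x ord0 i) * \prod_(j | j != i) f j (x ord0 j).
Proof.
rewrite /tens (bigD1 i)//= /tens_upd eqxx; congr (_ * _).
by apply: eq_bigr => j /negbTE ->.
Qed.

Lemma tensE f i x :
  tens f x = f i (x ord0 i) * \prod_(j | j != i) f j (x ord0 j).
Proof. by rewrite /tens (bigD1 i). Qed.

Lemma is_derive_tens f i (x : 'rV[R]_n) (d : R) : is_derive (x ord0 i : R) (1 : R) (f i) d ->
  is_derive x (e_ i) (tens f) (d * \prod_(j | j != i) f j (x ord0 j)).
Proof.
move=> [df <-]; set P := \prod_(j | _) _.
have E : (fun h : R => h^-1 *: ((tens f \o shift x) (h *: e_ i) - tens f x)) =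
    (fun h : R => (h^-1 *: ((f i \o shift (x ord0 i)) (h *: (1 : R)) - f i (x ord0 i))) * P).
  apply/funext => h /=; rewrite [tens f x](tensE f i) [tens f _](tensE f i) -/P.
  have -> : (h *: e_ i + x) ord0 i = h *: (1 : R) + x ord0 i by rewrite !mxE !eqxx.
  have -> : \prod_(j | j != i) f j ((h *: e_ i + x) ord0 j) = P.
    by apply: eq_bigr => j ji; rewrite !mxE (negbTE ji) andbF mulr0 add0r.
  by rewrite -mulrBl -scalerAl.
have H : (fun h : R => h^-1 *: ((tens f \o shift x) (h *: e_ i) - tens f x)) @ 0^' --> 'D_1 (f i) (x ord0 i) * P.
  by rewrite E; apply: cvgM; [exact: df|exact: cvg_cst].
by split; [apply/cvg_ex; eexists; exact: H|exact/cvg_lim].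
Qed.

Lemma continuous_tens f : (forall i, continuous (f i)) -> continuous (tens f).
Proof.
move=> cf; rewrite /tens; elim: (index_enum _) => [|i s IH].
  by rewrite (_ : (fun _ => _) = cst 1); [exact: cst_continuous|apply/funext => x; rewrite big_nil].
rewrite (_ : (fun _ => _) = fun x : 'rV[R]_n => f i (x ord0 i) * \prod_(i <- s) f i (x ord0 i)).
  move=> x; apply: continuousM; last exact: IH.
  by apply: continuous_comp; [exact: coord_continuous|exact: cf].
by apply/funext => x; rewrite big_cons.
Qed.

Lemma partial_tens f i : (forall x, derivable (f i) x 1) ->
  partial i (tens f) = tens (tens_upd f i (derive1 (f i))).
Proof.
move=> df; apply/funext => x; rewrite tens_updE derive1E.
apply: (@derive_val _ _ _ _ _ _ _ (is_derive_tens (derivableP (df _)))).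
Qed.

Lemma Ck_tens k f : (forall i, D1 k (f i)) -> Ck k (tens f).
Proof.
elim: k f => [|k IH] f Df.
  by split=> //; apply: continuous_tens => i; exact: (Df i).1.
split; first by apply: continuous_tens => i; exact: (Df i).1.
move=> i; split.
  move=> x; have [_ [dfi _]] := Df i.
  by have [] := is_derive_tens (derivableP (dfi (x ord0 i))).
rewrite partial_tens; last exact: (Df i).2.1.
by apply: IH => j; rewrite /tens_upd; case: eqP => _; [exact: (Df i).2.2|exact: D1W].
Qed.

Lemma test_functionP phi : test_function phi <->
  (forall k, Ck k phi) /\ exists r, forall x, phi x != 0 -> cube r x.
Proof.
rewrite /test_function smoothP; split=> -[Cphi H]; split=> //.
  have [N HN] := compact_cube H; exists N.+1%:R => x phix.
  by apply: HN; exact: subset_closure.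
by have [r Hr] := H; exact: cube_closure_compact Hr.
Qed.

Lemma test_function_tens f : (0 < n)%N -> (forall i, bump1 (f i)) -> test_function (tens f).
Proof.
move=> n0 Bf; apply/test_functionP; split.
  by move=> k; apply: Ck_tens => i; exact: (Bf i).1.
have /choice[r Hr] : forall i, exists r, forall x, f i x != 0 -> `|x| < r.
  by move=> i; exact: (Bf i).2.
exists (\sum_i `|r i|) => x phix; apply/cubeP => i.
have /Hr : f i (x ord0 i) != 0.
  by apply: contraNN phix; rewrite (tensE f i) => /eqP ->; rewrite mul0r.
move=> /lt_le_trans; apply.
by rewrite (le_trans (ler_norm _))// (bigD1 i)//= lerDl sumr_ge0.
Qed.
End tensors.

Lemma cvg_EFin_seq (R : realType) (u : R^nat) (l : R) :
  u k @[k --> \oo] --> l -> (u k)%:E @[k --> \oo] --> l%:E.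
Proof. by move=> ul; apply/fine_cvgP; split; [exact: nearW|exact: ul]. Qed.

Lemma dominated_cvg_real d (T : measurableType d) (R : realType)
    (mu : {measure set T -> \bar R}) (F : nat -> T -> R) (f g : T -> R) :
  (forall k, measurable_fun setT (F k)) -> measurable_fun setT f ->
  {ae mu, forall x, F k x @[k --> \oo] --> f x} ->
  mu.-integrable setT (EFin \o g) ->
  {ae mu, forall x k, `|F k x| <= g x} ->
  mu.-integrable setT (EFin \o f) /\
  (\int[mu]_x F k x) @[k --> \oo] --> \int[mu]_x f x.
Proof.
move=> mF mf Ff ig Fg.
have [If _ H] := @dominated_convergence _ _ _ mu setT measurableT
  (fun k => EFin \o F k) (EFin \o f) (EFin \o g)
  (fun k => proj2 (measurable_EFinP _ _) (mF k)) (proj2 (measurable_EFinP _ _) mf)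
  (filterS (fun x Hx _ => cvg_EFin_seq Hx) Ff) ig
  (filterS (fun x Hx k _ => Hx k) Fg).
split=> //; apply: fine_cvg; rewrite fineK; first exact: H.
exact: integrable_fin_num.
Qed.

(** * Compact supports and integration by parts *)

Section compact_support.
Context {R : realType} {n : nat}.
Implicit Types (u phi f g : 'rV[R]_n -> R) (i : 'I_n).
Local Notation leb := (rV_lebesgue R n).
Local Notation e_ i := (delta_mx ord0 i : 'rV[R]_n).

Definition csupp phi : Prop := exists r, forall x, phi x != 0 -> cube r x.

Lemma csuppMl f phi : csupp phi -> csupp (fun x => f x * phi x).
Proof.
by move=> [r Hr]; exists r => x; rewrite mulf_eq0 negb_or => /andP[_]; exact: Hr.
Qed.

Lemma csupp_partial i phi : csupp phi -> csupp (partial i phi).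
Proof.
(* The margin 1 ensures that [phi] vanishes on a whole neighbourhood of a point outside the larger
   cube. *)
move=> [r Hr]; exists (r + 1) => x; apply: contra_neqP => xr.
rewrite /partial; apply: (@derive_val _ _ _ _ _ _ _ _).
apply: (@near_eq_is_derive _ _ _ (cst 0)).
near=> y; apply/esym/eqP; apply: contraT => /Hr yr; exfalso; apply: xr.
apply/cubeP => j; have : `|(x - y) ord0 j| < 1.
  apply: le_lt_trans (coord_norm_le _ _) _.
  have : ball x 1 y by near: y; exact: nbhsx_ballx.
  by rewrite mx_norm_ball.
move/cubeP : yr => /(_ j); rewrite !mxE => yr xy.
by rewrite -[x _ _](subrK (y ord0 j)) (le_lt_trans (ler_normD _ _))// addrC ltrD.
Unshelve. all: by end_near. Qed.

Lemma compact_bounded_continuous f (K : set 'rV[R]_n) : compact K -> continuous f ->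
  exists2 M : R, 0 <= M & forall x, K x -> `|f x| <= M.
Proof.
move=> cK cf; have [[x0 Kx0]|] := pselect (K !=set0); last first.
  by move=> K0; exists 0 => // x Kx; exfalso; apply: K0; exists x.
have [||c _ Hc] := @EVT_max_rV R n (fun x => `|f x|) K _ cK.
- by exists x0.
- apply: continuous_subspaceT => x; apply: (@continuous_comp _ _ _ f (fun y : R => `|y|)); first exact: cf.
  exact: norm_continuous.
by exists `|f c| => // x Kx; apply: Hc; rewrite inE.
Qed.

Lemma csupp_bounded phi : continuous phi -> csupp phi -> exists2 M : R, 0 <= M & forall x, `|phi x| <= M.
Proof.
move=> cphi [r Hr].
have [M M0 HM] := compact_bounded_continuous (@cube_closure_compact R n r _ (@subset_refl _ _)) cphi.
exists M => // x; have [->|px] := eqVneq (phi x) 0; first by rewrite normr0.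
by apply: HM; apply: subset_closure; exact: Hr.
Qed.

Lemma compact_lebesgue_fin (K : set 'rV[R]_n) : compact K -> (leb K < +oo)%E.
Proof.
move=> cK; have [N KN] := compact_cube cK.
apply: (@le_lt_trans _ _ (leb (cube N.+1%:R))); last exact: rV_lebesgue_obox_fin.
by apply: le_measure; rewrite ?inE; [exact: compact_measurable_rV|exact: measurable_obox|].
Qed.

Lemma continuous_locally_integrable f : continuous f -> locally_integrable_rV f.
Proof.
move=> cf; split; first exact: continuous_measurable_rV.
move=> K cK; have [M M0 HM] := compact_bounded_continuous cK cf.
apply: (@le_lt_trans _ _ (\int[leb]_(x in K) (cst M%:E x))%E).
  apply: ge0_le_integral => //.
  - exact: compact_measurable_rV.
  - apply: measurable_funTS; apply/measurable_EFinP; apply: measurableT_comp => //.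
    exact: continuous_measurable_rV.
rewrite integral_cst; last exact: compact_measurable_rV.
by rewrite lte_mul_pinfty ?lee_fin//; exact: compact_lebesgue_fin.
Qed.

Lemma locally_integrableM u phi : locally_integrable_rV u -> continuous phi -> csupp phi ->
  leb.-integrable setT (EFin \o (fun x => u x * phi x)).
Proof.
move=> [mu iu] cphi sphi; have [M M0 HM] := csupp_bounded cphi sphi.
have [r Hr] := sphi.
have cK := @cube_closure_compact R n r _ (@subset_refl _ (cube r)).
set K := closure _ in cK.
have mK := compact_measurable_rV cK.
have mup : measurable_fun setT (fun x => u x * phi x).
  by apply: measurable_funM => //; exact: continuous_measurable_rV.
apply/integrableP; split; first exact/measurable_EFinP.
have -> : (\int[leb]_x `|(EFin \o (fun x => u x * phi x)%R) x| =
    \int[leb]_(x in K) `|(u x * phi x)%R%:E|)%E.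
  rewrite [RHS]integral_mkcond; apply: eq_integral => x _ /=.
  rewrite /patch; case: ifPn => // xK; rewrite (_ : phi x = 0) ?mulr0 ?normr0//.
  apply/eqP; apply: contraNT xK => /Hr xr; rewrite inE; exact: subset_closure.
apply: (@le_lt_trans _ _ (\int[leb]_(x in K) (M%:E * `|u x|%:E))%E).
  apply: ge0_le_integral => //.
  - by apply: measurable_funTS; apply: measurableT_comp => //; exact/measurable_EFinP.
  - apply: measurable_funTS; apply: measurable_funeM; apply/measurable_EFinP.
    exact: measurableT_comp.
  - by move=> x _; rewrite abse_EFin -EFinM lee_fin normrM mulrC ler_wpM2r.
rewrite ge0_integralZl_EFin//; first by rewrite lte_mul_pinfty ?lee_fin// iu.
by apply: measurable_funTS; apply/measurable_EFinP; exact: measurableT_comp.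
Qed.

Lemma integrable_csupp phi : continuous phi -> csupp phi ->
  leb.-integrable setT (EFin \o phi).
Proof.
move=> cphi sphi.
rewrite (_ : EFin \o phi = EFin \o (fun x => cst 1 x * phi x)).
  apply: locally_integrableM => //; apply: continuous_locally_integrable.
  exact: cst_continuous.
by apply/funext => x /=; rewrite mul1r.
Qed.

Lemma integrable_indic_fin (A : set 'rV[R]_n) : measurable A -> (leb A < +oo)%E ->
  leb.-integrable setT (EFin \o (\1_A : 'rV[R]_n -> R)).
Proof.
move=> mA Aoo; apply/integrableP; split.
  by apply/measurable_EFinP; exact: measurable_indic.
under eq_integral do rewrite /= ger0_norm//.
by rewrite integral_indic// setIT.
Qed.

(** The difference quotients [q k] have integral zero by translation invariance, and dominated
    convergence passes this to the partial derivative. *)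
Lemma integral_partial_eq0 i f : Ck 1 f -> csupp f -> \int[leb]_x partial i f x = 0.
Proof.
move=> Cf sf; have [cf df] := Cf; have [di [cdi _]] := df i.
have [M M0 HM] := csupp_bounded cdi (csupp_partial i sf).
have [r Hr] := sf.
pose q (k : nat) x := k.+1%:R * (f (x + k.+1%:R^-1 *: e_ i) - f x).
have mf : measurable_fun setT (EFin \o f) by apply/measurable_EFinP; exact: continuous_measurable_rV.
have msh c : measurable_fun setT (fun x : 'rV[R]_n => f (x + c)).
  apply: (measurableT_comp (continuous_measurable_rV cf)); exact: measurable_rV_shift.
have mq k : measurable_fun setT (EFin \o q k).
  apply/measurable_EFinP; apply: measurable_funM => //; apply: measurable_funB => //.
  exact: continuous_measurable_rV.
have If := integrable_csupp cf sf.
have Ishift c : (\int[leb]_x (f (x + c)%R)%:E = \int[leb]_x (f x)%:E)%E.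
  have QQ : (1%:M : 'M[R]_n) *m (1%:M)^T = 1%:M by rewrite trmx1 mulmx1.
  have := @integral_similarity R n 1 _ c (EFin \o f) ltr01 QQ mf.
  rewrite expr1n invr1 mul1e => <-; apply: eq_integral => x _ /=.
  by rewrite scale1r mulmx1.
have Ish c : leb.-integrable setT (EFin \o (fun x => f (x + c))).
  apply/integrableP; split; first exact/measurable_EFinP.
  rewrite (@ge0_integral_shift R n c (fun x => `|f x|%:E)); first by have /integrableP[] := If.
    by apply/measurable_EFinP; apply: measurableT_comp => //; exact: continuous_measurable_rV.
  by move=> x; rewrite lee_fin.
have q0 k : (\int[leb]_x (q k x)%:E = 0)%E.
  rewrite /q; under eq_integral do rewrite EFinM.
  rewrite integralZl//; last exact: (@integrableB _ _ _ _ _ measurableT _ _ (Ish _) If).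
  rewrite (@integralB_EFin _ _ _ leb setT)// Ishift subee ?mule0//.
  exact: (integrable_fin_num _ If).
have qx x : q k x @[k --> \oo] --> partial i f x.
  rewrite /q.
  have := di x; rewrite /derivable => /cvg_ex[l Hl].
  have -> : partial i f x = l by rewrite /partial /derive; exact/cvg_lim.
  have H : (k.+1%:R^-1 : R) @[k --> \oo] --> (0 : R)^'.
    move=> A HA; have H1 : \forall k \near \oo, (k.+1%:R^-1 : R) != 0 -> A k.+1%:R^-1.
      exact: (@cvg_harmonic R _ HA).
    by apply: filterS H1 => k; apply; rewrite invr_eq0 pnatr_eq0.
  have := cvg_comp _ _ H Hl; apply: cvg_trans; apply: near_eq_cvg; apply: nearW => k /=.
  by rewrite invrK [_ *: _]/(_ * _) [_ + x]addrC.
(* The mean value theorem bounds the quotient by [M]. Steps have length at most 1, so all quotients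
   vanish outside the cube of radius [r + 1]. *)
have qM k x : `|q k x| <= M * \1_(cube (r + 1)) x.
  have k1 : (k.+1%:R^-1 : R) <= 1 by rewrite invf_le1// ler1n.
  rewrite indicE; have [xr|xr] := boolP (x \in _).
    rewrite mulr1; have [t _] := @mvt_coord R n f i x k.+1%:R^-1 di.
    by rewrite /q => ->; rewrite mulrA mulfV ?mul1r ?HM// pnatr_eq0.
  have fx0 : f x = 0.
    apply/eqP; apply: contraNT xr => /Hr xr; rewrite inE.
    by apply: cube_mono xr; rewrite lerDl.
  have fx1 : f (x + k.+1%:R^-1 *: e_ i) = 0.
    apply/eqP; apply: contraNT xr => /Hr/cubeP xr; rewrite inE; apply/cubeP => j.
    have := xr j; rewrite !mxE eqxx /= => xrj.
    set s := _ * _ in xrj; have s1 : `|s| <= 1.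
      by rewrite /s; case: eqP; rewrite ?mulr1 ?mulr0 ?normr0// ger0_norm.
    rewrite -[x _ _](addrK s) (le_lt_trans (ler_normB _ _))//.
    by apply: ltr_leD.
  by rewrite /q fx0 fx1 subr0 mulr0 mulr0 normr0.
have Ig : leb.-integrable setT (fun x => (M * \1_(cube (r + 1)) x)%:E).
  under eq_fun do rewrite EFinM.
  apply: integrableZl => //; apply: integrable_indic_fin; first exact: measurable_obox.
  exact: rV_lebesgue_obox_fin.
have [_] := @dominated_cvg_real _ _ _ leb q (partial i f) (fun x => M * \1_(cube (r + 1)) x)
  (fun k => proj1 (measurable_EFinP _ _) (mq k)) (continuous_measurable_rV cdi)
  (aeW _ qx) Ig (aeW _ (fun x k => qM k x)).
have -> : (fun k => \int[leb]_x q k x) = cst 0.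
  by apply/funext => k; rewrite /Rintegral q0.
move=> /cvg_lim <-//; rewrite lim_cst//.
Qed.

Lemma integration_by_parts i f phi : Ck 1 f -> test_function phi ->
  \int[leb]_x (f x * partial i phi x) = - \int[leb]_x (partial i f x * phi x).
Proof.
move=> Cf /test_functionP[Cphi sphi].
have C1p := Cphi 1%N.
have cf := Ck_continuous Cf; have cp := Ck_continuous C1p.
have [dfi [cdf _]] := Cf.2 i; have [dpi [cdp _]] := C1p.2 i.
have E := @integral_partial_eq0 i (fun x => f x * phi x) (CkM Cf C1p) (csuppMl f sphi).
apply/eqP; rewrite -subr_eq0 opprK -RintegralD//; last 2 first.
- by apply: locally_integrableM => //; [exact: continuous_locally_integrable|exact: csupp_partial].
- by apply: locally_integrableM => //; exact: continuous_locally_integrable.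
apply/eqP; rewrite -E; apply: eq_Rintegral => x _.
by rewrite partialM// [phi x * _]mulrC.
Qed.

End compact_support.

Opaque flat step bump.

(** * Uniqueness of weak derivatives *)

Section fundamental_lemma.
Context {R : realType} {n : nat}.
Implicit Types (u g : 'rV[R]_n -> R).
Local Notation leb := (rV_lebesgue R n).

(** Products of plateaus are test functions bounded by the indicator of the box and converging to it
    pointwise. *)
Lemma integral_obox_eq0 g : (0 < n)%N -> locally_integrable_rV g ->
  (forall phi, test_function phi -> \int[leb]_x (g x * phi x) = 0) ->
  forall a b, (\int[leb]_(x in obox a b) (g x)%:E = 0)%E.
Proof.
move=> n0 lg H a b; have [mg ig] := lg.
pose pl (k : nat) : 'rV[R]_n -> R :=
  tens (fun i => plateau k.+1%:R (a ord0 i) (b ord0 i)).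
have tpl k : test_function (pl k).
  by apply: test_function_tens => // i; exact: plateau_bump1.
have cpl k : continuous (pl k) by have /test_functionP[/(_ 0%N) /Ck_continuous] := tpl k.
have pl0 k x : ~ obox a b x -> pl k x = 0.
  move=> /existsNP[i xi]; rewrite /pl (tensE _ i).
  rewrite (_ : plateau _ _ _ _ = 0) ?mul0r// /plateau.
  move/negP: xi; rewrite negb_and -!leNgt => /orP[xa|xb].
    by rewrite [flat 0 (_ * (x _ _ - _))]flat_eq0 ?mul0r// pmulr_rle0// subr_le0.
  by rewrite mulrC [flat 0 (_ * (b _ _ - _))]flat_eq0 ?mul0r// pmulr_rle0// subr_le0.
have pl01 k x : `|pl k x| <= \1_(obox a b) x.
  rewrite indicE; have [_|xab] := boolP (x \in _); last first.
    by rewrite pl0 ?normr0//; move/negP: xab; rewrite inE.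
  rewrite /pl /tens normr_prod; apply: prodr_ile1 => i _.
  have /andP[p0 p1] := @plateau_01 R k.+1%:R (a ord0 i) (b ord0 i) (x ord0 i).
  by rewrite normr_ge0 ger0_norm.
have plcvg x : pl k x @[k --> \oo] --> (\1_(obox a b) x : R).
  have -> : (\1_(obox a b) x : R) = \prod_i (a ord0 i < x ord0 i < b ord0 i)%R%:R.
    rewrite indicE; have [xab|xab] := boolP (x \in _).
      by move: xab; rewrite inE => xab; rewrite big1// => i _; rewrite xab.
    move/negP: xab; rewrite inE => /existsNP[i /negP/negbTE xi].
    by rewrite (bigD1 i)//= xi mul0r.
  rewrite /pl /tens; elim: (index_enum _) => [|i s IH].
    by rewrite big_nil; under eq_fun do rewrite big_nil; exact: cvg_cst.
  rewrite big_cons; under eq_fun do rewrite big_cons.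
  by apply: cvgM => //; exact: cvg_plateau.
have [r Hr] : exists r, obox a b `<=` cube r.
  exists (\sum_i (`|a ord0 i| + `|b ord0 i|)) => x xab; apply/cubeP => i.
  have /andP[ax xb] := xab i.
  apply: (@lt_le_trans _ _ (`|a ord0 i| + `|b ord0 i|)); last first.
    by rewrite (bigD1 i)//= lerDl sumr_ge0// => j _; rewrite addr_ge0.
  have := ler_norm (b ord0 i); have := ler_norm (- a ord0 i); rewrite normrN.
  have := normr_ge0 (a ord0 i); have := normr_ge0 (b ord0 i).
  by move=> *; rewrite ltr_norml; apply/andP; split; lra.
have cK := cube_closure_compact Hr; set K := closure _ in cK.
have mob := @measurable_obox R n a b.
have m1 : measurable_fun setT (fun x => `|g x| * \1_(obox a b) x).
  by apply: measurable_funM; [exact: measurableT_comp|exact: measurable_indic].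
have Ig1 : leb.-integrable setT (EFin \o (fun x => `|g x| * \1_(obox a b) x)).
  apply/integrableP; split; first exact/measurable_EFinP.
  apply: le_lt_trans (ig K cK).
  rewrite [leRHS]integral_mkcond; apply: ge0_le_integral => //.
  - by apply: measurableT_comp => //; exact/measurable_EFinP.
  - apply/(measurable_restrictT _ (compact_measurable_rV cK)).
    by apply: measurable_funTS; apply/measurable_EFinP; exact: measurableT_comp.
  - move=> x _ /=; rewrite /patch; case: ifPn => xK.
      by rewrite lee_fin ger0_norm ?mulr_ge0// ler_piMr// indicE; case: (_ \in _).
    rewrite indicE memNset ?mulr0 ?normr0// => xab; move/negP: xK; apply.
    by rewrite inE; exact: subset_closure.
have [||||If] := @dominated_cvg_real _ _ _ leb (fun k x => g x * pl k x) (fun x => g x * \1_(obox a b) x)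
  (fun x => `|g x| * \1_(obox a b) x) _ _ _ Ig1 _.
- by move=> k; apply: measurable_funM => //; exact: continuous_measurable_rV.
- by apply: measurable_funM => //; exact: measurable_indic.
- by apply: aeW => x; apply: cvgM; [exact: cvg_cst|exact: plcvg].
- by apply: aeW => x k; rewrite normrM ler_wpM2l.
have -> : (fun k => \int[leb]_x (g x * pl k x)) = cst 0.
  by apply/funext => k; exact: H.
move=> /(cvg_unique (@Rhausdorff R) (cvg_cst 0)) I0.
rewrite integral_mkcond.
rewrite (_ : (fun x => (g x)%:E) \_ (obox a b) = EFin \o (fun x => g x * \1_(obox a b) x)).
  by rewrite -[LHS]fineK ?integrable_fin_num//; congr EFin; exact/esym.
by apply/funext => x; rewrite /patch /= indicE; case: ifP; rewrite ?mulr1 ?mulr0.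
Qed.

(** It suffices to treat [g] cut off to each cube of an exhausting sequence, where it is
    integrable. *)
Lemma ae_eq0_obox g : locally_integrable_rV g ->
  (forall a b, (\int[leb]_(x in obox a b) (g x)%:E = 0)%E) ->
  {ae leb, forall x, g x = 0}.
Proof.
move=> [mg ig] H.
have HN (N : nat) : {ae leb, forall x, cube N.+1%:R x -> g x = 0}.
  set Q := cube N.+1%:R.
  have mQ : measurable Q by exact: measurable_obox.
  have cK := cube_closure_compact (@subset_refl _ Q).
  pose g1 : 'rV[R]_n -> \bar R := (fun x => (g x)%:E) \_ Q.
  have mg1 : measurable_fun setT g1.
    apply/(measurable_restrictT _ mQ); apply: measurable_funTS.
    exact/measurable_EFinP.
  have Ig1 : leb.-integrable setT g1.
    apply/integrableP; split=> //; apply: le_lt_trans (ig _ cK).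
    rewrite [leRHS]integral_mkcond; apply: ge0_le_integral => //.
    - exact: measurableT_comp.
    - apply/(measurable_restrictT _ (compact_measurable_rV cK)).
      by apply: measurable_funTS; apply/measurable_EFinP; exact: measurableT_comp.
    - move=> x _ /=; rewrite /g1 /patch; case: ifPn => xQ.
        by rewrite mem_set ?abse_EFin//; apply: subset_closure; rewrite inE in xQ.
      by rewrite abse0; case: ifP => _; rewrite ?lee_fin.
  (* The sets on which the cut-off function integrates to zero form a Dynkin system containing the
     boxes, hence contain all Borel sets. *)
  have P0 A : measurable A -> (\int[leb]_(x in A) g1 x = 0)%E.
    rewrite measurable_oboxE; move: A; apply: dynkin_induction.
    - exact: measurable_oboxE.
    - exact: obox_setI.
    - by rewrite /g1 -integral_mkcond H.
    - move=> _ [[a b] _ <-] /=.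
      rewrite integral_mkcond /g1 -patch_setI -integral_mkcond.
      have [[c d] _ <-] := @obox_setI R n _ _ (ex_intro2 _ _ (a, b) I erefl)
        (ex_intro2 _ _ (const_mx (- N.+1%:R), const_mx N.+1%:R) I erefl).
      exact: H.
    - move=> S mS S0.
      have := @integral_setU _ _ _ leb S (~` S) g1 mS (measurableC mS).
      rewrite setUv S0 add0e /g1 => <-//.
      + by rewrite -integral_mkcond H.
      + by apply/disj_setPS => x [].
    - move=> F mF tF F0; rewrite integral_bigcup//; first by rewrite eseries0.
      by apply: integrableS Ig1 => //; exact: bigcupT_measurable.
  have := @integral_ae_eq _ _ _ leb setT measurableT (cst 0) g1 Ig1 (measurable_cst _)
    (fun A _ mA => etrans (P0 A mA) (esym (integral0 _ _))).
  apply: filterS => x /(_ I) + Qx; rewrite /g1 /patch mem_set//.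
  by case.
have := @ae_foralln _ _ _ leb _ HN.
apply: filterS => x Hx; have [N xN] := cube_ge x; exact: Hx xN.
Qed.

Lemma weak_partial_unique i u g1 g2 : (0 < n)%N ->
  is_weak_partial i u g1 -> is_weak_partial i u g2 ->
  {ae leb, forall x, g1 x = g2 x}.
Proof.
move=> n0 [l1 H1] [l2 H2].
have lB : locally_integrable_rV (fun x => g1 x - g2 x).
  have [m1 i1] := l1; have [m2 i2] := l2.
  split; first exact: measurable_funB.
  move=> K cK; have mK := compact_measurable_rV cK.
  apply: (@le_lt_trans _ _ (\int[leb]_(x in K) (`|g1 x|%:E + `|g2 x|%:E))%E).
    apply: ge0_le_integral => //.
    - by apply: measurable_funTS; apply/measurable_EFinP; apply: measurableT_comp => //; exact: measurable_funB.
    - by apply: measurable_funTS; apply: emeasurable_funD; apply/measurable_EFinP; exact: measurableT_comp.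
    - by move=> x _; rewrite -EFinD lee_fin; exact: ler_normB.
  rewrite ge0_integralD//; first by rewrite lte_add_pinfty ?i1 ?i2.
  - by apply: measurable_funTS; apply/measurable_EFinP; exact: measurableT_comp.
  - by apply: measurable_funTS; apply/measurable_EFinP; exact: measurableT_comp.
have := ae_eq0_obox lB (integral_obox_eq0 n0 lB _).
move=> /(_ _) H; apply: filterS (H _) => [x /eqP|phi tphi]; first by rewrite subr_eq0 => /eqP.
have /test_functionP[Cphi sphi] := tphi.
have cphi := Ck_continuous (Cphi 0%N).
under eq_Rintegral do rewrite mulrBl.
rewrite RintegralB//; [|exact: locally_integrableM|exact: locally_integrableM].
by apply/eqP; rewrite subr_eq0 -eqr_opp -H1// -H2.
Qed.
End fundamental_lemma.

(** * Functions with a p-integrable weak gradient *)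

Lemma powRD_le (R : realType) (p a b : R) : 0 <= p -> 0 <= a -> 0 <= b ->
  (a + b) `^ p <= 2 `^ p * (a `^ p + b `^ p).
Proof.
move=> p0 a0 b0; wlog ab : a b a0 b0 / a <= b.
  by move=> W; case: (leP a b) => [/W->//|/ltW/W]; rewrite addrC [b `^ p + _]addrC => ->.
apply: (@le_trans _ _ ((2 * b) `^ p)).
  by apply: ge0_ler_powR; rewrite ?nnegrE ?addr_ge0 ?mulr_ge0//; lra.
by rewrite powRM// ler_wpM2l ?powR_ge0// lerDr powR_ge0.
Qed.

Section dirichlet.
Context {R : realType} {n : nat}.
Implicit Types (u v phi : 'rV[R]_n -> R) (G H : 'rV[R]_n -> 'rV[R]_n) (p : R) (i : 'I_n).
Local Notation leb := (rV_lebesgue R n).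
Local Notation e_ i := (delta_mx ord0 i : 'rV[R]_n).

Definition energy p G : \bar R := (\int[leb]_x (enorm (G x) `^ p)%:E)%E.

(** Working form of [D1p]: the gradient is an explicit field with a single energy bound, so sums,
    multiples, similarities and limits act on the pair (u, G). *)
Definition has_grad p u G : Prop :=
  [/\ continuous u, measurable_fun setT G, (energy p G < +oo)%E &
      forall i phi, test_function phi ->
        \int[leb]_x (u x * partial i phi x) = - \int[leb]_x (G x ord0 i * phi x)].

Lemma enormD_powR p (x y : 'rV[R]_n) : 0 <= p ->
  enorm (x + y) `^ p <= 2 `^ p * (enorm x `^ p + enorm y `^ p).
Proof.
move=> p0; apply: le_trans (powRD_le p0 (enorm_ge0 x) (enorm_ge0 y)).
by apply: ge0_ler_powR; rewrite ?nnegrE ?addr_ge0 ?enorm_ge0 ?enorm_triangle.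
Qed.

(** Elementary source of local integrability: a field of finite p-energy is dominated by 1 + |G|^p,
    integrable on sets of finite measure. *)
Lemma powR_le1D p (t : R) : 1 <= p -> 0 <= t -> t <= 1 + t `^ p.
Proof.
move=> p1 t0; have [t1|t1] := leP t 1.
  by rewrite (le_trans t1)// lerDl powR_ge0.
apply: (@le_trans _ _ (t `^ p)); last by rewrite lerDr.
by have := @ler_powR R t (ltW t1) 1 p p1; rewrite powRr1.
Qed.

Lemma measurable_coordG G i : measurable_fun setT G ->
  measurable_fun setT (fun x => G x ord0 i).
Proof. by move=> mG; exact: (measurableT_comp (@measurable_coord R n i) mG). Qed.

Lemma measurable_energy p G : measurable_fun setT G ->
  measurable_fun setT (fun x => (enorm (G x) `^ p)%:E).
Proof.
move=> mG; apply/measurable_EFinP.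
apply: (measurableT_comp (@measurable_powR R p)).
exact: (measurableT_comp (@measurable_enorm R n) mG).
Qed.

Lemma energy_ge0 p G : (0 <= energy p G)%E.
Proof. by apply: integral_ge0 => x _; rewrite lee_fin powR_ge0. Qed.

Lemma locally_integrable_coord p G i : 1 <= p -> measurable_fun setT G ->
  (energy p G < +oo)%E -> locally_integrable_rV (fun x => G x ord0 i).
Proof.
move=> p1 mG Goo; split; first exact: measurable_coordG.
move=> K cK; have mK := compact_measurable_rV cK.
have mE := measurable_energy p mG.
apply: (@le_lt_trans _ _ (\int[leb]_(x in K) (1 + (enorm (G x) `^ p)%:E))%E).
  apply: ge0_le_integral => //.
  - by apply: measurable_funTS; apply/measurable_EFinP; apply: measurableT_comp => //; exact: measurable_coordG.
  - by apply: measurable_funTS; exact: emeasurable_funD.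
  - move=> x _; rewrite -EFinD lee_fin (le_trans (coord_le_enorm _ _))//.
    by rewrite powR_le1D ?enorm_ge0.
rewrite ge0_integralD//; last 2 first.
- by move=> x _; rewrite lee_fin powR_ge0.
- exact: measurable_funTS.
rewrite integral_cst// mul1e lte_add_pinfty//; first exact: compact_lebesgue_fin.
apply: le_lt_trans Goo; apply: ge0_subset_integral => //.
by move=> x _; rewrite lee_fin powR_ge0.
Qed.

Lemma has_grad_weak p u G i : 1 <= p -> has_grad p u G ->
  is_weak_partial i u (fun x => G x ord0 i).
Proof.
move=> p1 [cu mG Goo HG]; split; last exact: HG.
exact: locally_integrable_coord Goo.
Qed.

Lemma has_grad_D1p p u G : 1 <= p -> has_grad p u G -> D1p p u.
Proof.
move=> p1 hG; have [cu mG Goo HG] := hG; split=> //.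
  exact: continuous_locally_integrable.
move=> i; exists (fun x => G x ord0 i); first exact: (has_grad_weak i p1 hG).
have p0 : 0 < p by apply: lt_le_trans p1.
rewrite inE; apply/andP; split; rewrite inE/=; first exact: measurable_coordG.
rewrite /finite_norm unlock; apply: poweR_lty; apply: le_lt_trans Goo.
change (\int[leb]_x (`|G x ord0 i| `^ p)%:E <= energy p G)%E.
apply: ge0_le_integral => //.
- apply/measurable_EFinP; apply: (measurableT_comp (@measurable_powR R p)).
  by apply: measurableT_comp => //; exact: measurable_coordG.
- exact: measurable_energy.
- move=> x _; rewrite lee_fin; apply: (ge0_ler_powR (ltW p0)); rewrite ?nnegrE ?enorm_ge0//.
  exact: coord_le_enorm.
Qed.

Lemma D1p_has_grad p u : 1 <= p -> D1p p u -> exists G, has_grad p u G.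
Proof.
move=> p1 [cu lu Hg0].
have /choice[g /all_and2[wg Lg]] : forall i, exists g : 'rV[R]_n -> R,
    is_weak_partial i u g /\ g \in Lfun leb p%:E.
  by move=> i; have [g] := Hg0 i; exists g.
have p0 : 0 < p by apply: lt_le_trans p1.
pose G x := \row_i g i x.
have mG : measurable_fun setT G.
  apply: measurable_fun_rVP => i; rewrite (_ : (fun _ => _) = g i).
    by have [[]] := wg i.
  by apply/funext => x; rewrite mxE.
exists G; split=> //; last first.
  move=> i phi tphi; have [_ ->//] := wg i.
  by congr (- _); apply: eq_Rintegral => x _; rewrite mxE.
(* At each point |G| is at most n times its largest coordinate in absolute value; since the position
   of that coordinate varies, the sum over all coordinates is used. *)
apply: (@le_lt_trans _ _ (\int[leb]_x \sum_(i < n) (n%:R `^ p * `|g i x| `^ p)%:E)%E).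
  apply: ge0_le_integral => //.
  - by move=> x _; rewrite lee_fin powR_ge0.
  - exact: measurable_energy.
  - apply: emeasurable_sum => i; apply/measurable_EFinP; apply: measurable_funM => //.
    apply: (measurableT_comp (@measurable_powR R p)); apply: measurableT_comp => //.
    by have [[]] := wg i.
  - move=> x _; rewrite sumEFin lee_fin.
    have [->|Gx0] := eqVneq (G x) 0.
      rewrite (_ : enorm 0 = 0) ?powR0 ?gt_eqF//; last by apply/eqP; rewrite enorm_eq0.
      by apply: sumr_ge0 => i _; rewrite mulr_ge0 ?powR_ge0.
    have [i Hi] : exists i, `|G x| = `|G x ord0 i|.
      have nz : mx_norm (G x) != 0 by rewrite -[mx_norm _]/(`|G x|) normr_eq0.
      have [[j i] Hji] := mx_norm_neq0 nz.
      by exists i; rewrite -[LHS]/(mx_norm (G x)) Hji /= ord1.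
    have n0 : (0 < n)%N by apply: leq_ltn_trans (ltn_ord i).
    have GH : enorm (G x) <= n%:R * `|g i x|.
      rewrite -(@ler_pXn2r _ 2)// ?nnegrE ?enorm_ge0 ?mulr_ge0// sqn_enorm exprMn.
      apply: (@le_trans _ _ (\sum_(j < n) `|g i x| ^+ 2)).
        apply: ler_sum => j _; rewrite -real_normK ?num_real// ler_pXn2r ?nnegrE//.
        by rewrite (le_trans (coord_norm_le _ _))// Hi mxE.
      rewrite sumr_const card_ord -[_ *+ n]mulr_natl ler_wpM2r ?sqr_ge0//.
      by rewrite -natrX ler_nat expnS expn1 leq_pmulr.
    rewrite (bigD1 i)//= -[leLHS]addr0 lerD//; last first.
      by apply: sumr_ge0 => j _; rewrite mulr_ge0 ?powR_ge0.
    by rewrite -powRM//; apply: (ge0_ler_powR (ltW p0)); rewrite ?nnegrE ?enorm_ge0 ?mulr_ge0.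
rewrite ge0_integral_sum//; last first.
  move=> i; apply/measurable_EFinP; apply: measurable_funM => //.
  apply: (measurableT_comp (@measurable_powR R p)); apply: measurableT_comp => //.
  by have [[]] := wg i.
apply: lte_sum_pinfty => i _; under eq_integral do rewrite EFinM.
rewrite ge0_integralZl_EFin ?powR_ge0//; last first.
  apply/measurable_EFinP; apply: (measurableT_comp (@measurable_powR R p)); apply: measurableT_comp => //.
  by have [[]] := wg i.
rewrite lte_mul_pinfty ?lee_fin ?powR_ge0//.
have /integrableP[_] := Lfun_integrable p1 (Lg i).
by under eq_integral do rewrite /= ger0_norm ?powR_ge0//.
Qed.

(** The chosen representatives [weak_partial] agree almost everywhere with the coordinates of any
    admissible [G], so the norm may be computed with [G]. *)
Lemma grad_normE p u G : (0 < n)%N -> 1 <= p -> has_grad p u G ->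
  grad_norm p u = ((energy p G) `^ p^-1)%E.
Proof.
move=> n0 p1 hG; have [cu mG Goo HG] := hG.
have ww i : is_weak_partial i u (weak_partial i u).
  by apply: (@xgetPex _ _ [set g | is_weak_partial i u g]); exists (fun x => G x ord0 i); exact: has_grad_weak p1 hG.
have mw : measurable_fun setT (weak_grad u).
  apply: measurable_fun_rVP => i; rewrite (_ : (fun _ => _) = weak_partial i u).
    by have [[]] := ww i.
  by apply/funext => x; rewrite mxE.
have ae i : {ae leb, forall x, weak_partial i u x = G x ord0 i}.
  exact: weak_partial_unique n0 (ww i) (has_grad_weak i p1 hG).
have aeG : {ae leb, forall x, weak_grad u x = G x}.
  have aei : {ae leb, forall x, forall i, weak_partial i u x = G x ord0 i} by exact: filter_forall.
  by apply: filterS aei => x Hx; apply/rowP => i; rewrite mxE.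
rewrite /grad_norm unlock; apply: (congr1 (fun z => poweR z p^-1)).
rewrite /energy.
transitivity (\int[leb]_x (enorm (weak_grad u x) `^ p)%:E)%E.
  by apply: eq_integral => x _; rewrite /= ger0_norm ?enorm_ge0.
apply: ae_eq_integral => //; [exact: measurable_energy|exact: measurable_energy|].
by apply: filterS aeG => x Hx _; rewrite Hx.
Qed.

Lemma energyZ p (a : R) G : 0 < p -> measurable_fun setT G ->
  energy p (fun x => a *: G x) = ((`|a| `^ p)%:E * energy p G)%E.
Proof.
move=> p0 mG; rewrite /energy; under eq_integral do rewrite enormZ powRM ?enorm_ge0// EFinM.
rewrite ge0_integralZl_EFin ?powR_ge0//; last exact: measurable_energy.
by move=> x _; rewrite lee_fin powR_ge0.
Qed.

Lemma measurable_rVD G H : measurable_fun setT G -> measurable_fun setT H ->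
  measurable_fun setT (fun x => G x + H x).
Proof.
move=> mG mH; apply: measurable_fun_rVP => i.
rewrite (_ : (fun _ => _) = fun x => G x ord0 i + H x ord0 i).
  by apply: measurable_funD; exact: measurable_coordG.
by apply/funext => x; rewrite mxE.
Qed.

Lemma measurable_rVZ (a : R) G : measurable_fun setT G ->
  measurable_fun setT (fun x => a *: G x).
Proof.
move=> mG; apply: measurable_fun_rVP => i.
rewrite (_ : (fun _ => _) = fun x => a * G x ord0 i).
  by apply: measurable_funM => //; exact: measurable_coordG.
by apply/funext => x; rewrite mxE.
Qed.

Lemma energyD_fin p G H : 0 <= p -> measurable_fun setT G -> measurable_fun setT H ->
  (energy p G < +oo)%E -> (energy p H < +oo)%E ->
  (energy p (fun x => G x + H x)%R < +oo)%E.
Proof.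
move=> p0 mG mH Goo Hoo.
apply: (@le_lt_trans _ _ (\int[leb]_x ((2 `^ p)%:E * ((enorm (G x) `^ p)%:E + (enorm (H x) `^ p)%:E)))%E).
  apply: ge0_le_integral => //.
  - by move=> x _; rewrite lee_fin powR_ge0.
  - by apply: measurable_energy; exact: measurable_rVD.
  - by apply: measurable_funeM; apply: emeasurable_funD; exact: measurable_energy.
  - by move=> x _; rewrite -EFinD -EFinM lee_fin enormD_powR.
rewrite ge0_integralZl_EFin ?powR_ge0//; last 2 first.
- by move=> x _; rewrite -EFinD lee_fin addr_ge0 ?powR_ge0.
- by apply: emeasurable_funD; exact: measurable_energy.
rewrite lte_mul_pinfty ?lee_fin ?powR_ge0// ge0_integralD//; last 4 first.
- by move=> x _; rewrite lee_fin powR_ge0.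
- exact: measurable_energy.
- by move=> x _; rewrite lee_fin powR_ge0.
- exact: measurable_energy.
exact: lte_add_pinfty Goo Hoo.
Qed.

Lemma has_gradD p u v G H : 1 <= p -> has_grad p u G -> has_grad p v H ->
  has_grad p (fun x => u x + v x) (fun x => G x + H x).
Proof.
move=> p1 hG hH; have [cu mG Goo HG] := hG; have [cv mH Hoo HH] := hH.
have p0 : 0 <= p by apply: le_trans p1.
split; [|exact: measurable_rVD|exact: energyD_fin|].
  by move=> x; exact: (continuousD (cu x) (cv x)).
move=> i phi tphi; have /test_functionP[Cphi sphi] := tphi.
have cphi := Ck_continuous (Cphi 0%N).
have cdphi := ((Cphi 1%N).2 i).2.1.
under eq_Rintegral do rewrite mulrDl.
rewrite RintegralD//; last 2 first.
- by apply: locally_integrableM => //; [exact: continuous_locally_integrable|exact: csupp_partial].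
- by apply: locally_integrableM => //; [exact: continuous_locally_integrable|exact: csupp_partial].
rewrite HG// HH// -opprD; congr (- _).
under [in RHS]eq_Rintegral do rewrite mxE mulrDl.
rewrite RintegralD//.
- by apply: locally_integrableM => //; exact: locally_integrable_coord p1 mG Goo.
- by apply: locally_integrableM => //; exact: locally_integrable_coord p1 mH Hoo.
Qed.

Lemma has_gradZ p (a : R) u G : 1 <= p -> has_grad p u G ->
  has_grad p (fun x => a * u x) (fun x => a *: G x).
Proof.
move=> p1 hG; have [cu mG Goo HG] := hG.
have p0 : 0 < p by apply: lt_le_trans p1.
split; [|exact: measurable_rVZ| |].
- by move=> x; apply: continuousM; [exact: cst_continuous|exact: cu].
- by rewrite energyZ// lte_mul_pinfty ?lee_fin ?powR_ge0.
move=> i phi tphi; have /test_functionP[Cphi sphi] := tphi.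
have cphi := Ck_continuous (Cphi 0%N).
have cdphi := ((Cphi 1%N).2 i).2.1.
under eq_Rintegral do rewrite -mulrA.
rewrite RintegralZl//; last first.
  by apply: locally_integrableM => //; [exact: continuous_locally_integrable|exact: csupp_partial].
rewrite HG// mulrN; congr (- _).
under [in RHS]eq_Rintegral do rewrite mxE -mulrA.
rewrite RintegralZl//.
by apply: locally_integrableM => //; exact: locally_integrable_coord p1 mG Goo.
Qed.

Lemma has_grad_cst p (c : R) : 1 <= p -> has_grad p (fun=> c) (fun=> 0).
Proof.
move=> p1; have p0 : 0 < p by apply: lt_le_trans p1.
split; [exact: cst_continuous|exact: measurable_cst| |].
  rewrite /energy (_ : enorm 0 = 0); last by apply/eqP; rewrite enorm_eq0.
  by rewrite powR0 ?gt_eqF// integral0.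
move=> i phi tphi; rewrite (integration_by_parts i (Ck_cst 1 c) tphi); congr (- _).
by apply: eq_Rintegral => x _; rewrite mxE /partial derive_cst.
Qed.

Lemma has_grad_affine p (c a : R) u G : 1 <= p -> has_grad p u G ->
  has_grad p (fun x => c + a * u x) (fun x => a *: G x).
Proof.
move=> p1 hG; have := has_gradD p1 (has_grad_cst c p1) (has_gradZ a p1 hG).
by under [X in has_grad _ _ X]eq_fun do rewrite add0r.
Qed.

Lemma has_gradB p u v G H : 1 <= p -> has_grad p u G -> has_grad p v H ->
  has_grad p (fun x => u x - v x) (fun x => G x - H x).
Proof.
move=> p1 hG hH; have := has_gradD p1 hG (has_gradZ (-1) p1 hH).
under eq_fun do rewrite mulN1r.
by under [X in has_grad _ _ X]eq_fun do rewrite scaleN1r.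
Qed.

Lemma Rintegral_similarity (l : R) (Q : 'M[R]_n) b (f : 'rV[R]_n -> R) :
  0 < l -> Q *m Q^T = 1%:M -> measurable_fun setT f ->
  \int[leb]_x f (l *: (x *m Q) + b) = l ^- n * \int[leb]_x f x.
Proof.
move=> l0 QQ mf.
have := integral_similarity b l0 QQ (proj2 (measurable_EFinP _ _) mf).
rewrite /Rintegral /= => ->.
have k0 : 0 < l ^- n by rewrite invr_gt0 exprn_gt0.
case: (\int[leb]_x (f x)%:E)%E => [r| |] //=.
- by rewrite gt0_muley ?lte_fin//= mulr0.
- by rewrite gt0_muleNy ?lte_fin//= mulr0.
Qed.

Lemma Rintegral_sum (F : 'I_n -> 'rV[R]_n -> R) :
  (forall j, leb.-integrable setT (EFin \o F j)) ->
  \int[leb]_x (\sum_j F j x) = \sum_j \int[leb]_x F j x.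
Proof.
move=> iF; rewrite /Rintegral; under eq_integral do rewrite -sumEFin.
rewrite integral_sum// -sum_fine// => j _; exact: (integrable_fin_num measurableT (iF j)).
Qed.

Lemma test_function_affine (A B : 'M[R]_n) b phi : A *m B = 1%:M -> B *m A = 1%:M ->
  test_function phi -> test_function (fun y => phi (y *m B + - b *m B)).
Proof.
move=> AB BA /test_functionP[Cphi [r Hr]]; apply/test_functionP; split.
  by move=> k; exact: Ck_affine.
(* A point y whose image z lies in [cube r] is zA + b; the radius bounds all coordinates of such
   points at once, and the final 1 makes the bound strict. *)
exists (\sum_i (\sum_j `|r| * `|A j i| + `|b ord0 i|) + 1) => y /Hr/cubeP yr.
apply/cubeP => i.
have yE : y ord0 i = \sum_j (y *m B + - b *m B) ord0 j * A j i + b ord0 i.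
  have : y = (y *m B + - b *m B) *m A + b.
    by rewrite -mulmxDl -mulmxA BA mulmx1 subrK.
  by move=> /(congr1 (fun z : 'rV[R]_n => z ord0 i)); rewrite [in RHS]mxE [in RHS]mxE.
rewrite yE ltr_pwDr//; apply: (@le_trans _ _ (\sum_j `|r| * `|A j i| + `|b ord0 i|)).
  apply: le_trans (ler_normD _ _) _; rewrite lerD2r.
  apply: le_trans (ler_norm_sum _ _ _) _; apply: ler_sum => j _.
  by rewrite normrM ler_wpM2r// (le_trans (ltW (yr j)))// ler_norm.
rewrite [leRHS](bigD1 i)//= lerDl; apply: sumr_ge0 => k _; rewrite addr_ge0//.
by apply: sumr_ge0 => j _; rewrite mulr_ge0.
Qed.

(** The chain rule contributes l^p to the energy and the change of variables l^(-n). The weak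
    identity is carried over by moving the test function instead of [u]. *)
Lemma has_grad_similarity p u G (l : R) (Q : 'M[R]_n) b : 1 <= p -> 0 < l ->
  Q *m Q^T = 1%:M -> has_grad p u G ->
  let H := fun x => l *: (G (l *: (x *m Q) + b) *m Q^T) in
  has_grad p (fun x => u (l *: (x *m Q) + b)) H /\
  energy p H = ((l `^ p * l ^- n)%:E * energy p G)%E.
Proof.
move=> p1 l0 QQ hG H; have [cu mG Goo HG] := hG.
have p0 : 0 < p by apply: lt_le_trans p1.
have QQ' : Q^T *m Q = 1%:M by exact: mulmx1C.
pose T x : 'rV[R]_n := l *: (x *m Q) + b.
pose A := l *: Q; pose B := l^-1 *: Q^T.
have TE x : T x = x *m A + b by rewrite /T /A scalemxAr.
have cT : continuous T.
  by rewrite (_ : T = fun x => x *m A + b); [exact: continuous_affine|apply/funext].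
have mT : measurable_fun setT T.
  apply: measurable_fun_rVP => i; apply: continuous_measurable_rV => x.
  by apply: (@continuous_comp _ _ _ T (fun y : 'rV[R]_n => y ord0 i)); [exact: cT|exact: coord_continuous].
have mGT : measurable_fun setT (fun x => G (T x)) by exact: (measurableT_comp mG mT).
have mH : measurable_fun setT H.
  by apply: measurable_rVZ; exact: (measurableT_comp (measurable_mulmxr Q^T) mGT).
have eGT : energy p (fun x => G (T x) *m Q^T) = ((l ^- n)%:E * energy p G)%E.
  have g0 x : (0 <= (enorm (G x) `^ p)%:E)%E by rewrite lee_fin powR_ge0.
  rewrite /energy -(ge0_integral_similarity b l0 QQ (measurable_energy p mG) g0).
  by apply: eq_integral => x _; rewrite enorm_mulmx// trmxK.
have eH : energy p H = ((l `^ p * l ^- n)%:E * energy p G)%E.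
  rewrite (@energyZ p l (fun x => G (T x) *m Q^T) p0 (measurableT_comp (measurable_mulmxr Q^T) mGT)).
  by rewrite eGT (gtr0_norm l0) muleA -EFinM.
split; last exact: eH.
split; [|exact: mH| |].
- by move=> x; apply: (@continuous_comp _ _ _ T u); [exact: cT|exact: cu].
- rewrite eH; apply: lte_mul_pinfty => //.
  by rewrite lee_fin mulr_ge0 ?powR_ge0// invr_ge0 exprn_ge0// ltW.
move=> i phi tphi.
have AB : A *m B = 1%:M by rewrite /A /B -scalemxAl -scalemxAr scalerA QQ divff ?scale1r// gt_eqF.
have BA : B *m A = 1%:M by exact: mulmx1C.
(* The test function transported by the inverse similarity, so that [phi] is [psi] after [T]. *)
pose psi y := phi (y *m B + - b *m B).
have tpsi : test_function psi by exact: (test_function_affine b AB BA tphi).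
have psiT x : psi (T x) = phi x.
  by rewrite /psi TE -mulmxDl addrK -mulmxA AB mulmx1.
have /test_functionP[Cpsi spsi] := tpsi.
have cpsi := Ck_continuous (Cpsi 0%N).
have cdpsi j : continuous (partial j psi) by exact: ((Cpsi 1%N).2 j).2.1.
have dphi x : partial i phi x = \sum_j A i j * partial j psi (T x).
  have := @partial_affine R n psi A b i x (Cpsi 1%N).
  rewrite -TE (_ : (fun x => psi _) = phi) => [d|].
    exact: (@derive_val _ _ _ _ _ _ _ d).
  by apply/funext => y; rewrite -TE psiT.
have Iu j : leb.-integrable setT (EFin \o (fun x => u x * partial j psi x)).
  by apply: locally_integrableM => //; [exact: continuous_locally_integrable|exact: csupp_partial].
have IG j : leb.-integrable setT (EFin \o (fun x => G x ord0 j * psi x)).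
  by apply: locally_integrableM => //; exact: locally_integrable_coord p1 mG Goo.
have IuA j : leb.-integrable setT (EFin \o (fun x => A i j * (u x * partial j psi x))).
  exact: (integrableZl measurableT (A i j) (Iu j)).
have IGA j : leb.-integrable setT (EFin \o (fun x => A i j * (G x ord0 j * psi x))).
  exact: (integrableZl measurableT (A i j) (IG j)).
pose F1 y := \sum_j A i j * (u y * partial j psi y).
pose F2 y := \sum_j A i j * (G y ord0 j * psi y).
have mF1 : measurable_fun setT F1.
  by apply: measurable_sum => j; exact: (proj1 (measurable_EFinP _ _) (measurable_int leb (IuA j))).
have mF2 : measurable_fun setT F2.
  by apply: measurable_sum => j; exact: (proj1 (measurable_EFinP _ _) (measurable_int leb (IGA j))).
transitivity (\int[leb]_x F1 (T x)).
  apply: eq_Rintegral => x _; rewrite dphi mulr_sumr; apply: eq_bigr => j _.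
  by rewrite mulrCA.
transitivity (- \int[leb]_x F2 (T x)); last first.
  congr (- _); apply: eq_Rintegral => x _; rewrite /F2 psiT /H !mxE mulr_sumr mulr_suml.
  by apply: eq_bigr => j _; rewrite !mxE mulrA [_ * G _ _ _]mulrAC -!mulrA.
rewrite (Rintegral_similarity b l0 QQ mF1) (Rintegral_similarity b l0 QQ mF2).
rewrite -mulrN; congr (_ * _).
rewrite !Rintegral_sum// -sumrN; apply: eq_bigr => j _.
by rewrite !RintegralZl// HG// mulrN.
Qed.

End dirichlet.

(** * Morrey's inequality for a pair of points *)

Section morrey_estimate.
Context {R : realType} {n : nat} (p : R).
Context (n0 : (0 < n)%N) (np : n%:R < p).
Implicit Types (u phi : 'rV[R]_n -> R) (G : 'rV[R]_n -> 'rV[R]_n) (i : 'I_n).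
Local Notation leb := (rV_lebesgue R n).

Let p1 : 1 <= p.
Proof. by apply: le_trans (ltW np); rewrite ler1n. Qed.

Let p0 : 0 < p. Proof. exact: lt_le_trans p1. Qed.

Lemma continuous_scale_shift (c : R) (d : 'rV[R]_n) :
  continuous (fun x : 'rV[R]_n => c *: (x - d)).
Proof.
rewrite (_ : (fun _ => _) = fun x : 'rV[R]_n => x *m c%:M + - (c *: d)).
  exact: continuous_affine.
by apply/funext => x; rewrite mul_mx_scalar scalerBr.
Qed.

(** The weak identity moves the derivative onto [u]; on the support of [phi] the coordinate of the
    gradient is at most 1 + |G|^p. The constant depends on [phi] only, not on [u]. *)
Lemma test_pairing_bound i phi : test_function phi -> exists2 C : R, 0 <= C &
  forall u G, has_grad p u G -> (energy p G <= 1)%E ->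
    `|\int[leb]_x (u x * partial i phi x)| <= C.
Proof.
move=> tphi; have /test_functionP[Cphi sphi] := tphi.
have cphi := Ck_continuous (Cphi 0%N).
have [M M0 HM] := csupp_bounded cphi sphi.
have [r Hr] := sphi.
have mQ : measurable (cube r : set 'rV[R]_n) by exact: measurable_obox.
have Qfin : leb (cube r) \is a fin_num by rewrite ge0_fin_numE// rV_lebesgue_obox_fin.
exists (M * (fine (leb (cube r)) + 1)).
  by rewrite mulr_ge0// addr_ge0// fine_ge0.
move=> u G hG E1; have [cu mG Goo HG] := hG; rewrite HG// normrN.
have I1 : leb.-integrable setT (EFin \o (fun x => G x ord0 i * phi x)).
  by apply: locally_integrableM => //; exact: (locally_integrable_coord i p1 mG Goo).
apply: le_trans (le_normr_Rintegral measurableT I1) _.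
have mE := measurable_energy p mG.
have mI : measurable_fun setT (fun x => (\1_(cube r) x + enorm (G x) `^ p)%:E).
  apply/measurable_EFinP; apply: measurable_funD; first exact: measurable_indic.
  exact/measurable_EFinP.
have E0 : (0 <= energy p G)%E by exact: energy_ge0.
have Efin : energy p G \is a fin_num by rewrite ge0_fin_numE.
have : (\int[leb]_x `|G x ord0 i * phi x|%:E <= M%:E * (leb (cube r) + energy p G))%E.
  have <- : (\int[leb]_x (\1_(cube r) x + enorm (G x) `^ p)%:E = leb (cube r) + energy p G)%E.
    under eq_integral do rewrite EFinD.
    rewrite ge0_integralD//; last 2 first.
    - by apply/measurable_EFinP; exact: measurable_indic.
    - by move=> x _; rewrite lee_fin powR_ge0.
    by rewrite integral_indic// setIT.
  rewrite -(@ge0_integralZl_EFin _ _ _ leb setT measurableT _ _ mI M)//; last first.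
    by move=> x _; rewrite lee_fin addr_ge0 ?powR_ge0.
  apply: ge0_le_integral => //.
  - apply/measurable_EFinP; apply: measurableT_comp => //.
    exact: (proj1 (measurable_EFinP _ _) (measurable_int leb I1)).
  - exact: measurable_funeM.
  - move=> x _; rewrite -EFinM lee_fin normrM.
    have [xr|xr] := pselect (cube r x); last first.
      have -> : phi x = 0 by apply/eqP; apply: contra_notT xr => /Hr.
      by rewrite normr0 mulr0 mulr_ge0// addr_ge0 ?powR_ge0.
    rewrite mulrC ler_pM// indicE mem_set//.
    by rewrite (le_trans (coord_le_enorm _ _))// powR_le1D ?enorm_ge0.
rewrite /Rintegral => H.
rewrite -lee_fin fineK; last first.
  have /integrableP[_ I1oo] := I1; rewrite ge0_fin_numE; first exact: I1oo.
  by apply: integral_ge0 => x _; rewrite lee_fin.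
apply: le_trans H _.
rewrite -[leb (cube r)]fineK// -[energy p G]fineK// -EFinD -EFinM lee_fin ler_wpM2l// lerD2l.
by rewrite -lee_fin fineK.
Qed.

(* Exchanging the factors one coordinate at a time writes [tens f - tens g] as the divergence
   of a compactly supported smooth field. *)
Lemma tens_sub_bound (f g t : 'I_n -> R -> R) :
  (forall i, bump1 (f i)) -> (forall i, bump1 (g i)) -> (forall i, bump1 (t i)) ->
  (forall i x, derive1 (t i) x = f i x - g i x) ->
  exists2 C : R, 0 <= C & forall u G, has_grad p u G -> (energy p G <= 1)%E ->
    `|\int[leb]_x (u x * tens f x) - \int[leb]_x (u x * tens g x)| <= C.
Proof.
move=> Bf Bg Bt tfg.
(* The first m factors are already exchanged: [h 0] is [f] and [h n] is [g]. In [phi m] the m-th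
   factor is the primitive [t m], so its m-th partial derivative is the m-th exchange. *)
pose h (m : nat) (i : 'I_n) := if (i < m)%N then g i else f i.
pose phi (m : 'I_n) := tens (tens_upd (h m) m (t m)).
have Bh m i : bump1 (h m i) by rewrite /h; case: ifP.
have tphi m : test_function (phi m).
  by apply: test_function_tens => // i; rewrite /tens_upd; case: eqP.
have th m : test_function (tens (h m)) by exact: test_function_tens.
have dphi m x : partial m (phi m) x = tens (h m) x - tens (h m.+1) x.
  rewrite /phi partial_tens; last first.
    by move=> y; rewrite /tens_upd eqxx; have [D _] := Bt m; exact: (D 1%N).2.1.
  rewrite (_ : tens_upd _ m _ = tens_upd (h m) m (derive1 (t m))); last first.
    by apply/funext => i; rewrite /tens_upd eqxx; case: eqP.
  rewrite tens_updE tfg (tensE (h m) m) (tensE (h m.+1) m).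
  have -> : \prod_(j | j != m) h m.+1 j (x ord0 j) = \prod_(j | j != m) h m j (x ord0 j).
    apply: eq_bigr => j jm; rewrite /h ltnS leq_eqVlt.
    by rewrite (_ : (j == m :> nat) = false)//; apply/negbTE.
  have -> : h m m = f m by rewrite /h ltnn.
  have -> : h m.+1 m = g m by rewrite /h ltnSn.
  by rewrite mulrBl.
have /choice[C HC] : forall m : 'I_n, exists C : R, 0 <= C /\
    forall u G, has_grad p u G -> (energy p G <= 1)%E ->
    `|\int[leb]_x (u x * partial m (phi m) x)| <= C.
  by move=> m; have [C C0 HC] := test_pairing_bound m (tphi m); exists C.
exists (\sum_m C m); first by apply: sumr_ge0 => m _; have [] := HC m.
move=> u G hG E1.
have [cu _ _ _] := hG.
have Itest psi : test_function psi -> leb.-integrable setT (EFin \o (fun x => u x * psi x)).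
  move=> /test_functionP[Cpsi spsi]; apply: locally_integrableM => //.
    exact: continuous_locally_integrable.
  exact: Ck_continuous (Cpsi 0%N).
have -> : \int[leb]_x (u x * tens f x) - \int[leb]_x (u x * tens g x) =
    \sum_(m < n) \int[leb]_x (u x * partial m (phi m) x).
  rewrite (_ : f = h 0%N); last by apply/funext => i; rewrite /h ltn0.
  rewrite {1}(_ : g = h n); last by apply/funext => i; rewrite /h ltn_ord.
  rewrite -opprB -(telescope_sumr (fun m => \int[leb]_x (u x * tens (h m) x)) (leq0n n)).
  rewrite big_mkord -sumrN; apply: eq_bigr => m _.
  rewrite opprB -RintegralB//; [|exact: Itest|exact: Itest].
  by apply: eq_Rintegral => x _; rewrite dphi mulrBr.
apply: le_trans (ler_norm_sum _ _ _) _; apply: ler_sum => m _.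
by have [_ H] := HC m; exact: (H u G hG E1).
Qed.

Definition eta : 'rV[R]_n -> R := tens (fun=> bump).

Lemma test_eta : test_function eta.
Proof. exact: (test_function_tens n0 (fun=> bump_bump1)). Qed.

Lemma continuous_eta : continuous eta.
Proof. by have /test_functionP[/(_ 0%N) C _] := test_eta; exact: (Ck_continuous C). Qed.

Lemma csupp_eta : csupp eta.
Proof. by have /test_functionP[] := test_eta. Qed.

Lemma eta_ge0 x : 0 <= eta x.
Proof. by apply: prodr_ge0 => i _; exact: bump_ge0. Qed.

Lemma eta0_gt0 : 0 < eta 0.
Proof. by rewrite /eta /tens prodr_gt0// => i _; rewrite mxE bump0_gt0. Qed.

Lemma eta_affineE (c : R) (d x : 'rV[R]_n) :
  tens (fun i y => c * bump (c * y + d ord0 i)) x = c ^+ n * eta (c *: x + d).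
Proof.
rewrite /eta /tens big_split/= prodr_const card_ord; congr (_ * _).
by apply: eq_bigr => i _; rewrite !mxE.
Qed.

Lemma etaE x : eta x = tens (fun=> bump) x. Proof. by []. Qed.

Opaque eta.

(** Comparing [eta] with the density c^n eta(c x + d) of equal mass; a change of variables then
    moves the affine map from the density to [u]. *)
Lemma eta_affine_bound (c : R) (d : 'rV[R]_n) : 0 < c -> exists2 C : R, 0 <= C &
  forall u G, has_grad p u G -> (energy p G <= 1)%E ->
    `|\int[leb]_x (u x * eta x) - \int[leb]_x (u (c^-1 *: (x - d)) * eta x)| <= C.
Proof.
move=> c0; have cn0 : c ^+ n != 0 by rewrite expf_neq0// gt_eqF.
have [C C0 HC] := @tens_sub_bound (fun=> bump) (fun i x => c * bump (c * x + d ord0 i))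
  (fun i x => step x - step (c * x + d ord0 i)) (fun=> bump_bump1)
  (fun i => bump_affine _ c0) (fun i => step_sub_bump1 _ c0) (fun i x => derive1_step_sub _ _ _).
exists C => // u G hG E1; have := HC u G hG E1.
under eq_Rintegral do rewrite -etaE.
set a := \int[leb]_x _; congr (`|_ - _| <= _).
have QQ : (1%:M : 'M[R]_n) *m (1%:M)^T = 1%:M by rewrite trmx1 mulmx1.
have [cu _ _ _] := hG.
have ceta := continuous_eta; have csb := csupp_eta.
have cuS : continuous (fun x : 'rV[R]_n => u (c^-1 *: (x - d))).
  move=> x; apply: (@continuous_comp _ _ _ (fun x : 'rV[R]_n => c^-1 *: (x - d)) u); last exact: cu.
  exact: continuous_scale_shift.
have IF : leb.-integrable setT (EFin \o (fun x : 'rV[R]_n => u (c^-1 *: (x - d)) * eta x)).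
  by apply: locally_integrableM => //; exact: continuous_locally_integrable.
have mF : measurable_fun setT (fun x : 'rV[R]_n => c ^+ n * (u (c^-1 *: (x - d)) * eta x)).
  by apply: measurable_funM => //; apply: continuous_measurable_rV => x; apply: continuousM; [exact: cuS|exact: ceta].
have E2 := RintegralZl (c ^+ n) measurableT IF.
have E3 := Rintegral_similarity d c0 QQ mF.
rewrite -[RHS](mulKf cn0) -E2 -E3.
apply: eq_Rintegral => x _.
by rewrite mulmx1 addrK scalerA (mulVf (lt0r_neq0 c0)) scale1r mulrCA eta_affineE.
Qed.

Lemma Rintegral_eta_gt0 : 0 < \int[leb]_x eta x.
Proof.
have ceta := continuous_eta; have csb := csupp_eta.
have eta0 := eta0_gt0.
have e20 : 0 < eta 0 / 2 by rewrite divr_gt0.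
have /cvgrPdist_lt/(_ _ e20)/nbhs_ballP[d /= d0 Hd] := ceta 0.
have mQ : measurable (cube d : set 'rV[R]_n) by exact: measurable_obox.
have Hcube x : cube d x -> eta 0 / 2 <= eta x.
  move=> /cubeP xd; have : ball (0 : 'rV[R]_n) d x.
    rewrite mx_norm_ball /ball_/= sub0r normrN [ltLHS]mx_normrE.
    by apply/bigmax_ltP; split=> // -[j i] _ /=; rewrite ord1.
  move=> /Hd /= /(le_lt_trans (ler_norm _)) /ltW.
  by rewrite lerBlDr -lerBlDl {1}[eta 0]splitr addrK.
have I0 : leb.-integrable setT (EFin \o eta) by exact: integrable_csupp.
rewrite -lte_fin fineK; last exact: (integrable_fin_num measurableT I0).
apply: (@lt_le_trans _ _ ((eta 0 / 2)%:E * leb (cube d))%E).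
  by rewrite rV_lebesgue_cube ?ltW// -EFinM lte_fin mulr_gt0// exprn_gt0// mulr_gt0.
rewrite -[cube d]setIT -integral_indic// -ge0_integralZl_EFin//; last 2 first.
- by apply/measurable_EFinP; exact: measurable_indic.
- exact: ltW.
have mc : measurable_fun setT (fun x : 'rV[R]_n => ((eta 0 / 2)%:E * (\1_(cube d) x)%:E)%E).
  by apply: measurable_funeM; apply/measurable_EFinP; exact: measurable_indic.
have mI := measurable_int leb I0.
clear ceta csb Hd I0.
apply: (ge0_le_integral _ _ _ mc mI) => [|x _|x _]; first exact: measurableT.
  by rewrite -EFinM lee_fin mulr_ge0// ltW.
rewrite -EFinM lee_fin indicE; case: (boolP (x \in _)) => [xd|_].
  by rewrite mulr1; apply: Hcube; rewrite inE in xd.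
by rewrite mulr0 eta_ge0.
Qed.

(** Induction by rescaling: u(x/2) divided by [q] again has energy at most 1, so passing from one
    scale to the next shrinks the error by [q], and the bound is uniform in [k]. *)
Lemma dyadic_bound : exists2 C : R, 0 <= C & forall (k : nat) u G,
  has_grad p u G -> (energy p G <= 1)%E ->
  `|\int[leb]_x (u x * eta x) - \int[leb]_x (u (2 ^- k *: x) * eta x)| <= C.
Proof.
have [C C0 HC] := @eta_affine_bound 2 0 ltac:(by []).
(* q^p is 2^(n - p), the factor by which the energy changes under x -> x/2; q < 1 because p > n. *)
pose q : R := 2^-1 `^ ((p - n%:R) / p).
have q0 : 0 < q by rewrite powR_gt0// invr_gt0.
have e0 : 0 < (p - n%:R) / p by rewrite divr_gt0// subr_gt0.
have q1 : q < 1.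
  have -> : 1 = 1 `^ ((p - n%:R) / p) :> R by rewrite powR1.
  by rewrite gt0_ltr_powR// ?nnegrE ?invr_ge0// invf_lt1// ltr1n.
have qp : q `^ p = 2^-1 `^ (p - n%:R).
  by rewrite -powRrM divfK// gt_eqF.
have q1' : 0 < 1 - q by rewrite subr_gt0.
(* The sum of the geometric series, that is, the solution of C + q X = X. *)
exists (C / (1 - q)); first by rewrite divr_ge0// ltW.
elim=> [|k IH] u G hG E1.
  rewrite expr0 invr1; under [X in _ - X]eq_Rintegral do rewrite scale1r.
  by rewrite subrr normr0 divr_ge0// ltW.
have QQ : (1%:M : 'M[R]_n) *m (1%:M)^T = 1%:M by rewrite trmx1 mulmx1.
have h0 : (0 : R) < 2^-1 by rewrite invr_gt0.
have [] := has_grad_similarity 0 p1 h0 QQ hG; set H := (fun x => _ *: _) => hH EH.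
pose Su x := q^-1 * u (2^-1 *: x).
have hS : has_grad p Su (fun x => q^-1 *: H x).
  have := has_gradZ q^-1 p1 hH.
  by under eq_fun do rewrite mulmx1 addr0.
have [_ mH _ _] := hH.
have ES : (energy p (fun x => q^-1 *: H x)%R <= 1)%E.
  rewrite energyZ// EH muleA -EFinM.
  rewrite (_ : _ * _ = 1)%R ?mul1e// gtr0_norm ?invr_gt0//.
  rewrite -powR_inv1 ?ltW// -powRrM mulN1r powRN qp.
  rewrite powRB; last by rewrite invr_eq0 pnatr_eq0 implybT.
  rewrite (powR_mulrn n (ltW h0)) mulVf//.
have := IH _ _ hS ES; have := HC u G hG E1.
under [X in `|_ - X| <= _ -> _]eq_Rintegral do rewrite subr0.
have cu2 (c : R) : continuous (fun x : 'rV[R]_n => u (c *: x)).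
  have [cu _ _ _] := hG.
  move=> x; apply: (@continuous_comp _ _ _ (fun x : 'rV[R]_n => c *: x) u); last exact: cu.
  by have := @continuous_scale_shift c 0 x; under eq_fun do rewrite subr0.
have ceta := continuous_eta; have csb := csupp_eta.
have SZ (c : R) : \int[leb]_x (Su (c *: x) * eta x) = q^-1 * \int[leb]_x (u ((2^-1 * c) *: x) * eta x).
  rewrite -RintegralZl//.
    by apply: eq_Rintegral => x _; rewrite /Su scalerA mulrA.
  by apply: locally_integrableM => //; exact: continuous_locally_integrable.
have := SZ 1; under eq_Rintegral do rewrite scale1r; rewrite mulr1 => ->.
rewrite SZ -exprVn -exprS exprVn.
set a := \int[leb]_x _; set b := \int[leb]_x _; set c := \int[leb]_x _.
move=> H1 H2.
rewrite -(subrKA b) (le_trans (ler_normD _ _))//.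
rewrite -mulrBr normrM gtr0_norm ?invr_gt0// ler_pdivrMl// in H2.
have := lerD H1 H2; move=> /le_trans; apply.
rewrite le_eqVlt; apply/orP; left; apply/eqP; field; rewrite gt_eqF//.
Qed.

(** For x in the support of [eta] all points 2^(-k) x stay in one cube, where the continuous [u] is
    bounded; this dominates the integrands. *)
Lemma cvg_eta_dilation u : continuous u ->
  \int[leb]_x (u (2 ^- k *: x) * eta x) @[k --> \oo] --> u 0 * \int[leb]_x eta x.
Proof.
move=> cu.
have ceta := continuous_eta; have csb := csupp_eta.
have cu2 (c : R) : continuous (fun x : 'rV[R]_n => u (c *: x)).
  move=> x; apply: (@continuous_comp _ _ _ (fun x : 'rV[R]_n => c *: x) u); last exact: cu.
  by have := @continuous_scale_shift c 0 x; under eq_fun do rewrite subr0.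
have I0 : leb.-integrable setT (EFin \o eta) by exact: integrable_csupp.
have [r Hr] := csb.
have [M M0 HM] := compact_bounded_continuous (@cube_closure_compact R n r _ (@subset_refl _ _)) cu.
rewrite -RintegralZl//.
have [|||||_] := @dominated_cvg_real _ _ _ leb (fun k x => u (2 ^- k *: x) * eta x)
  (fun x => u 0 * eta x) (fun x => M * `|eta x|).
- by move=> k; apply: continuous_measurable_rV => x; apply: continuousM; [exact: cu2|exact: ceta].
- by apply: continuous_measurable_rV => x; apply: continuousM; [exact: cst_continuous|exact: ceta].
- apply: aeW => x; apply: cvgM; last exact: cvg_cst.
  have cv : 2 ^- k *: x @[k --> \oo] --> (0 : 'rV[R]_n).
    rewrite -(scale0r x); apply: cvgZr_tmp.
    under eq_fun do rewrite -exprVn.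
    by apply: cvg_expr; rewrite ger0_norm ?invr_ge0// invf_lt1// ltr1n.
  exact: (cvg_comp _ _ cv (cu 0)).
- exact: (integrableZl measurableT M (integrable_abse I0)).
- apply: aeW => x k; rewrite normrM.
  have [->|/Hr xr] := eqVneq (eta x) 0; first by rewrite normr0 !mulr0.
  rewrite ler_wpM2r//; apply: HM; apply: subset_closure; apply/cubeP => i.
  move/cubeP : xr => /(_ i); rewrite mxE normrM; apply: le_lt_trans.
  by rewrite ler_piMl// ger0_norm ?invr_ge0// invf_le1 ?exprn_gt0// exprn_ege1// ler1n.
- by [].
Qed.

(* Averages against the dilates of [eta] concentrate at the origin; consecutive ones differ
   by a divergence. *)
Lemma mean_value_bound : exists2 C : R, 0 <= C & forall u G,
  has_grad p u G -> (energy p G <= 1)%E ->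
  `|\int[leb]_x (u x * eta x) - u 0 * \int[leb]_x eta x| <= C.
Proof.
have [C C0 HC] := dyadic_bound; exists C => // u G hG E1.
have [cu _ _ _] := hG.
have := cvg_eta_dilation cu => /(cvgB (cvg_cst (\int[leb]_x (u x * eta x)))) /cvg_norm H.
rewrite -(cvg_lim _ H)//; apply: limr_le; first by apply/cvg_ex; eexists; exact: H.
by apply: nearW => k; exact: (HC k u G hG E1).
Qed.

(** Translations bring each point to the origin, where the value is compared with an average, and
    the two averages are compared with each other. *)
Lemma morrey_pair (x0 y0 : 'rV[R]_n) : exists2 C : R, 0 < C & forall u G,
  has_grad p u G -> (energy p G <= 1)%E -> `|u x0 - u y0| <= C.
Proof.
have [C1 C10 H1] := mean_value_bound.
(* Scale 1 and displacement x0 - y0 turn the average of [u] around [x0] into the one around [y0]. *)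
have [C2 C20 H2] := @eta_affine_bound 1 (x0 - y0) ltr01.
have I0 := Rintegral_eta_gt0; set I := \int[leb]_x eta x in I0 H1.
exists ((C1 + C2 + C1) / I + 1).
  by rewrite ltr_wpDl// divr_ge0 ?addr_ge0// ltW.
move=> u G hG E1.
have QQ : (1%:M : 'M[R]_n) *m (1%:M)^T = 1%:M by rewrite trmx1 mulmx1.
have shift b : exists2 H, has_grad p (fun x => u (x + b)) H & (energy p H <= 1)%E.
  have [] := has_grad_similarity b p1 ltr01 QQ hG; set H := (fun x => _ *: _) => hH EH.
  exists H; first by move: hH; under eq_fun do rewrite scale1r mulmx1.
  by rewrite EH powR1 expr1n invr1 mulr1 mul1e.
have [Hx hx Ex] := shift x0; have [Hy hy Ey] := shift y0.
have := H1 _ _ hx Ex; have := H1 _ _ hy Ey; have := H2 _ _ hx Ex.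
rewrite !add0r.
under [X in `|_ - X| <= C2 -> _]eq_Rintegral do rewrite invr1 scale1r opprB addrA subrK.
set a := \int[leb]_x _; set b := \int[leb]_x _ => h2 h3 h4.
apply: (@le_trans _ _ ((C1 + C2 + C1) / I)); last by rewrite lerDl.
rewrite ler_pdivlMr// -[X in _ * X](gtr0_norm I0) -normrM mulrBl.
rewrite (_ : _ - _ = - (a - u x0 * I) + (a - b) + (b - u y0 * I)); last by ring.
rewrite (le_trans (ler_normD _ _))// lerD//.
by rewrite (le_trans (ler_normD _ _))// lerD// normrN.
Qed.

End morrey_estimate.

(** * Uniform convexity *)

Lemma bernoulli_lt (R : realType) (p x : R) : 1 < p -> 0 <= x -> x != 1 ->
  1 + p * (x - 1) < x `^ p.
Proof.
move=> p1 x0 x1; have p0 : 0 < p by apply: lt_trans p1.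
have [->|xn0] := eqVneq x 0; first by rewrite powR0 ?gt_eqF//; lra.
have xp : 0 < x by rewrite lt_neqAle eq_sym xn0.
have l0 : ln x != 0 by rewrite ln_eq0.
set l := ln x in l0; have ex : expR l = x by rewrite lnK.
(* With l = ln x, the two strict bounds give x^p > x + (p - 1) x l and x l > x - 1; together they
   yield the claim. *)
have H1 := @expR_gt1Dx R ((p - 1) * l) ltac:(by rewrite mulf_neq0// gt_eqF// subr_gt0).
have H2 := @expR_gt1Dx R (- l) ltac:(by rewrite oppr_eq0).
have -> : x `^ p = x * expR ((p - 1) * l).
  by rewrite /powR (negbTE xn0) -/l -[X in _ = X * _]ex -expRD; congr expR; ring.
rewrite expRN ex -(ltr_pM2l xp) mulfV// in H2.
move: H1; rewrite -(ltr_pM2l xp) => H1.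
nra.
Qed.

(** After division by the midpoint the two numbers have mean 1, so the linear terms in Bernoulli's
    inequality cancel. *)
Lemma powR_midpoint_lt (R : realType) (p s t : R) : 1 < p -> 0 <= s -> 0 <= t -> s != t ->
  ((s + t) / 2) `^ p < (s `^ p + t `^ p) / 2.
Proof.
move=> p1 s0 t0 st.
have m0 : 0 < (s + t) / 2.
  rewrite divr_gt0// lt_neqAle addr_ge0// andbT eq_sym.
  by apply: contra st; rewrite paddr_eq0// => /andP[/eqP-> /eqP->].
set m := (s + t) / 2 in m0 *.
have sE : s = m * (s / m) by rewrite mulrC divfK// gt_eqF.
have tE : t = m * (t / m) by rewrite mulrC divfK// gt_eqF.
have xy : s / m + t / m = 2 by rewrite -mulrDl /m; field; apply/eqP; move: m0; rewrite /m; lra.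
have x1 : s / m != 1.
  apply: contra st => /eqP h; move: xy sE tE; rewrite h => xy.
  by rewrite (_ : t / m = 1) => [->->//|]; lra.
have y1 : t / m != 1 by apply: contra x1 => /eqP; lra.
have s0m : 0 <= s / m by rewrite divr_ge0// ltW.
have t0m : 0 <= t / m by rewrite divr_ge0// ltW.
have H1 := bernoulli_lt p1 s0m x1; have H2 := bernoulli_lt p1 t0m y1.
have mp : 0 < m `^ p by rewrite powR_gt0.
have -> : s `^ p + t `^ p = m `^ p * ((s / m) `^ p + (t / m) `^ p).
  by rewrite mulrDr -!powRM ?(ltW m0)// -sE -tE.
rewrite -mulrA -[ltLHS]mulr1 ltr_pM2l//.
have : p * (s / m - 1) + p * (t / m - 1) = 0 by rewrite -mulrDr (_ : _ + _ = 0) ?mulr0//; lra.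
lra.
Qed.

Lemma continuous_norm_powR (R : realType) (p : R) : 0 < p -> continuous (fun t : R => `|t| `^ p).
Proof.
move=> p0 t; have [->|t0] := eqVneq t 0.
  rewrite /continuous_at normr0 powR0 ?gt_eqF//.
  apply/cvgrPdist_lt => e e0; near=> y; rewrite sub0r normrN ger0_norm ?powR_ge0//.
  have [->|y0] := eqVneq y 0; first by rewrite normr0 powR0 ?gt_eqF.
  rewrite -[ltRHS](@powRr1 _ e) ?ltW// -(@mulVf _ p) ?gt_eqF// powRrM.
  rewrite gt0_ltr_powR// ?nnegrE ?powR_ge0//; near: y.
  apply/nbhs_ballP; exists (e `^ p^-1); first exact: powR_gt0.
  by move=> y; rewrite /ball/= sub0r normrN.
apply: (@continuous_comp _ _ _ (fun t : R => `|t|) (fun t => t `^ p)).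
  exact: norm_continuous.
have t0' : 0 < `|t| by rewrite normr_gt0.
have d := @is_derive1_powR R p `|t| t0'.
apply: differentiable_continuous; apply/derivable1_diffP.
exact: (@ex_derive _ _ _ _ _ _ _ d).
Unshelve. all: by end_near. Qed.

(** * Convexity of powers of the Euclidean norm *)

Section strict_convexity.
Context {R : realType} {n : nat}.
Implicit Types (a b x y : 'rV[R]_n) (p : R).

Lemma sqnD_sub x y : sqn (x + y) + sqn (x - y) = 2 * (sqn x + sqn y).
Proof.
rewrite /sqn -!big_split/= mulr_sumr; apply: eq_bigr => i _; rewrite !mxE; ring.
Qed.

(** If the norms differ, t^p is strictly convex on them; if they agree, the parallelogram law makes
    the midpoint strictly shorter. *)
Lemma enorm_midpoint_powR_lt p a b : 1 < p -> a != b ->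
  enorm (2^-1 *: (a + b)) `^ p < (enorm a `^ p + enorm b `^ p) / 2.
Proof.
move=> p1 ab; have p0 : 0 < p by apply: lt_trans p1.
have [ab'|ab'] := eqVneq (enorm a) (enorm b); last first.
  apply: le_lt_trans (powR_midpoint_lt p1 (enorm_ge0 a) (enorm_ge0 b) ab').
  apply: (ge0_ler_powR (ltW p0)); rewrite ?nnegrE ?enorm_ge0 ?divr_ge0 ?addr_ge0 ?enorm_ge0//.
  by rewrite enormZ ger0_norm ?invr_ge0// mulrC ler_pM2r ?invr_gt0// enorm_triangle.
rewrite ab' (_ : (_ + _) / 2 = enorm b `^ p); last by lra.
apply: gt0_ltr_powR; rewrite ?nnegrE ?enorm_ge0//.
rewrite -(@ltr_pXn2r _ 2)// ?nnegrE ?enorm_ge0// enormZ ger0_norm ?invr_ge0// exprMn !sqn_enorm.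
have := sqnD_sub a b; rewrite -(sqn_enorm a) ab' (sqn_enorm b).
have : 0 < sqn (a - b) by rewrite lt_neqAle sqn_ge0 andbT eq_sym sqn_eq0 subr_eq0.
rewrite exprVn; lra.
Qed.

Lemma enorm_midpoint_powR_le p a b : 1 < p ->
  enorm (2^-1 *: (a + b)) `^ p <= (enorm a `^ p + enorm b `^ p) / 2.
Proof.
move=> p1; have [->|ab] := eqVneq a b; last exact: ltW (enorm_midpoint_powR_lt p1 ab).
have -> : 2^-1 *: (b + b) = b by apply/rowP => i; rewrite !mxE; lra.
by lra.
Qed.

Lemma continuous_enorm : continuous (@enorm R n).
Proof.
move=> x; apply: (@continuous_comp _ _ _ (@sqn R n) (@Num.sqrt R)); last exact: sqrt_continuous.
suff : Ck 0 (@sqn R n) by move/Ck_continuous; exact.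
by rewrite /sqn; apply: Ck_sum => i; apply: (@CkM _ _ 0); split=> //; exact: coord_continuous.
Qed.

Lemma continuous_enorm_powR (T : topologicalType) (f : T -> 'rV[R]_n) p : 0 < p ->
  continuous f -> continuous (fun t => enorm (f t) `^ p).
Proof.
move=> p0 cf t; rewrite (_ : (fun t => _) = (fun t => `|enorm (f t)| `^ p)).
  apply: (@continuous_comp _ _ _ (fun t => enorm (f t)) (fun s : R => `|s| `^ p)).
    by apply: (@continuous_comp _ _ _ f (@enorm R n)); [exact: cf|exact: continuous_enorm].
  exact: continuous_norm_powR.
by apply/funext => s; rewrite ger0_norm// enorm_ge0.
Qed.

(* Compactness of the set of normalised pairs turns strict midpoint convexity into a uniform gap. *)
Lemma uniform_convexity_gap p (e : R) : 1 < p -> 0 < e -> exists2 c : R, 0 < c &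
  forall a b, enorm a `^ p + enorm b `^ p = 1 -> e <= enorm (a - b) `^ p ->
  2 `^ p <= c * (1 / 2 - enorm (2^-1 *: (a + b)) `^ p).
Proof.
move=> p1 e0; have p0 : 0 < p by apply: lt_trans p1.
(* A pair of vectors is encoded as one row of length n + n, to which compactness and the extreme
   value theorem for row vectors apply. *)
pose A (z : 'rV[R]_(n + n)) := lsubmx z; pose B (z : 'rV[R]_(n + n)) := rsubmx z.
have cA : continuous A.
  apply: continuous_rV => i; rewrite (_ : (fun _ => _) = fun z : 'rV_(n+n) => z ord0 (lshift n i)).
    exact: coord_continuous.
  by apply/funext => z; rewrite mxE.
have cB : continuous B.
  apply: continuous_rV => i; rewrite (_ : (fun _ => _) = fun z : 'rV_(n+n) => z ord0 (rshift n i)).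
    exact: coord_continuous.
  by apply/funext => z; rewrite mxE.
have cM : continuous (fun z => 2^-1 *: (A z + B z)).
  move=> z; apply: (@continuous_comp _ _ _ (fun z => A z + B z) (fun y : 'rV[R]_n => 2^-1 *: y)).
    by apply: continuousD; [exact: cA|exact: cB].
  exact: scaler_continuous.
have cD : continuous (fun z => A z - B z).
  by move=> z; apply: continuousB; [exact: cA|exact: cB].
pose N z := enorm (A z) `^ p + enorm (B z) `^ p.
have cN : continuous N.
  have cAp := @continuous_enorm_powR _ A p p0 cA; have cBp := @continuous_enorm_powR _ B p p0 cB.
  by move=> z; exact: (continuousD (cAp z) (cBp z)).
pose F z := N z / 2 - enorm (2^-1 *: (A z + B z)) `^ p.
have cF : continuous F.
  have cMp := @continuous_enorm_powR _ _ p p0 cM.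
  have cN2 : continuous (fun z => N z / 2) by move=> z; apply: continuousM; [exact: cN|exact: cst_continuous].
  by move=> z; exact: (continuousB (cN2 z) (cMp z)).
pose K := [set z | N z = 1] `&` [set z | e <= enorm (A z - B z) `^ p].
have cK : compact K.
  apply: (@subclosed_compact _ _ (closure (cube 3))).
  - apply: closedI.
      have c1 : closed [set x : R | x = 1] by exact: closed_eq.
      exact: (proj1 (continuous_closedP N) cN _ c1).
    exact: (proj1 (continuous_closedP _) (@continuous_enorm_powR _ _ p p0 cD) [set x | e <= x] (@closed_ge R e)).
  - exact: (@cube_closure_compact _ _ 3).
  (* Each vector of a normalised pair satisfies |a| <= 1 + |a|^p <= 2, so its coordinates are below
     3. *)
  - move=> z [Nz _]; apply: subset_closure; apply/cubeP => i.
    have h (x : 'rV[R]_n) j : enorm x `^ p <= 1 -> `|x ord0 j| < 3.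
      move=> x1; apply: le_lt_trans (coord_le_enorm _ _) _.
      by have := powR_le1D (ltW p1) (enorm_ge0 x); lra.
    have ab := powR_ge0 (enorm (A z)) p; have bb := powR_ge0 (enorm (B z)) p.
    rewrite /= /N in Nz.
    have hA : enorm (A z) `^ p <= 1 by rewrite -Nz lerDl; exact: bb.
    have hB : enorm (B z) `^ p <= 1 by rewrite -Nz lerDr; exact: ab.
    rewrite -(splitK i); case: (fintype.split i) => j /=.
      have := h (A z) j hA; rewrite mxE; exact.
    have := h (B z) j hB; rewrite mxE; exact.
have p2 : 0 < 2 `^ p :> R by rewrite powR_gt0.
have [c c0 Hc] : exists2 c : R, 0 < c & forall z, K z -> 2 `^ p <= c * F z.
  have [K0|K0] := pselect (K !=set0); last first.
    by exists 1 => // z Kz; exfalso; apply: K0; exists z.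
  have [z0 z0K Hz0] := EVT_min_rV K0 cK (continuous_subspaceT cF).
  have F0 : 0 < F z0.
    move: z0K; rewrite inE => -[_ Kz]; rewrite subr_gt0; apply: enorm_midpoint_powR_lt p1 _.
    apply: contraTneq Kz => ->; rewrite subrr enorm0 powR0 ?gt_eqF//.
    by rewrite -ltNge.
  exists (2 `^ p / F z0); first exact: divr_gt0.
  move=> z Kz; have Hz : F z0 <= F z by apply: Hz0; exact: mem_set.
  rewrite mulrAC (ler_pdivlMr _ _ F0) (ler_pM2l p2); exact: Hz.
exists c; first exact: c0.
move=> a b N1 eab.
have Az : A (row_mx a b) = a by rewrite /A row_mxKl.
have Bz : B (row_mx a b) = b by rewrite /B row_mxKr.
have Kz : K (row_mx a b) by split; rewrite /= ?/N Az Bz; [exact: N1|exact: eab].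
have := Hc _ Kz; rewrite /F /N Az Bz N1; exact.
Qed.

(** Both sides are homogeneous of degree p, so normalised pairs suffice. Close pairs cost at most
    [e]; for the others |a - b|^p <= 2^p is paid for by the midpoint gap. *)
Lemma uniform_convexity p (e : R) : 1 < p -> 0 < e -> exists2 c : R, 0 < c & forall a b,
  enorm (a - b) `^ p + c * enorm (2^-1 *: (a + b)) `^ p <=
  (e + c / 2) * (enorm a `^ p + enorm b `^ p).
Proof.
move=> p1 e0; have p0 : 0 < p by apply: lt_trans p1.
have [c c0 Hc] := uniform_convexity_gap p1 e0.
have Hunit a b : enorm a `^ p + enorm b `^ p = 1 ->
    enorm (a - b) `^ p + c * enorm (2^-1 *: (a + b)) `^ p <= e + c / 2.
  move=> N1.
  have [eab|eab] := leP e (enorm (a - b) `^ p).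
    have := Hc a b N1 eab; rewrite mulrBr.
    have := @enormD_powR R n p a (- b) (ltW p0).
    rewrite enormN N1 mulr1.
    move: (enorm (a - b) `^ p) (enorm _ `^ p) (2 `^ p) e0 => s t q; clear; lra.
  rewrite lerD ?(ltW eab)// ler_pM2l//.
  by have := enorm_midpoint_powR_le a b p1; rewrite N1 mul1r.
exists c; first exact: c0.
move=> a b.
pose M := enorm a `^ p + enorm b `^ p; rewrite -/M.
have : 0 <= M by rewrite addr_ge0 ?powR_ge0.
rewrite le_eqVlt => /orP[/eqP M0|M0].
  have [a0 b0] : a = 0 /\ b = 0.
    move: M0 => /esym/eqP; rewrite paddr_eq0 ?powR_ge0//.
    by rewrite !powR_eq0 !enorm_eq0 => /andP[/andP[/eqP-> _] /andP[/eqP-> _]].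
  rewrite -M0 a0 b0 subrr addr0 scaler0 enorm0 powR0 ?gt_eqF// ?mulr0 ?addr0//.
pose l := M `^ (- p^-1).
have l0 : 0 < l by rewrite powR_gt0.
have lp : l `^ p = M^-1 by rewrite -powRrM mulNr mulVf ?gt_eqF// powR_inv1// ltW.
have hom x : enorm (l *: x) `^ p = M^-1 * enorm x `^ p.
  by rewrite enormZ powRM ?enorm_ge0// gtr0_norm// lp.
have := Hunit (l *: a) (l *: b); rewrite !hom -mulrDr -scalerBr -scalerDr.
rewrite -/M (mulVf (lt0r_neq0 M0)).
have -> : 2^-1 *: (l *: (a + b)) = l *: (2^-1 *: (a + b)) by rewrite !scalerA (mulrC l).
by rewrite !hom mulrCA -mulrDr => /(_ erefl); rewrite mulrC ler_pdivrMr.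
Qed.

End strict_convexity.

(** * Limits of sequences with rapidly converging gradients *)

Lemma cvg_rV (R : realType) n (x : nat -> 'rV[R]_n) (l : 'rV[R]_n) :
  (forall i, x k ord0 i @[k --> \oo] --> l ord0 i) -> x k @[k --> \oo] --> l.
Proof.
move=> xl; apply/cvgrPdist_lt => e e0.
have H : \forall k \near \oo, forall i, `|l ord0 i - x k ord0 i| < e.
  by apply: filter_forall => i; have /cvgrPdist_lt/(_ e e0) := xl i.
apply: filterS H => k Hk; rewrite [ltLHS]mx_normrE; apply/bigmax_ltP; split=> // -[j i] _ /=.
by rewrite ord1 !mxE.
Qed.

Lemma geometric_cvg (R : realType) (u : nat -> R) (C s : R) : 0 <= s -> s < 1 ->
  (forall k, `|u k.+1 - u k| <= C * s ^+ k) -> cvgn u.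
Proof.
move=> s0 s1 Hu.
have C0 : 0 <= C by have := Hu 0%N; rewrite expr0 mulr1; apply: le_trans.
have cg : cvgn (series (geometric C s)) by apply: is_cvg_geometric_series; rewrite ger0_norm.
have cd : cvgn (series (fun k => u k.+1 - u k)).
  apply: normed_cvg; apply: series_le_cvg cg => k //=.
  by rewrite mulr_ge0// exprn_ge0.
have -> : u = (cst (u 0%N) \+ series (fun k => u k.+1 - u k)).
  by apply/funext => k; rewrite /= /series/= telescope_sumr// subrKC.
by apply: is_cvgD cd; exact: is_cvg_cst.
Qed.

Lemma geometric_le (R : realType) (u : nat -> R) (C s : R) : 0 <= s -> s < 1 -> 0 <= C ->
  (forall k, u k.+1 <= u k + C * s ^+ k) -> forall k, u k <= u 0%N + C / (1 - s).
Proof.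
move=> s0 s1 C0 Hu k.
have s1' : 0 < 1 - s by rewrite subr_gt0.
suff : u k <= u 0%N + C * (1 - s ^+ k) / (1 - s).
  move=> /le_trans; apply; rewrite lerD2l ler_pM2r ?invr_gt0// ler_piMr//.
  by rewrite gerBl exprn_ge0.
elim: k => [|k IH]; first by rewrite expr0 subrr mulr0 mul0r addr0.
apply: le_trans (Hu k) _; apply: (le_trans (lerD IH (lexx _))).
rewrite le_eqVlt; apply/orP; left; apply/eqP; rewrite exprS; field.
by rewrite gt_eqF.
Qed.

Section gradient_limit.
Context {R : realType} {n : nat}.
Implicit Types (u v : 'rV[R]_n -> R) (G H : 'rV[R]_n -> 'rV[R]_n) (p : R).
Local Notation leb := (rV_lebesgue R n).

Lemma powR_exprn_swap (a q : R) k : 0 <= a -> (a `^ q) ^+ k = (a ^+ k) `^ q.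
Proof. by move=> a0; elim: k => [|k IH]; rewrite ?powR1// !exprS powRM ?exprn_ge0// IH. Qed.

Lemma powR_root_le (p a s b : R) k : 0 < p -> 0 <= a -> 0 <= s -> 0 <= b ->
  a `^ p <= s * b ^+ k -> a <= s `^ p^-1 * (b `^ p^-1) ^+ k.
Proof.
move=> p0 a0 s0 b0 h.
rewrite powR_exprn_swap// -powRM ?exprn_ge0// -[a]powRr1// -(@divff _ p) ?gt_eqF// powRrM.
by apply: ge0_ler_powR; rewrite ?nnegrE ?invr_ge0 ?powR_ge0 ?mulr_ge0 ?exprn_ge0// ltW.
Qed.

(* [S = \sum_k 2^k |G_{k+1} - G_k|^p] has finite integral; where [S] is finite, [G_k] converges
   geometrically. *)
Lemma fast_gradient_cvg p (G : nat -> 'rV[R]_n -> 'rV[R]_n) : 1 <= p ->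
  (forall k, measurable_fun setT (G k)) -> (energy p (G 0%N) < +oo)%E ->
  (forall k, (energy p (fun x => G k.+1 x - G k x)%R <= (4 ^- k)%:E)%E) ->
  exists2 L : 'rV[R]_n -> 'rV[R]_n, measurable_fun setT L &
  exists2 g : 'rV[R]_n -> R, leb.-integrable setT (EFin \o g) &
    {ae leb, forall x, G k x @[k --> \oo] --> L x /\ forall k, enorm (G k x) `^ p <= g x}.
Proof.
move=> p1 mG G0 HG.
have p0 : 0 < p by apply: lt_le_trans p1.
pose D k x := enorm (G k.+1 x - G k x) `^ p.
have mB k : measurable_fun setT (fun x => G k.+1 x - G k x).
  under eq_fun do rewrite -scaleN1r.
  by apply: measurable_rVD => //; exact: measurable_rVZ.
have mD k : measurable_fun setT (fun x => (2 ^+ k * D k x)%:E).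
  by under eq_fun do rewrite EFinM; apply: measurable_funeM; exact: measurable_energy (mB k).
have D0 k x : 0 <= 2 ^+ k * D k x by rewrite mulr_ge0 ?exprn_ge0 ?powR_ge0.
pose S x : \bar R := (\sum_(0 <= k <oo) (2 ^+ k * D k x)%:E)%E.
have S0 x : (0 <= S x)%E by apply: nneseries_ge0 => k _ _; rewrite lee_fin.
have mS : measurable_fun setT S by apply: ge0_emeasurable_sum => // k x _ _; rewrite lee_fin.
have IS : (\int[leb]_x S x < +oo)%E.
  rewrite integral_nneseries//; last by move=> k x _; rewrite lee_fin.
  (* The k-th term is at most 2^k 4^(-k) = 2 / 2^(k+1), and these sum to 2. *)
  apply: (@le_lt_trans _ _ 2%:E); last exact: ltry.
  apply: le_trans (@epsilon_trick0 R 2 xpredT ltac:(by [])).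
  apply: lee_nneseries => [k _ _|k _].
    by apply: integral_ge0 => x _; rewrite lee_fin.
  under eq_integral do rewrite EFinM.
  rewrite (@ge0_integralZl_EFin _ _ _ leb _ measurableT (fun x => (D k x)%:E)).
  - apply: (@le_trans _ _ ((2 ^+ k)%:E * (4 ^- k)%:E)%E).
      by apply: lee_wpmul2l; [rewrite lee_fin exprn_ge0|exact: HG].
    rewrite -EFinM lee_fin (_ : 4 = 2 * 2 :> R); last by rewrite -natrM.
    rewrite exprMn invfM mulrA divff ?expf_neq0// mul1r natrX exprS invfM.
    by rewrite mulrA divff// mul1r.
  - by move=> x _; rewrite lee_fin powR_ge0.
  - exact: measurable_energy (mB k).
  - exact: exprn_ge0.
have iS : leb.-integrable setT S.
  by apply/integrableP; split=> //; under eq_integral do rewrite gee0_abs//.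
pose r : R := 2^-1 `^ p^-1.
have r0 : 0 <= r by exact: powR_ge0.
have r1 : r < 1.
  have -> : 1 = 1 `^ p^-1 :> R by rewrite powR1.
  by rewrite gt0_ltr_powR ?invr_gt0// ?nnegrE ?invr_ge0// invf_lt1// ltr1n.
have step k x : S x \is a fin_num -> enorm (G k.+1 x - G k x) <= fine (S x) `^ p^-1 * r ^+ k.
  move=> Sx; have s0 : 0 <= fine (S x) by rewrite -lee_fin fineK.
  have Dk : D k x <= fine (S x) * 2^-1 ^+ k.
    rewrite exprVn ler_pdivlMr ?exprn_gt0// mulrC -lee_fin fineK//.
    apply: le_trans (@nneseries_lim_ge _ _ xpredT 0 k.+1 _); last first.
      by move=> i _ _; rewrite lee_fin.
    rewrite big_nat_recr//= leeDr// sume_ge0// => i _; by rewrite lee_fin.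
  by apply: powR_root_le Dk => //; rewrite ?enorm_ge0// invr_ge0.
pose A := [set x | S x \is a fin_num].
have mA : measurable A by rewrite -[A]setTI; exact: emeasurable_fin_num.
(* Cutting off to the set where [S] is finite makes the coordinate limits exist at every point,
   which gives measurability of the limit field. *)
pose h k x := \1_A x *: G k x.
have mh k : measurable_fun setT (h k).
  apply: measurable_fun_rVP => i; rewrite (_ : (fun _ => _) = fun x => \1_A x * G k x ord0 i).
    by apply: measurable_funM; [exact: measurable_indic|exact: measurable_coordG].
  by apply/funext => x; rewrite mxE.
have ch x i : cvgn (fun k => h k x ord0 i).
  rewrite /h indicE; case: (boolP (x \in A)) => [/set_mem xA|_].
    apply: (geometric_cvg r0 r1) => k.
    rewrite !scale1r (_ : _ - _ = (G k.+1 x - G k x) ord0 i); last by rewrite !mxE.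
    exact: le_trans (coord_le_enorm _ _) (step k x xA).
  by under eq_fun do rewrite scale0r mxE; exact: is_cvg_cst.
exists (fun x => \row_i limn (fun k => h k x ord0 i)).
  apply: measurable_fun_rVP => i.
  apply: (@measurable_fun_cvg _ _ _ _ (fun k x => h k x ord0 i)) => [k|x _].
    exact: measurable_coordG.
  by rewrite mxE; exact: ch.
(* The p-th power of |G_0| + S^(1/p) / (1 - r), the sum of all increments, split by [powRD_le]. *)
exists (fun x => 2 `^ p * (enorm (G 0%N x) `^ p + ((1 - r)^-1) `^ p * fine (S x))).
  have i0 : leb.-integrable setT (EFin \o (fun x => enorm (G 0%N x) `^ p)).
    apply/integrableP; split; first exact: measurable_energy.
    by under eq_integral do rewrite /= ger0_norm ?powR_ge0//.
  have i1 : leb.-integrable setT (EFin \o (fun x => fine (S x))).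
    apply: le_integrable iS => //.
      by apply/measurable_EFinP; exact: (measurableT_comp (fine_measurable measurableT) mS).
    by move=> x _ /=; case: (S x) => [s| |] /=; rewrite ?normr0 ?lexx ?leey.
  have i2 : leb.-integrable setT (EFin \o (fun x => enorm (G 0%N x) `^ p + ((1 - r)^-1) `^ p * fine (S x))).
    exact: (integrableD measurableT i0 (integrableZl measurableT (((1 - r)^-1) `^ p) i1)).
  exact: (integrableZl measurableT (2 `^ p) i2).
apply: filterS (integrable_ae measurableT iS) => x /(_ I) Sx.
have hE k : h k x = G k x by rewrite /h indicE mem_set// scale1r.
split.
  apply: cvg_rV => i; rewrite mxE.
  have -> : (fun k => G k x ord0 i) = (fun k => h k x ord0 i) by apply/funext => k; rewrite hE.
  exact: ch.
move=> k; pose C := fine (S x) `^ p^-1.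
have C0 : 0 <= C by exact: powR_ge0.
have r1' : 0 < 1 - r by rewrite subr_gt0.
have Gk : enorm (G k x) <= enorm (G 0%N x) + C / (1 - r).
  apply: (@geometric_le _ (fun k => enorm (G k x)) C r r0 r1 C0) => {}k.
  rewrite -[G k.+1 x](subrKC (G k x)); apply: le_trans (enorm_triangle _ _) _.
  by rewrite lerD2l; exact: step.
apply: (@le_trans _ _ ((enorm (G 0%N x) + C / (1 - r)) `^ p)).
  apply: ge0_ler_powR; rewrite ?nnegrE ?enorm_ge0 ?(ltW p0)//.
  by rewrite addr_ge0 ?enorm_ge0// divr_ge0// ltW.
apply: le_trans (powRD_le (ltW p0) (enorm_ge0 _) _) _; first by rewrite divr_ge0// ltW.
rewrite powRM// ?invr_ge0 ?(ltW r1')// /C -powRrM mulVf ?gt_eqF// powRr1 1?[X in _ + X]mulrC//.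
by rewrite -lee_fin fineK.
Qed.

End gradient_limit.

(** Dominated convergence is applied to the energies and to the two sides of the weak identity. The
    envelope [B] bounds the functions on the support of the test function, and [g] the gradients. *)
Lemma has_grad_limit (R : realType) (n : nat) (p : R) (u : nat -> 'rV[R]_n -> R)
    (G : nat -> 'rV[R]_n -> 'rV[R]_n) (v B g : 'rV[R]_n -> R) (L : 'rV[R]_n -> 'rV[R]_n) :
  let leb := rV_lebesgue R n in 1 <= p ->
  (forall k, has_grad p (u k) (G k)) ->
  continuous v -> (forall x, u k x @[k --> \oo] --> v x) ->
  continuous B -> (forall k x, `|u k x| <= B x) ->
  measurable_fun setT L -> leb.-integrable setT (EFin \o g) ->
  {ae leb, forall x, G k x @[k --> \oo] --> L x /\ forall k, enorm (G k x) `^ p <= g x} ->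
  has_grad p v L /\ fine (energy p (G k)) @[k --> \oo] --> fine (energy p L).
Proof.
move=> leb p1 hG cv uv cB uB mL Ig aeG.
have p0 : 0 < p by apply: lt_le_trans p1.
have mG k : measurable_fun setT (G k) by have [] := hG k.
have [|||||IL EL] := @dominated_cvg_real _ _ _ leb (fun k x => enorm (G k x) `^ p)
  (fun x => enorm (L x) `^ p) g.
- by move=> k; exact: (proj1 (measurable_EFinP _ _) (measurable_energy p (mG k))).
- exact: (proj1 (measurable_EFinP _ _) (measurable_energy p mL)).
- apply: filterS aeG => x [Gx _].
  have cid : continuous (id : 'rV[R]_n -> 'rV[R]_n) by move=> y; exact: cvg_id.
  have ce := @continuous_enorm_powR R n _ id p p0 cid.
  exact: (cvg_comp _ _ Gx (ce (L x))).
- exact: Ig.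
- by apply: filterS aeG => x [_ H] k; rewrite ger0_norm ?powR_ge0.
split; last exact: EL.
have Loo : (energy p L < +oo)%E.
  have /integrableP[_] := IL; rewrite /energy.
  by under eq_integral do rewrite /= ger0_norm ?powR_ge0//.
split=> // i phi tphi; have /test_functionP[Cphi sphi] := tphi.
have cphi := Ck_continuous (Cphi 0%N).
have cdphi := ((Cphi 1%N).2 i).2.1.
have sdphi := csupp_partial i sphi.
have [M M0 HM] := csupp_bounded cphi sphi.
have Iphi : leb.-integrable setT (EFin \o phi) by exact: integrable_csupp.
have [|||||_ E1] := @dominated_cvg_real _ _ _ leb (fun k x => u k x * partial i phi x)
  (fun x => v x * partial i phi x) (fun x => `|B x * partial i phi x|).
- move=> k; have [cu _ _ _] := hG k.
  by apply: continuous_measurable_rV => x; apply: continuousM; [exact: cu|exact: cdphi].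
- by apply: continuous_measurable_rV => x; apply: continuousM; [exact: cv|exact: cdphi].
- by apply: aeW => x; apply: cvgM; [exact: uv|exact: cvg_cst].
- apply: (@integrable_abse _ _ _ leb setT (EFin \o (fun x => B x * partial i phi x))).
  exact: locally_integrableM (continuous_locally_integrable cB) cdphi sdphi.
- apply: aeW => x k; rewrite !normrM ler_wpM2r//.
  exact: le_trans (uB k x) (ler_norm _).
have [|||||_ E2] := @dominated_cvg_real _ _ _ leb (fun k x => G k x ord0 i * phi x)
  (fun x => L x ord0 i * phi x) (fun x => `|phi x| + M * g x).
- move=> k; apply: measurable_funM; first exact: measurable_coordG.
  exact: continuous_measurable_rV.
- apply: measurable_funM; first exact: measurable_coordG.
  exact: continuous_measurable_rV.
- apply: filterS aeG => x [Gx _]; apply: cvgM; last exact: cvg_cst.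
  exact: (cvg_comp _ _ Gx (@coord_continuous _ _ _ ord0 i (L x))).
- exact: (integrableD measurableT (integrable_abse Iphi) (integrableZl measurableT M Ig)).
- apply: filterS aeG => x [_ gx] k; rewrite normrM.
  (* A coordinate of the gradient is at most 1 + |G_k|^p, hence at most 1 + g. *)
  apply: (@le_trans _ _ ((1 + g x) * `|phi x|)).
    rewrite ler_wpM2r// (le_trans (coord_le_enorm _ _))//.
    by rewrite (le_trans (powR_le1D p1 (enorm_ge0 _)))// lerD2l.
  rewrite mulrDl mul1r lerD2l mulrC ler_wpM2r ?HM//.
  exact: le_trans (powR_ge0 _ _) (gx 0%N).
move: E1; rewrite (_ : (fun k => _) = (fun k => - \int[leb]_x (G k x ord0 i * phi x))).
  by move=> E1; rewrite -(cvg_lim _ E1)//; apply: cvg_lim => //; apply: cvgN; exact: E2.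
by apply/funext => k; have [_ _ _ ->] := hG k.
Qed.

(** * Energy minimisers *)

Section morrey_transport.
Context {R : realType} {n : nat}.
Implicit Types (u v : 'rV[R]_n -> R) (G H : 'rV[R]_n -> 'rV[R]_n) (p K : R) (x y : 'rV[R]_n).

Lemma fine_energy_ge0 p G : 0 <= fine (energy p G).
Proof. by rewrite fine_ge0// energy_ge0. Qed.

Lemma energyE p u G : has_grad p u G -> energy p G = (fine (energy p G))%:E.
Proof. by move=> [_ _ Goo _]; rewrite fineK// ge0_fin_numE ?energy_ge0. Qed.

(** Homogeneous form of [morrey_pair], obtained by dividing [u] by the p-th root of its energy. *)
Lemma morrey_powR p x0 y0 : (0 < n)%N -> n%:R < p -> exists2 K : R, 0 < K &
  forall u G, has_grad p u G -> `|u x0 - u y0| `^ p <= K * fine (energy p G).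
Proof.
move=> n0 np; have [C C0 HC] := morrey_pair n0 np x0 y0.
have p1 : 1 <= p by apply: le_trans (ltW np); rewrite ler1n.
have p0 : 0 < p by apply: lt_le_trans p1.
exists (C `^ p); first exact: powR_gt0.
move=> u G hG; have EG := energyE hG.
have scale (a : R) : `|a| `^ p * fine (energy p G) <= 1 -> `|a| * `|u x0 - u y0| <= C.
  move=> aE; rewrite -normrM mulrBr; apply: (HC _ _ (has_gradZ a p1 hG)).
  by have [_ mG _ _] := hG; rewrite energyZ// EG -EFinM lee_fin.
have := fine_energy_ge0 p G; rewrite le_eqVlt => /orP[/eqP E0|E0].
  rewrite -E0 mulr0; suff -> : `|u x0 - u y0| = 0 by rewrite powR0// gt_eqF.
  apply/eqP; rewrite eq_le normr_ge0 andbT leNgt; apply/negP => d0.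
  (* With zero energy every multiple of [u] obeys the bound [C]; this multiple would give C + 1 <=
     C. *)
  have := scale ((C + 1) / `|u x0 - u y0|); rewrite -E0 mulr0 => /(_ ler01).
  rewrite ger0_norm ?divr_ge0 ?addr_ge0 ?(ltW C0)// divfK ?gt_eqF//.
  by rewrite gerDl ler10.
set e := fine (energy p G) in scale E0 *.
have := scale (e `^ (- p^-1)); rewrite ger0_norm ?powR_ge0// -powRrM mulNr mulVf ?gt_eqF//.
rewrite powR_inv1 ?(ltW E0)// mulVf ?gt_eqF// => /(_ (lexx _)) h.
have -> : C `^ p * e = (e `^ p^-1 * C) `^ p.
  by rewrite powRM ?powR_ge0 ?(ltW C0)// -powRrM mulVf ?gt_eqF// powRr1 ?(ltW E0)// mulrC.
apply: ge0_ler_powR; rewrite ?nnegrE ?mulr_ge0 ?powR_ge0 ?(ltW C0) ?(ltW p0)//.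
move: h; rewrite powRN mulrC ler_pdivrMr ?powR_gt0// mulrC; exact.
Qed.

(** The exponent p - n is the homogeneity of the energy under similarities; the ratio [l] of the
    distances is the scale of the map taking one pair to the other. *)
Lemma ratio_transport p K x0 y0 : 1 <= p -> n%:R < p -> x0 != y0 ->
  (forall u G, has_grad p u G -> `|u x0 - u y0| `^ p <= K * fine (energy p G)) ->
  forall u G x y, has_grad p u G ->
  `|u x - u y| `^ p <= K * (enorm (x - y) / enorm (x0 - y0)) `^ (p - n%:R) * fine (energy p G).
Proof.
move=> p1 np xy0 HK u G x y hG.
have p0 : 0 < p by apply: lt_le_trans p1.
have [->|xy] := eqVneq x y.
  by rewrite !subrr normr0 enorm0 mul0r !powR0 ?gt_eqF ?subr_gt0// mulr0 mul0r.
have z0 : 0 < enorm (x0 - y0) by rewrite lt_neqAle enorm_ge0 eq_sym enorm_eq0 subr_eq0 xy0.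
have w0 : 0 < enorm (x - y) by rewrite lt_neqAle enorm_ge0 eq_sym enorm_eq0 subr_eq0 xy.
set l := enorm (x - y) / enorm (x0 - y0).
have l0 : 0 < l by rewrite divr_gt0.
have [Q QQ zQ] : exists2 Q : 'M[R]_n, Q *m Q^T = 1%:M & (x0 - y0) *m Q = l^-1 *: (x - y).
  apply: orthogonal_transitive; rewrite enormZ gtr0_norm ?invr_gt0//.
  by rewrite /l invf_div divfK ?gt_eqF.
(* The translation part sends [y0] to [y]; then [zQ] forces [x0] to go to [x]. *)
have [] := has_grad_similarity (y - l *: (y0 *m Q)) p1 l0 QQ hG.
set H := (fun x => _ *: _) => hH EH.
have := HK _ _ hH; rewrite EH (energyE hG) -EFinM /= subrKC.
have -> : l *: (x0 *m Q) + (y - l *: (y0 *m Q)) = x.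
  rewrite addrCA -scalerBr -mulmxBl zQ scalerA divff ?gt_eqF// scale1r.
  by rewrite subrKC.
have -> : l `^ (p - n%:R) = l `^ p / l ^+ n.
  by rewrite powRB ?(gt_eqF l0) ?implybT// powR_mulrn ?(ltW l0).
by rewrite -mulrA.
Qed.

End morrey_transport.

(** * Existence of a minimiser with prescribed values *)

Section minimiser.
Context {R : realType} {n : nat}.
Implicit Types (u v : 'rV[R]_n -> R) (G H : 'rV[R]_n -> 'rV[R]_n) (p : R) (x y : 'rV[R]_n).
Local Notation leb := (rV_lebesgue R n).

Lemma energy_fin_num p u G : has_grad p u G -> energy p G \is a fin_num.
Proof. by move=> [_ _ Goo _]; rewrite ge0_fin_numE ?energy_ge0. Qed.

Definition admissible p x0 y0 (al be : R) u G :=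
  [/\ has_grad p u G, u x0 = al & u y0 = be].

Definition energies p x0 y0 al be : set R :=
  [set e | exists u G, admissible p x0 y0 al be u G /\ e = fine (energy p G)].

Definition min_energy p x0 y0 al be := inf (energies p x0 y0 al be).

Lemma min_energy_le p x0 y0 al be u G : admissible p x0 y0 al be u G ->
  min_energy p x0 y0 al be <= fine (energy p G).
Proof.
move=> adm; apply: ge_inf; last by exists u, G.
by exists 0 => _ [v [H [_ ->]]]; exact: fine_energy_ge0.
Qed.

Lemma energy_uniform_convexity p (e : R) : 1 < p -> 0 < e -> exists2 c : R, 0 < c &
  forall G H, measurable_fun setT G -> measurable_fun setT H ->
  (energy p (fun x => G x - H x)%R + c%:E * energy p (fun x => 2^-1 *: (G x + H x))%R
  <= (e + c / 2)%:E * (energy p G + energy p H))%E.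
Proof.
move=> p1 e0; have [c c0 Hc] := @uniform_convexity R n p e p1 e0.
exists c; first exact: c0.
move=> G H mG hH.
pose D x := G x - H x; pose M x := 2^-1 *: (G x + H x).
have mD : measurable_fun setT D.
  have := measurable_rVD mG (measurable_rVZ (-1) hH).
  by under [X in measurable_fun _ X -> _]eq_fun do rewrite scaleN1r.
have mM : measurable_fun setT M by exact: measurable_rVZ (measurable_rVD mG hH).
have {}Hc x : enorm (D x) `^ p + c * enorm (M x) `^ p
  <= (e + c / 2) * (enorm (G x) `^ p + enorm (H x) `^ p) by exact: Hc.
change (energy p D + c%:E * energy p M <= (e + c / 2)%:E * (energy p G + energy p H))%E.
move: D M mD mM Hc => D M mD mM Hc.
have ec : 0 <= e + c / 2 by rewrite addr_ge0 ?divr_ge0// ltW.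
have pos (J : 'rV[R]_n -> 'rV[R]_n) x : (0 <= (enorm (J x) `^ p)%:E)%E by rewrite lee_fin powR_ge0.
have mE := @measurable_energy R n p.
have cM : measurable_fun setT (fun x => (c%:E * (enorm (M x) `^ p)%:E)%E).
  exact: measurable_funeM (mE _ mM).
have GH : measurable_fun setT (fun x => ((enorm (G x) `^ p)%:E + (enorm (H x) `^ p)%:E)%E).
  exact: emeasurable_funD (mE _ mG) (mE _ hH).
have lhs : (\int[leb]_x ((enorm (D x) `^ p)%:E + c%:E * (enorm (M x) `^ p)%:E))%E =
    (energy p D + c%:E * energy p M)%E.
  rewrite (@ge0_integralD _ _ _ leb _ measurableT _ _ (fun x _ => pos D x) (mE _ mD)
    (fun x _ => mule_ge0 (ltW c0 : (0 <= c%:E)%E) (pos M x)) cM).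
  by rewrite (@ge0_integralZl_EFin _ _ _ leb _ measurableT _ (fun x _ => pos M x) (mE _ mM) c (ltW c0)).
have rhs : (\int[leb]_x ((e + c / 2)%:E * ((enorm (G x) `^ p)%:E + (enorm (H x) `^ p)%:E)))%E =
    ((e + c / 2)%:E * (energy p G + energy p H))%E.
  rewrite (@ge0_integralZl_EFin _ _ _ leb _ measurableT _ (fun x _ => adde_ge0 (pos G x) (pos H x)) GH (e + c / 2) ec).
  by rewrite (@ge0_integralD _ _ _ leb _ measurableT _ _ (fun x _ => pos G x) (mE _ mG) (fun x _ => pos H x) (mE _ hH)).
rewrite -[leLHS]lhs -[leRHS]rhs.
clear lhs rhs.
apply: ge0_le_integral => //.
- by move=> x _; rewrite -EFinM -EFinD lee_fin addr_ge0 ?mulr_ge0 ?powR_ge0// ltW.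
- exact: emeasurable_funD (mE _ mD) cM.
- exact: measurable_funeM.
- by move=> x _; rewrite -EFinM -!EFinD -EFinM lee_fin; exact: Hc.
Qed.

Lemma halfD (a : R) : 2^-1 * (a + a) = a.
Proof. by lra. Qed.

(** The convexity inequality and the bounds on the energies give a <= 2 e (m + h) + c h, and each of
    the two terms is at most t/2. *)
Let gap_arith (a b E1 E2 : \bar R) (c e h m t : R) : 0 < c -> 0 < e -> 0 <= h -> h <= 1 ->
  a \is a fin_num -> b \is a fin_num -> E1 \is a fin_num -> E2 \is a fin_num ->
  h * c <= t / 2 -> e * (m + 1) <= t / 4 ->
  fine E1 <= m + h -> fine E2 <= m + h -> m <= fine b ->
  (a + c%:E * b <= (e + c / 2)%:E * (E1 + E2))%E -> fine a <= t.
Proof.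
move=> c0 e0 h0 h1 fa fb f1 f2 hc em.
case: a fa => // A _; case: b fb => // B _; case: E1 f1 => // F1 _; case: E2 f2 => // F2 _ /=.
rewrite -(EFinD F1 F2) -!EFinM -EFinD lee_fin => H1 H2 mB main.
have ec : 0 <= e + c / 2 by rewrite addr_ge0 ?divr_ge0// ltW.
have {}H1 : (e + c / 2) * (F1 + F2) <= (e + c / 2) * (2 * (m + h)).
  by apply: ler_wpM2l ec _ _ _; lra.
have {}H2 : c * m <= c * B by rewrite ler_pM2l.
have H3 : e * (m + h) <= e * (m + 1) by rewrite ler_pM2l// lerD2l.
clear -main H1 H2 H3 hc em; nra.
Qed.

(** The midpoint of two admissible functions is admissible, so its energy is at least the infimum;
    uniform convexity then leaves little room for the difference of the gradients. *)
Lemma near_minimisers p x0 y0 al be (t : R) : 1 < p -> 0 < t ->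
  exists2 eta : R, 0 < eta & forall u v G H,
  admissible p x0 y0 al be u G -> admissible p x0 y0 al be v H ->
  fine (energy p G) <= min_energy p x0 y0 al be + eta ->
  fine (energy p H) <= min_energy p x0 y0 al be + eta ->
  fine (energy p (fun x => G x - H x)) <= t.
Proof.
move=> p1 t0; set m := min_energy _ _ _ _ _.
have p1' := ltW p1.
(* Chosen so that e (m + 1) <= t/4; the absolute value keeps the denominator positive. The tolerance
   below likewise gives h c <= t/2. *)
pose e := t / (4 * (`|m| + 1)).
have m1 : 0 < `|m| + 1 by rewrite ltr_wpDl.
have e0 : 0 < e by rewrite divr_gt0// mulr_gt0.
have [c c0 Hc] := energy_uniform_convexity p1 e0.
exists (Num.min 1 (t / (2 * c))); first by rewrite lt_min ltr01 divr_gt0// mulr_gt0.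
set h := Num.min _ _ => u v G H [hG ux uy] [hH vx vy] Gm Hm.
have h0 : 0 <= h by rewrite le_min ler01 divr_ge0 ?mulr_ge0// ltW.
have h1 : h <= 1 by rewrite ge_min lexx.
have hc : h * c <= t / 2.
  apply: (@le_trans _ _ (t / (2 * c) * c)); first by rewrite ler_wpM2r ?(ltW c0)// ge_min lexx orbT.
  by rewrite le_eqVlt; apply/orP; left; apply/eqP; field; rewrite gt_eqF.
have mid : m <= fine (energy p (fun x => 2^-1 *: (G x + H x))).
  apply: (@min_energy_le p x0 y0 al be (fun x => 2^-1 * (u x + v x))).
  split; first exact: has_gradZ (has_gradD p1' hG hH).
  - by rewrite ux vx halfD.
  - by rewrite uy vy halfD.
have em : e * (m + 1) <= t / 4.
  apply: (@le_trans _ _ (e * (`|m| + 1))).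
    by rewrite ler_wpM2l ?(ltW e0)// lerD2r ler_norm.
  by rewrite le_eqVlt; apply/orP; left; apply/eqP; rewrite /e; field; rewrite gt_eqF.
have [_ mG _ _] := hG; have [_ mH _ _] := hH.
have fB := energy_fin_num (has_gradB p1' hG hH).
have fM := energy_fin_num (has_gradZ 2^-1 p1' (has_gradD p1' hG hH)).
have := gap_arith c0 e0 h0 h1 fB fM (energy_fin_num hG) (energy_fin_num hH) hc em Gm Hm mid.
apply; exact: Hc.
Qed.

Lemma has_grad_test_function p phi : 1 <= p -> test_function phi ->
  has_grad p phi (fun x => \row_i partial i phi x).
Proof.
move=> p1 tphi; have /test_functionP[Cphi [r Hr]] := tphi.
have p0 : 0 < p by apply: lt_le_trans p1.
have cphi := Ck_continuous (Cphi 0%N).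
have cd i : continuous (partial i phi) by exact: ((Cphi 1%N).2 i).2.1.
have cG : continuous (fun x => \row_i partial i phi x : 'rV[R]_n).
  apply: continuous_rV => i; under eq_fun do rewrite mxE; exact: cd.
split=> //.
- apply: measurable_fun_rVP => i; under eq_fun do rewrite mxE.
  exact: continuous_measurable_rV.
- have cE := @continuous_enorm_powR R n _ _ p p0 cG.
  have sE : csupp (fun x => enorm (\row_i partial i phi x : 'rV[R]_n) `^ p).
    have /choice[s Hs] : forall i, exists s, forall x, partial i phi x != 0 -> cube s x.
      by move=> i; apply: (@csupp_partial R n i phi); exists r.
    exists (\sum_i `|s i|) => x nz.
    have [i nzi] : exists i, partial i phi x != 0.
      apply/not_existsP => H; move/eqP : nz; apply.
      rewrite (_ : \row_i _ = 0) ?enorm0 ?powR0 ?gt_eqF//.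
      apply/rowP => i; rewrite !mxE; apply/eqP; move: (H i); by move/negP; rewrite negbK.
    apply: cube_mono (Hs i x nzi); rewrite (bigD1 i)//=.
    by rewrite (le_trans (ler_norm _))// lerDl sumr_ge0.
  have /integrableP[_] := integrable_csupp cE sE.
  by under eq_integral do rewrite /= ger0_norm ?powR_ge0//.
- move=> i psi tpsi; rewrite (integration_by_parts i (Cphi 1%N) tpsi); congr (- _).
  by apply: eq_Rintegral => x _; rewrite mxE.
Qed.

Lemma admissible_nonempty p x0 y0 al be : (0 < n)%N -> 1 <= p -> x0 != y0 ->
  exists u G, admissible p x0 y0 al be u G.
Proof.
move=> n0 p1 xy.
have [j xyj] : exists j, x0 ord0 j != y0 ord0 j.
  apply/not_existsP => H; move/eqP : xy; apply; apply/rowP => j.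
  by apply/eqP; move: (H j); move/negP; rewrite negbK.
have d0 : 0 < `|y0 ord0 j - x0 ord0 j| by rewrite normr_gt0 subr_eq0 eq_sym.
have [_ [r Hr]] := @bump_bump1 R.
(* The dilation about [x0] carries the j-th coordinate of [y0] to distance 1 + |r|, outside the
   support of [bump], so the product vanishes at [y0] and is positive at [x0]. *)
pose c := (1 + `|r|) / `|y0 ord0 j - x0 ord0 j|.
have c0 : 0 < c by rewrite divr_gt0// ltr_pwDl.
pose f (i : 'I_n) t := c * bump (c * t + - (c * x0 ord0 i)).
have tf : test_function (tens f) by apply: test_function_tens => // i; exact: bump_affine.
have fx : 0 < tens f x0.
  by apply: prodr_gt0 => i _; rewrite /f subrr mulr_gt0// bump0_gt0.
have fy : tens f y0 = 0.
  rewrite /tens (bigD1 j)//= (_ : f j _ = 0) ?mul0r//.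
  apply/eqP; rewrite mulf_eq0 (gt_eqF c0)/=; apply: contraT => /Hr.
  rewrite -mulrBr normrM gtr0_norm// divfK ?gt_eqF// => h.
  by have := le_lt_trans (ler_norm r) (lt_trans _ h); rewrite ltxx => -> //; rewrite ltrDr.
exists (fun x => be + ((al - be) / tens f x0) * tens f x).
exists (fun x => ((al - be) / tens f x0) *: \row_i partial i (tens f) x).
split; first exact: has_grad_affine (has_grad_test_function p1 tf).
- by rewrite divfK ?gt_eqF// subrKC.
- by rewrite fy mulr0 addr0.
Qed.

(** The rate 4^(-k) for the gradient increments leaves a summable 2^(-k) after the weight 2^k in
    [fast_gradient_cvg]. *)
Lemma minimising_sequence p x0 y0 al be : (0 < n)%N -> 1 < p -> x0 != y0 ->
  exists (u : nat -> 'rV[R]_n -> R) (G : nat -> 'rV[R]_n -> 'rV[R]_n),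
    [/\ forall k, admissible p x0 y0 al be (u k) (G k),
    forall k, fine (energy p (G k)) <= min_energy p x0 y0 al be + 4 ^- k &
    forall k, (energy p (fun x => G k.+1 x - G k x)%R <= (4 ^- k)%:E)%E].
Proof.
move=> n0 p1 xy; set m := min_energy _ _ _ _ _.
have q0 k : 0 < 4 ^- k :> R by rewrite invr_gt0 exprn_gt0.
have /choice[h /all_and2[h0 Hh]] : forall k : nat, exists h : R, 0 < h /\ forall u v G H,
    admissible p x0 y0 al be u G -> admissible p x0 y0 al be v H ->
    fine (energy p G) <= m + h -> fine (energy p H) <= m + h ->
    fine (energy p (fun x => G x - H x)) <= 4 ^- k.
  by move=> k; have [h ? ?] := near_minimisers x0 y0 al be p1 (q0 k); exists h.
(* Both [h k] and [h k.-1] enter, so that the k-th and the (k+1)-th functions are both within the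
   tolerance [h k]. *)
pose d k := Num.min (4 ^- k) (Num.min (h k) (h k.-1)).
have d0 k : 0 < d k by rewrite !lt_min q0 !h0.
have /choice[uG HuG] : forall k, exists w : ('rV[R]_n -> R) * ('rV[R]_n -> 'rV[R]_n),
    admissible p x0 y0 al be w.1 w.2 /\ fine (energy p w.2) <= m + d k.
  move=> k; have ne : has_inf (energies p x0 y0 al be).
    split; first by have [u [G adm]] := admissible_nonempty al be n0 (ltW p1) xy; exists (fine (energy p G)), u, G.
    by exists 0 => _ [v [H [_ ->]]]; exact: fine_energy_ge0.
  have [e [u [G [adm ->]]] /ltW le] := inf_adherent (d0 k) ne.
  by exists (u, G).
exists (fun k => (uG k).1), (fun k => (uG k).2); split=> k.
- by have [] := HuG k.
- have [_ /le_trans->//] := HuG k; by rewrite lerD2l ge_min lexx.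
have [a1 e1] := HuG k; have [a2 e2] := HuG k.+1.
have [hG _ _] := a1; have [hG' _ _] := a2.
rewrite (energyE (has_gradB (ltW p1) hG' hG)) lee_fin.
apply: (Hh k _ _ _ _ a2 a1).
- by rewrite (le_trans e2)// lerD2l !ge_min lexx !orbT.
- by rewrite (le_trans e1)// lerD2l !ge_min lexx !orbT.
Qed.

Lemma continuous_enormB_powR x0 (K q : R) : 0 < q ->
  continuous (fun x => K * enorm (x - x0) `^ q).
Proof.
move=> q0; have cs : continuous (fun y : 'rV[R]_n => y - x0).
  rewrite (_ : (fun y => _) = fun y => y *m 1%:M + - x0); first exact: continuous_affine.
  by apply/funext => y; rewrite mulmx1.
have cT := @continuous_enorm_powR R n _ _ q q0 cs.
by move=> y; exact: (continuousM (@cst_continuous _ _ K y) (cT y)).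
Qed.

Lemma holder_continuous (p q K : R) v : 0 < p -> 0 < q ->
  (forall x y, `|v x - v y| `^ p <= K * enorm (x - y) `^ q) -> continuous v.
Proof.
move=> p0 q0 Hv x; apply/(@cvgrPdist_lt _ _ _ (nbhs x)) => e e0.
have cT := @continuous_enormB_powR x K q q0.
have := cT x; rewrite /continuous_at subrr enorm0 powR0 ?gt_eqF// mulr0.
move=> /cvgrPdist_lt/(_ (e `^ p) (powR_gt0 _ e0)); apply: filterS => y.
rewrite sub0r normrN => /(le_lt_trans (ler_norm _)) /(le_lt_trans (Hv y x)) h.
rewrite ltNge distrC; apply/negP => ev; move: h; rewrite ltNge => /negP; apply.
by apply: ge0_ler_powR; rewrite ?nnegrE ?(ltW p0) ?(ltW e0).
Qed.

Lemma holder_estimate p x0 y0 : (0 < n)%N -> n%:R < p -> x0 != y0 ->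
  exists2 K : R, 0 <= K & forall u G x y, has_grad p u G ->
  `|u x - u y| `^ p <= K * enorm (x - y) `^ (p - n%:R) * fine (energy p G).
Proof.
move=> n0 np xy; have p1 : 1 <= p by apply: le_trans (ltW np); rewrite ler1n.
have [K K0 HK] := morrey_powR x0 y0 n0 np.
exists (K * enorm (x0 - y0) `^ (- (p - n%:R))); first by rewrite mulr_ge0 ?powR_ge0// ltW.
move=> u G x y hG; have := ratio_transport p1 np xy HK x y hG.
rewrite powRM ?enorm_ge0 ?invr_ge0 ?enorm_ge0// -powR_inv1 ?enorm_ge0// -powRrM mulN1r.
move/le_trans; apply; rewrite le_eqVlt; apply/orP; left; apply/eqP.
by congr (_ * _); rewrite -[RHS]mulrA [in RHS](mulrC (enorm (x0 - y0) `^ _)).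
Qed.

Lemma minimiser_exists p x0 y0 al be : (0 < n)%N -> n%:R < p -> x0 != y0 ->
  exists v G, admissible p x0 y0 al be v G /\
    fine (energy p G) = min_energy p x0 y0 al be.
Proof.
move=> n0 np xy.
have p1 : 1 < p by apply: le_lt_trans np; rewrite ler1n.
have p0 : 0 < p by apply: lt_trans p1.
have pn0 : 0 < p - n%:R by rewrite subr_gt0.
have [u [G [adm Em dE]]] := minimising_sequence al be n0 p1 xy.
set m := min_energy _ _ _ _ _ in Em *.
have hG k : has_grad p (u k) (G k) by have [] := adm k.
have [K K_ge0 holder] := holder_estimate n0 np xy.
have Em1 k : fine (energy p (G k)) <= m + 1.
  by rewrite (le_trans (Em k))// lerD2l invf_le1 ?exprn_gt0// exprn_ege1// ler1n.
have holderk k x y : `|u k x - u k y| `^ p <= K * (m + 1) * enorm (x - y) `^ (p - n%:R).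
  apply: le_trans (holder _ _ x y (hG k)) _.
  by rewrite mulrAC ler_wpM2r ?powR_ge0// ler_wpM2l.
(* All [u k] take the value [al] at [x0], so the estimate for the pair (x, x0) bounds the increments
   at [x] by a geometric sequence. *)
have uc x : cvgn (fun k => u k x).
  have r1 : 4^-1 `^ p^-1 < 1 :> R.
    rewrite -[ltRHS](congr1 (fun f => f p^-1) (@powR1 R)).
    by rewrite gt0_ltr_powR ?invr_gt0// ?nnegrE ?invr_ge0// invf_lt1// ltr1n.
  apply: (geometric_cvg (powR_ge0 4^-1 p^-1) r1) => k.
  apply: (powR_root_le p0 (normr_ge0 _) (mulr_ge0 K_ge0 (powR_ge0 (enorm (x - x0)) (p - n%:R)))).
    by rewrite invr_ge0.
  have hB := has_gradB (ltW p1) (hG k.+1) (hG k).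
  have := holder _ _ x x0 hB.
  have [_ -> _] := adm k; have [_ -> _] := adm k.+1; rewrite subrr subr0 => /le_trans; apply.
  rewrite ler_wpM2l ?mulr_ge0 ?powR_ge0// -lee_fin -(energyE hB) exprVn; exact: dE.
pose v x := limn (fun k => u k x).
have uv x : u k x @[k --> \oo] --> v x by exact: uc.
have holderv x y : `|v x - v y| `^ p <= K * (m + 1) * enorm (x - y) `^ (p - n%:R).
  have cu : u k x - u k y @[k --> \oo] --> v x - v y by apply: cvgB; exact: uv.
  have cp := cvg_comp _ _ cu (@continuous_norm_powR R p p0 (v x - v y)).
  rewrite -(cvg_lim _ cp)//; apply: limr_le; first by apply/cvg_ex; eexists; exact: cp.
  by apply: nearW => k; exact: holderk.
have cv := holder_continuous p0 pn0 holderv.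
(* Common envelope: the fixed value at [x0] plus the common Hoelder bound, with t <= 1 + t^p
   removing the root. *)
pose B x := `|al| + 1 + K * (m + 1) * enorm (x - x0) `^ (p - n%:R).
have cB : continuous B.
  by move=> y; exact: (continuousD (@cst_continuous _ _ (`|al| + 1) y) (@continuous_enormB_powR x0 (K * (m + 1)) _ pn0 y)).
have uB k x : `|u k x| <= B x.
  have [_ ux _] := adm k; rewrite -[u k x](subrK (u k x0)) (le_trans (ler_normD _ _))// ux addrC.
  rewrite /B -addrA lerD2l (le_trans (powR_le1D (ltW p1) (normr_ge0 _)))// lerD2l -ux.
  exact: holderk.
have mG k : measurable_fun setT (G k) by have [] := hG k.
have [_ _ G0 _] := hG 0%N.
have [L mL [g Ig aeG]] := fast_gradient_cvg (ltW p1) mG G0 dE.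
have [hv cE] := has_grad_limit (ltW p1) hG cv uv cB uB mL Ig aeG.
exists v, L.
have admv : admissible p x0 y0 al be v L.
  split=> //; rewrite /v.
    have -> : (fun k => u k x0) = (fun=> al) by apply/funext => k; have [_ ->] := adm k.
    exact: lim_cst.
  have -> : (fun k => u k y0) = (fun=> be) by apply/funext => k; have [_ _ ->] := adm k.
  exact: lim_cst.
split=> //; apply: le_anti; rewrite (min_energy_le admv) andbT.
have c4 : m + 4 ^- k @[k --> \oo] --> m + 0.
  apply: cvgD; first exact: cvg_cst.
  under eq_fun do rewrite -exprVn.
  by apply: cvg_expr; rewrite ger0_norm ?invr_ge0// invf_lt1// ltr1n.
rewrite addr0 in c4; rewrite -(cvg_lim _ cE)// -[leRHS](cvg_lim _ c4)//.
by apply: ler_lim; [apply/cvg_ex; eexists; exact: cE|apply/cvg_ex; eexists; exact: c4|exact: nearW].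
Qed.

End minimiser.

(** * From minimal energy to the sharp Hoelder bound *)

Section extremal.
Context {R : realType} {n : nat}.
Implicit Types (u v : 'rV[R]_n -> R) (G H : 'rV[R]_n -> 'rV[R]_n) (p : R) (x y : 'rV[R]_n).

(* An affine function of [u] is admissible as soon as [u x0 != u y0]. *)
Lemma min_energy_ratio p x0 y0 al be u G : 1 <= p -> has_grad p u G ->
  `|u x0 - u y0| `^ p * min_energy p x0 y0 al be <= `|al - be| `^ p * fine (energy p G).
Proof.
move=> p1 hG; have p0 : 0 < p by apply: lt_le_trans p1.
have [/eqP uxy|d0] := eqVneq (u x0 - u y0) 0.
  move/eqP : uxy => ->; rewrite normr0 powR0 ?gt_eqF// mul0r.
  by rewrite mulr_ge0 ?powR_ge0// fine_energy_ge0.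
set d := u x0 - u y0 in d0 *.
have dp : 0 < `|d| `^ p by rewrite powR_gt0// normr_gt0.
pose a := (al - be) / d.
have adm : admissible p x0 y0 al be (fun x => (be - a * u y0) + a * u x) (fun x => a *: G x).
  split; first exact: has_grad_affine.
  - by rewrite -addrA -mulrN -mulrDr (addrC (- _)) -/d divfK// subrKC.
  - by rewrite subrK.
have [_ mG _ _] := hG.
have := min_energy_le adm; rewrite energyZ// (energyE hG) -EFinM /=.
rewrite /a normrM normfV powRM ?invr_ge0// -[`|d|^-1]powR_inv1// -powRrM mulN1r powRN.
rewrite mulrAC ler_pdivlMr// mulrC; exact.
Qed.

(** Morrey's inequality for the pair, applied to the minimiser, bounds |al - be|^p by a multiple of
    the minimal energy. *)
Lemma min_energy_gt0 p x0 y0 al be : (0 < n)%N -> n%:R < p -> x0 != y0 -> al != be ->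
  0 < min_energy p x0 y0 al be.
Proof.
move=> n0 np xy ab.
have p1 : 1 <= p by apply: le_trans (ltW np); rewrite ler1n.
have [v [L [[hv vx vy] <-]]] := minimiser_exists al be n0 np xy.
have [K K0 HK] := morrey_powR x0 y0 n0 np.
have := HK _ _ hv; rewrite vx vy => h.
rewrite -(pmulr_rgt0 _ K0); apply: lt_le_trans h.
by rewrite powR_gt0// normr_gt0 subr_eq0.
Qed.

(** Minimality is an estimate at (x0, y0) with constant |al - be|^p / m; it is transported to (x, y)
    and its p-th root is taken. *)
Lemma holder_ratio_le p (x0 y0 : 'rV[R]_n) (al be : R) u G x y : 1 <= p -> n%:R < p -> x0 != y0 ->
  0 < min_energy p x0 y0 al be -> has_grad p u G -> x != y ->
  holder_ratio p u x y <=
  `|al - be| / min_energy p x0 y0 al be `^ p^-1 / enorm (x0 - y0) `^ (1 - n%:R / p)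
  * fine (energy p G) `^ p^-1.
Proof.
move=> p1 np xy0 m0 hG xy; set m := min_energy _ _ _ _ _ in m0 *.
have p0 : 0 < p by apply: lt_le_trans p1.
have dist_gt0 (z w : 'rV[R]_n) : z != w -> 0 < enorm (z - w).
  by move=> zw; rewrite lt_neqAle enorm_ge0 eq_sym enorm_eq0 subr_eq0 zw.
have d0 := dist_gt0 _ _ xy0; have w0 := dist_gt0 _ _ xy.
have HK v H : has_grad p v H ->
    `|v x0 - v y0| `^ p <= `|al - be| `^ p / m * fine (energy p H).
  move=> hH; have := min_energy_ratio x0 y0 al be p1 hH.
  by rewrite -ler_pdivlMr// mulrAC.
have := ratio_transport p1 np xy0 HK x y hG.
set g := 1 - n%:R / p; set E := fine _; set l := enorm (x - y) / _.
have E0 : 0 <= E by exact: fine_energy_ge0.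
have l0 : 0 < l by rewrite divr_gt0.
(* Since p - n = (1 - n/p) p, the right-hand side is an exact p-th power. *)
have pg : (p - n%:R) = g * p by rewrite /g mulrBl mul1r divfK ?gt_eqF.
have -> : `|al - be| `^ p / m * l `^ (p - n%:R) * E =
    (`|al - be| / m `^ p^-1 * l `^ g * E `^ p^-1) `^ p.
  have m1 : 0 <= (m `^ p^-1)^-1 by rewrite invr_ge0 powR_ge0.
  have mE : (m `^ p^-1)^-1 `^ p = m^-1.
    by rewrite -powRN -powRrM mulNr mulVf ?gt_eqF// powR_inv1// ltW.
  have EE : (E `^ p^-1) `^ p = E by rewrite -powRrM mulVf ?gt_eqF// powRr1.
  rewrite (powRM _ (mulr_ge0 (mulr_ge0 (normr_ge0 _) m1) (powR_ge0 _ _)) (powR_ge0 _ _)).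
  rewrite (powRM _ (mulr_ge0 (normr_ge0 _) m1) (powR_ge0 _ _)) (powRM _ (normr_ge0 _) m1).
  by rewrite mE EE -[(l `^ g) `^ p]powRrM -pg.
move=> h.
have {}h : `|u x - u y| <= `|al - be| / m `^ p^-1 * l `^ g * E `^ p^-1.
  rewrite leNgt; apply/negP => lt; move: h; rewrite leNgt => /negP; apply.
  apply: gt0_ltr_powR; rewrite ?nnegrE ?mulr_ge0 ?powR_ge0 ?invr_ge0 ?powR_ge0//.
rewrite /holder_ratio ler_pdivrMr ?powR_gt0//; apply: le_trans h _.
rewrite /l powRM ?invr_ge0 ?(ltW w0) ?(ltW d0)//.
rewrite -[(enorm (x0 - y0))^-1]powR_inv1 ?(ltW d0)// -powRrM mulN1r powRN.
rewrite le_eqVlt; apply/orP; left; apply/eqP.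
move: (enorm _ `^ g) (enorm _ `^ g)^-1 (m `^ _)^-1 (E `^ _) `|_| => *; ring.
Qed.

End extremal.

Theorem corollary2p2 (R : realType) (n : nat) (p : R)
  (n_ge1 : (1 <= n)%N) (np : n%:R < p)
  (x0 y0 : 'rV[R]_n) (alpha beta : R) :
  x0 != y0 -> alpha != beta ->
  exists u : 'rV[R]_n -> R,
    [/\ extremal p u, u x0 = alpha, u y0 = beta &
        holder_seminorm p u = (holder_ratio p u x0 y0)%:E].
Proof.
move=> xy ab.
have p1 : 1 <= p by apply: le_trans (ltW np); rewrite ler1n.
have p0 : 0 < p by apply: lt_le_trans p1.
have [v [L [[hv vx vy] Lm]]] := minimiser_exists alpha beta n_ge1 np xy.
have m0 := min_energy_gt0 n_ge1 np xy ab.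
have ratio := holder_ratio_le p1 np xy m0.
set m := min_energy _ _ _ _ _ in Lm m0 ratio.
have mp : 0 < m `^ p^-1 by rewrite powR_gt0.
(* The candidate for the sharp constant; [Cm] says that the minimiser attains equality at [x0] and
   [y0]. *)
set C := _ / _ / _ in ratio.
have Cm : C * m `^ p^-1 = holder_ratio p v x0 y0.
  by rewrite /C /holder_ratio vx vy mulrAC divfK ?gt_eqF.
have gradE (u : 'rV[R]_n -> R) G : has_grad p u G -> grad_norm p u = (fine (energy p G) `^ p^-1)%:E.
  by move=> hG; rewrite (grad_normE n_ge1 p1 hG) (energyE hG) poweR_EFin.
have seminorm_le (u : 'rV[R]_n -> R) G : has_grad p u G ->
    (holder_seminorm p u <= (C * fine (energy p G) `^ p^-1)%:E)%E.
  move=> hG; apply: ge_ereal_sup => _ [x [y [xy' ->]]]; rewrite lee_fin; exact: ratio.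
have seminorm_ge (u : 'rV[R]_n -> R) : ((holder_ratio p u x0 y0)%:E <= holder_seminorm p u)%E.
  by apply: ereal_sup_ubound; exists x0, y0.
have seminormE : holder_seminorm p v = (holder_ratio p v x0 y0)%:E.
  apply/eqP; rewrite eq_le seminorm_ge andbT -Cm -Lm; exact: seminorm_le.
have Dv : D1p p v by exact: has_grad_D1p p1 hv.
(* [C] is a Morrey bound by [seminorm_le]. Conversely, testing any bound [C'] on the minimiser and
   cancelling the positive m^(1/p) gives C <= C'. *)
have sharp : morrey_constant n p = C%:E.
  apply/eqP; rewrite eq_le; apply/andP; split.
    apply: ereal_inf_lbound; exists C => // u /(D1p_has_grad p1)[G hG].
    rewrite (gradE _ _ hG) -EFinM; exact: seminorm_le.
  apply: le_ereal_inf_tmp => _ [C' /(_ v Dv) HC' <-].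
  move: HC'; rewrite seminormE (gradE _ _ hv) -EFinM !lee_fin Lm -Cm.
  by rewrite ler_pM2r.
exists v; split=> //; split=> //.
by rewrite sharp seminormE (gradE _ _ hv) -EFinM Lm Cm.
Qed.
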